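(* Let $V$ be an $L_\infty$-algebra and $A$ a formal cdga. A deformation of the $L_\infty$-algebra $V$ over $A$ which is trivial as a deformation of $V$ as a curved $L_\infty$-algebra is always given by a twisting with some MC-element $\xi\in\mathrm{MC}(V,A)$.
   Context: Conventions. All vector spaces are $\mathbb Z/2$-graded over a field $\mathbf k$ of characteristic $0$; $\Pi$ is parity reversion; unmarked $\otimes$ is over $\mathbf k$; the Koszul sign rule is used throughout. A formal space is an inverse limit of finite-dimensional spaces, and maps from/into formal spaces are continuous; $V^*$ is formal for $V$ discrete. If $V$ is discrete and $W=\varprojlim W_i$ formal then $W\otimes V:=\varprojlim W_i\otimes V$. A formal cdga is $A=\mathbf k\oplus A_+$, obtained by adjoining a unit to an inverse limit $A_+$ of finite-dimensional nilpotent non-unital ($\mathbb Z/2$-graded, commutative) cdgas. An $L_\infty$-structure on $V$ is a continuous odd derivation $m$ of the completed symmetric algebra $\hat S\Pi V^*$ with $m^2=0$ and no constant term (the component of $m|_{\Pi V^*}$ in $S^0$ vanishes); dropping the condition on the constant term gives a curved $L_\infty$-structure. The duals of the components of $m|_{\Pi V^*}$ are the structure maps $m_i:S^i\Pi V\to\Pi V$, where $(S^n\Pi V)^*=((\Pi V^* )^{\hat\otimes n})^{S_n}$ is identified with the coinvariants $S^n\Pi V^*$ by $x_1\otimes\cdots\otimes x_n\mapsto\frac1{n!}x_1\otimes\cdots\otimes x_n$. $\mathrm{CE}(V,V)$ is the dgla of continuous derivations of $\hat S\Pi V^*$ with commutator bracket and differential given by the commutator with $m$, taken as $[m,-]$;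 $\overline{\mathrm{CE}}(V,V)$ is the sub-dgla of derivations with no constant term. For a dgla $\mathfrak g$, $\mathrm{MC}(\mathfrak g,A)$ is the set of odd $x\in A_+\otimes\mathfrak g$ (completed tensor product) with $(d_A+d_{\mathfrak g})x+\frac12[x,x]=0$. Two elements $x_0,x_1\in\mathrm{MC}(\mathfrak g,A)$ are gauge equivalent if there is $X\in\mathrm{MC}(\mathfrak g[z,dz],A)$, where $\mathfrak g[z,dz]=\mathfrak g\otimes\mathbf k[z,dz]$ with $\mathbf k[z,dz]$ the polynomial de Rham algebra of the interval, such that $X|_{z=0}=x_0$ and $X|_{z=1}=x_1$. A deformation of the $L_\infty$-algebra $V$ over $A$ is an MC-element in $A_+\otimes\overline{\mathrm{CE}}(V,V)$; a deformation of $V$ as a curved $L_\infty$-algebra over $A$ is an MC-element in $A_+\otimes\mathrm{CE}(V,V)$; in both cases two deformations are called equivalent if the corresponding MC-elements are gauge equivalent (in the respective dgla), and a deformation is trivial if it is equivalent to $0$. A deformation of $V$ as an $L_\infty$-algebra is regarded as a deformation of $V$ as a curved $L_\infty$-algebra via the inclusion $\overline{\mathrm{CE}}(V,V)\subset\mathrm{CE}(V,V)$. $\mathrm{MC}(V,A)$ is the set of even $\xi\in A_+\otimes\Pi V$ with $(d_A\otimes\mathrm{id})(\xi)+\sum_{i\ge1}\frac1{i!}m_i^A(\xi^{\otimes i})=0$, where $m^A=\mathrm{id}_A\otimes m$ and $m_i^A$ is the $A$-multilinear extension of $m_i$. Twisting by $\xi\in\mathrm{MC}(V,A)$ means passing from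 $m$ to the $A$-linear $L_\infty$-structure $m^\xi$ on $V$ (an $A$-linear derivation of $A\otimes\hat S\Pi V^*$) with structure maps $m_n^\xi(x_1,\ldots,x_n)=\sum_{i\ge0}\frac1{i!}m^A_{n+i}(\xi,\ldots,\xi,x_1,\ldots,x_n)$, $n\ge1$; the corresponding deformation of $V$ over $A$ is $m^\xi-m^A\in\mathrm{MC}(\overline{\mathrm{CE}}(V,V),A)$.
   Formalization: ''Given by a twisting'' is taken up to equivalence of deformations of the L∞-algebra: the deformation is gauge equivalent (without constant terms) to m^ξ − m^A; literal equality fails, e.g. V=k, m=0, A₊ spanned by a and da with zero products. *)

(* Defs.v *)
From HB Require Import structures.
From mathcomp Require Import all_boot all_order all_algebra.
From mathcomp Require Import boolp classical_sets functions cardinality fsbigop.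

Set Implicit Arguments.
Unset Strict Implicit.
Unset Printing Implicit Defensive.

Import GRing.Theory.
Local Open Scope ring_scope.

(* Z/2-gradings are given by the projections [p false], [p true] onto the even
   and odd parts. [ksgn p b x] is (-1)^(b |x|) x, the Koszul sign for moving
   something of parity b past x, extended linearly to inhomogeneous x. *)
Definition ksgn (M : zmodType) (p : bool -> M -> M) (b : bool) (x : M) : M :=
  if b then p false x - p true x else x.

Record superspace (k : fieldType) := Superspace {
  svec :> lmodType k;
  sprj : bool -> {linear svec -> svec};
  sprjK : forall b c v, sprj b (sprj c v) = if b == c then sprj c v else 0;
  sprjD : forall v, sprj false v + sprj true v = v }.

Section Parity_reversion.
Variables (k : fieldType) (V : superspace k).

Fact Pi_prjK (b c : bool) (v : V) :
  sprj V (~~ b) (sprj V (~~ c) v) = if b == c then sprj V (~~ c) v else 0.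
Proof. by rewrite sprjK; case: b; case: c. Qed.

Fact Pi_prjD (v : V) : sprj V (~~ false) v + sprj V (~~ true) v = v.
Proof. by rewrite addrC sprjD. Qed.

Definition Pi : superspace k :=
  @Superspace k V (fun b => sprj V (~~ b)) Pi_prjK Pi_prjD.
End Parity_reversion.

(* The completed symmetric algebra of U^*. Its degree n part is the space of
   S_n-invariants of the completed n-th tensor power of U^*, i.e. of graded
   symmetric n-linear forms on U (invariants being identified with coinvariants
   by t |-> t / n!). So an element is a function on finite sequences of vectors
   of U, its degree n component being the restriction to sequences of size n. *)
Section Completed_symmetric_algebra.
Variables (k : fieldType) (U : superspace k).
Implicit Types (f g : seq U -> k^o) (s t : seq U).

Notation usgn := (ksgn (sprj U)).

Definition multilinear f := forall s t (a : k) (u v : U),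
  f (s ++ (a *: u + v) :: t) = a * f (s ++ u :: t) + f (s ++ v :: t).

Definition gsymmetric f := forall s t (b c : bool) (u v : U),
  f (s ++ sprj U b u :: sprj U c v :: t) =
  (-1) ^+ (b && c) * f (s ++ sprj U c v :: sprj U b u :: t).

Definition symform : {pred (seq U -> k^o)} :=
  fun f => `[< multilinear f /\ gsymmetric f >].

Lemma symformP f : reflect (multilinear f /\ gsymmetric f) (f \in symform).
Proof. exact: asboolP. Qed.

Fact symform_submod_closed : submod_closed symform.
Proof.
split=> [|a f g /symformP[fl fs] /symformP[gl gs]]; apply/symformP; split.
- by move=> s t a u v /=; rewrite mulr0 addr0.
- by move=> s t b c u v /=; rewrite mulr0.
- move=> s t c u v; rewrite !fctE fl gl !scalerDr.
  by rewrite mulrDr addrACA /GRing.scale /= !mulrA (mulrC a c).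
- move=> s t b c u v; rewrite !fctE fs gs mulrDr /GRing.scale /=.
  by rewrite !mulrA (mulrC a).
Qed.

HB.instance Definition _ :=
  GRing.isSubmodClosed.Build k (seq U -> k^o) symform symform_submod_closed.

Record Shat := MkShat { Shat_fun :> seq U -> k^o; _ : Shat_fun \in symform }.

HB.instance Definition _ := [isSub for Shat_fun].
HB.instance Definition _ := [Choice of Shat by <:].
HB.instance Definition _ := [SubChoice_isSubLmodule of Shat by <:].

Lemma Shat_symform (f : Shat) : (f : seq U -> k^o) \in symform.
Proof. by case: f. Qed.

(* f o (ksgn b)^(x n), which is (-1)^(b |f|) f *)
Definition form_sgn (b : bool) f : seq U -> k^o := fun s => f (map (usgn b) s).

(* (f g)(v :: s) = (f . (g v))(s) + (-1)^(|g||v|) ((f v) . g)(s), where f v is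
   the contraction t |-> f (v :: t). Unfolded, this is the sum over all
   shuffles s ~ (I, J) of +- f(I) g(J) with the Koszul sign of f g s |-> f I g J. *)
Fixpoint form_mul s f g : k^o :=
  if s is v :: s' then
    form_mul s' f (fun t => g (v :: t)) +
    \sum_(b : bool) form_mul s' (fun t => f (sprj U b v :: t)) (form_sgn b g)
  else f [::] * g [::].

Fact form_mulDl s (a : k) f f' g :
  form_mul s (fun t => a * f t + f' t) g =
  a * form_mul s f g + form_mul s f' g.
Proof.
elim: s f f' g => [|v s IH] f f' g /=; first by rewrite mulrDl mulrA.
rewrite IH mulrDr addrACA; congr (_ + _); rewrite big_distrr -big_split /=.
by apply: eq_bigr => b _; rewrite IH.
Qed.

Fact form_mulDr s (a : k) f g g' :
  form_mul s f (fun t => a * g t + g' t) =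
  a * form_mul s f g + form_mul s f g'.
Proof.
elim: s f g g' => [|v s IH] f g g' /=.
  by rewrite mulrDr !mulrA (mulrC a).
rewrite IH mulrDr addrACA; congr (_ + _); rewrite big_distrr -big_split /=.
by apply: eq_bigr => b _; rewrite -IH.
Qed.

Fact form_mul0l s g : form_mul s (fun=> 0) g = 0.
Proof.
elim: s g => [|v s IH] g /=; first exact: mul0r.
by rewrite IH add0r big1 // => b _; rewrite IH.
Qed.

Fact form_mulZl s (a : k) f g :
  form_mul s (fun t => a * f t) g = a * form_mul s f g.
Proof.
rewrite -[RHS]addr0 -(form_mul0l s g) -form_mulDl; congr form_mul.
by apply: funext => t; rewrite addr0.
Qed.

Fact form_mul0r s f : form_mul s f (fun=> 0) = 0.
Proof.
elim: s f => [|v s IH] f /=; first exact: mulr0.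
by rewrite IH add0r big1 // => b _; exact: IH.
Qed.

Fact form_mulZr s (a : k) f g :
  form_mul s f (fun t => a * g t) = a * form_mul s f g.
Proof.
rewrite -[RHS]addr0 -(form_mul0r s f) -form_mulDr; congr form_mul.
by apply: funext => t; rewrite addr0.
Qed.

Fact usgn_linear (b : bool) : linear (usgn b).
Proof.
move=> a u v; rewrite /ksgn; case: b => //.
by rewrite 2!linearP /= opprD addrACA scalerBr.
Qed.

Fact usgn_prj (b c : bool) (u : U) :
  usgn b (sprj U c u) = (-1) ^+ (b && c) *: sprj U c u.
Proof.
rewrite /ksgn; case: b; last by rewrite scale1r.
by rewrite !sprjK; case: c;
  rewrite /= ?expr1 ?expr0 ?scaleN1r ?scale1r ?subr0 ?sub0r.
Qed.

Fact prj_usgn (b c : bool) (u : U) :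
  sprj U c (usgn b u) = (-1) ^+ (b && c) *: sprj U c u.
Proof.
rewrite /ksgn; case: b; last by rewrite scale1r.
by rewrite raddfB /= !sprjK; case: c;
  rewrite /= ?expr1 ?expr0 ?scaleN1r ?scale1r ?subr0 ?sub0r.
Qed.

Fact multilinear0 f s t : multilinear f -> f (s ++ 0 :: t) = 0.
Proof.
move=> fl; have := fl s t 1 0 0; rewrite scale1r addr0 mul1r => /eqP.
by rewrite -subr_eq0 opprD addrA subrr sub0r oppr_eq0 => /eqP.
Qed.

Fact multilinearZ f s t (a : k) (u : U) : multilinear f ->
  f (s ++ a *: u :: t) = a * f (s ++ u :: t).
Proof.
by move=> fl; rewrite -[a *: u]addr0 fl (multilinear0 _ _ fl) addr0.
Qed.

Fact multilinear_contract f v :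
  multilinear f -> multilinear (fun t => f (v :: t)).
Proof. by move=> fl s t a u w; exact: (fl (v :: s)). Qed.

Fact gsymmetric_contract f v :
  gsymmetric f -> gsymmetric (fun t => f (v :: t)).
Proof. by move=> fs s t b c u w; exact: (fs (v :: s)). Qed.

Fact multilinear_sgn b f : multilinear f -> multilinear (form_sgn b f).
Proof.
by move=> fl s t a u v; rewrite /form_sgn !map_cat /= usgn_linear fl.
Qed.

Fact gsymmetric_sgn b f :
  multilinear f -> gsymmetric f -> gsymmetric (form_sgn b f).
Proof.
move=> fl fs s t c d u v; rewrite /form_sgn !map_cat /= !usgn_prj.
have flZ a a' w w' s' t' :
    f (s' ++ a *: w :: a' *: w' :: t') = a * a' * f (s' ++ w :: w' :: t').
  rewrite multilinearZ // -cat_rcons multilinearZ // cat_rcons.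
  by rewrite mulrA.
by rewrite !flZ fs mulrCA [_ ^+ (b && d) * _]mulrC.
Qed.

Fact form_mul_multilinear f g :
  multilinear f -> multilinear g -> multilinear (fun s => form_mul s f g).
Proof.
move=> fl gl s; elim: s f g fl gl => [|w s IH] f g fl gl t a u v /=.
  rewrite mulrDr addrACA -form_mulDr; congr (_ + _).
    by congr form_mul; apply: funext => r; rewrite (gl [::]).
  rewrite big_distrr -big_split /=; apply: eq_bigr => b _.
  rewrite -form_mulDl; congr form_mul; apply: funext => r.
  by rewrite linearP (fl [::]).
rewrite IH //; last exact: multilinear_contract.
rewrite mulrDr addrACA; congr (_ + _).
rewrite big_distrr -big_split /=; apply: eq_bigr => b _.
by rewrite IH //; [exact: multilinear_contract|exact: multilinear_sgn].
Qed.

Fact form_mul_cons_prj (b : bool) (u : U) s f g : multilinear f ->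
  form_mul (sprj U b u :: s) f g =
  form_mul s f (fun t => g (sprj U b u :: t)) +
  form_mul s (fun t => f (sprj U b u :: t)) (form_sgn b g).
Proof.
move=> fl /=; rewrite (bigD1 b) //= sprjK eqxx [X in _ + (_ + X)]big1 ?addr0 //.
move=> c cb; rewrite sprjK (negbTE cb) -[RHS](form_mul0l s (form_sgn c g)).
by congr form_mul; apply: funext => t; exact: (multilinear0 [::]).
Qed.

Fact form_mul_gsymmetric f g :
  multilinear f -> gsymmetric f -> multilinear g -> gsymmetric g ->
  gsymmetric (fun s => form_mul s f g).
Proof.
move=> fl fs gl gs s.
elim: s f g fl fs gl gs => [|w s IH] f g fl fs gl gs t b c u v.
  rewrite !cat0s !form_mul_cons_prj //; try exact: multilinear_contract.
  have sgnE d e z : (fun r => form_sgn d g (sprj U e z :: r)) =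
      (fun r => (-1) ^+ (d && e) * form_sgn d (fun r => g (sprj U e z :: r)) r).
    apply: funext => r; rewrite /form_sgn /= usgn_prj.
    exact: (multilinearZ [::]).
  rewrite !sgnE !form_mulZr.
  have gE : (fun r => g (sprj U b u :: sprj U c v :: r)) =
      (fun r => (-1) ^+ (b && c) * g (sprj U c v :: sprj U b u :: r)).
    by apply: funext => r; exact: (gs [::]).
  have fE : (fun r => f (sprj U b u :: sprj U c v :: r)) =
      (fun r => (-1) ^+ (b && c) * f (sprj U c v :: sprj U b u :: r)).
    by apply: funext => r; exact: (fs [::]).
  have sgnC : form_sgn c (form_sgn b g) = form_sgn b (form_sgn c g).
    apply: funext => r; rewrite /form_sgn -!map_comp; congr g.
    by apply: eq_map => z /=; case: b {gE fE sgnE}; case: c.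
  rewrite gE fE form_mulZr form_mulZl sgnC (andbC c b) !mulrDr.
  rewrite !mulrA -expr2 sqrr_sign mul1r.
  by rewrite addrACA.
rewrite /= IH //; try exact: multilinear_contract;
  try exact: gsymmetric_contract.
rewrite mulrDr big_distrr /=; congr (_ + _); apply: eq_bigr => d _.
by rewrite IH //; [exact: multilinear_contract | exact: gsymmetric_contract
  | exact: multilinear_sgn | exact: gsymmetric_sgn].
Qed.

Fact symform_mul (f g : Shat) : (fun s => form_mul s f g) \in symform.
Proof.
have [[fl fs] [gl gs]] := (symformP _ (Shat_symform f), symformP _ (Shat_symform g)).
by apply/symformP; split; [exact: form_mul_multilinear|exact: form_mul_gsymmetric].
Qed.

Definition Shat_mul (f g : Shat) : Shat := MkShat (symform_mul f g).

Fact symform_sgn b (f : Shat) : form_sgn b f \in symform.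
Proof.
have [fl fs] := symformP _ (Shat_symform f).
by apply/symformP; split; [exact: multilinear_sgn|exact: gsymmetric_sgn].
Qed.

Definition Shat_sgn b (f : Shat) : Shat := MkShat (symform_sgn b f).

Definition Shat_prj (b : bool) (f : Shat) : Shat :=
  2^-1 *: (f + (-1) ^+ b *: Shat_sgn true f).

End Completed_symmetric_algebra.

Section Derivations.
Variables (k : fieldType) (U : superspace k).
Notation S := (Shat U).
Implicit Types (D E : S -> S).

Definition End_prj (b : bool) D : S -> S :=
  fun f => \sum_(c : bool) Shat_prj (b (+) c) (D (Shat_prj c f)).

Definition commutator D E : S -> S :=
  \sum_(b : bool) \sum_(c : bool)
    (End_prj b D \o End_prj c E - (-1) ^+ (b && c) *: (End_prj c E \o End_prj b D)).

(* Shat U is the dual of a discrete space, with the topology of pointwise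
   convergence; a linear D is continuous iff each f |-> D f s only depends on
   finitely many values of f. *)
Definition pointwise_continuous D := forall s : seq U,
  exists L : seq (seq U), forall f : S,
    (forall t, t \in L -> f t = 0) -> D f s = 0.

Definition derivation (b : bool) D := forall f g,
  D (Shat_mul f g) = Shat_mul (D f) g + Shat_mul (Shat_sgn b f) (D g).

Definition CE : set (S -> S) := [set D |
  [/\ linear D, pointwise_continuous D & forall b, derivation b (End_prj b D)]].

Definition linear_form (f : S) := forall s, size s != 1%N -> f s = 0.

Definition CEbar : set (S -> S) :=
  [set D | CE D /\ forall f, linear_form f -> D f [::] = 0].

(* The maps D_n : S^n U -> U dual to the components of the restriction of D to
   U^*, all n at once. The dual is the contragredient one, for which D acts as a
   derivation on the pairing: (D x)(s) = - (-1)^(|D||x|) x(D_n s). This sign makes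
   d_A xi + sum_i m_i(xi^i) / i! the obstruction to m^xi - m being Maurer-Cartan:
   up to sign it is the constant term of d_A + m conjugated by the translation
   by xi. The vector D_n s exists for D in CE, by continuity, and is unique. *)
Definition str_prj (b : bool) D (s : seq U) : U := xget 0 [set u : U |
  forall x : S, linear_form x ->
    End_prj b D x s = - x [:: ksgn (sprj U) b u]].

Definition str D (s : seq U) : U := \sum_(b : bool) str_prj b D s.

End Derivations.

Record linf_algebra (k : fieldType) := LinfAlgebra {
  lvec :> superspace k;
  ldif : Shat (Pi lvec) -> Shat (Pi lvec);
  ldif_CEbar : CEbar ldif;
  ldif_odd : End_prj true ldif = ldif;
  ldif_sq : forall f, ldif (ldif f) = 0 }.
Arguments ldif {k} l _.

(* The operations of a dgla. Sub-dglas are given by their underlying subspaces,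
   and the operations are only relevant there. *)
Record dgla_ops (k : fieldType) := DglaOps {
  gvec :> lmodType k;
  gprj : bool -> gvec -> gvec;
  gbra : gvec -> gvec -> gvec;
  gdif : gvec -> gvec }.

Definition CE_ops (k : fieldType) (V : linf_algebra k) : dgla_ops k :=
  @DglaOps k (Shat (Pi V) -> Shat (Pi V)) (@End_prj k (Pi V))
    (@commutator k (Pi V)) (commutator (ldif V)).

(* g[z,dz]: the pair (p, q) of sequences of coefficients stands for
   sum_n p_n z^n + sum_n q_n z^n dz, where elements of g are written to the left
   of those of k[z,dz]. *)
Section Polynomial_forms.
Variables (k : fieldType) (g : dgla_ops k).
Implicit Types (p q : nat -> g) (P Q : (nat -> g) * (nat -> g)).

Definition coef_bra p q : nat -> g :=
  fun n => \sum_(i < n.+1) gbra (p i) (q (n - i)%N).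

Definition gsgn : g -> g := ksgn (@gprj k g) true.

Definition zdz_prj (b : bool) P : (nat -> g) * (nat -> g) :=
  (gprj b \o P.1, gprj (~~ b) \o P.2).

Definition zdz_bra P Q : (nat -> g) * (nat -> g) :=
  (coef_bra P.1 Q.1, coef_bra P.1 Q.2 + coef_bra P.2 (gsgn \o Q.1)).

Definition zdz_dif P : (nat -> g) * (nat -> g) :=
  (@gdif k g \o P.1,
   fun n => gdif (P.2 n) + gsgn (P.1 n.+1 *+ n.+1)).

Definition zdz_ops : dgla_ops k :=
  @DglaOps k ((nat -> g) * (nat -> g))%type zdz_prj zdz_bra zdz_dif.

Definition zdz_sub (h : set g) : set zdz_ops := [set P |
  (forall n, h (P.1 n) /\ h (P.2 n)) /\
  exists N, forall n, (N <= n)%N -> P.1 n = 0 /\ P.2 n = 0].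

Definition zdz_eval (c : k) (P : zdz_ops) : g :=
  \sum_(n \in [set: nat]) c ^+ n *: P.1 n.

End Polynomial_forms.

(* A (x) M for a finite-dimensional A, in coordinates with respect to the basis
   [vbasis {:A}] of A. *)
Notation tensor A M := {ffun 'I_(\dim {:A}) -> M}.

Section Tensor.
Variables (k : fieldType) (A : vectType k).

Definition pure (M : lmodType k) (a : A) (v : M) : tensor A M :=
  [ffun j => coord (vbasis {:A}) j a *: v].

Definition tlift (M W : lmodType k) (h : A -> M -> W) (X : tensor A M) : W :=
  \sum_(j < \dim {:A}) h (vbasis {:A})`_j (X j).

Definition tprj (pA : bool -> A -> A) (M : lmodType k) (pM : bool -> M -> M)
    (b : bool) : tensor A M -> tensor A M :=
  tlift (fun a v => \sum_(c : bool) pure (pA (b (+) c) a) (pM c v)).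

End Tensor.

Definition tmap (k : fieldType) (A B : vectType k) (M : lmodType k)
    (phi : A -> B) : tensor A M -> tensor B M :=
  tlift (fun a v => pure (phi a) v).

Record nil_cdga (k : fieldType) := NilCdga {
  avec :> vectType k;
  aprj : bool -> {linear avec -> avec};
  amul : avec -> avec -> avec;
  adif : {linear avec -> avec};
  aprjK : forall b c x, aprj b (aprj c x) = if b == c then aprj c x else 0;
  aprjD : forall x, aprj false x + aprj true x = x;
  amulPl : forall (c : k) x y z, amul (c *: x + y) z = c *: amul x z + amul y z;
  amulPr : forall (c : k) x y z, amul x (c *: y + z) = c *: amul x y + amul x z;
  amulA : forall x y z, amul x (amul y z) = amul (amul x y) z;
  amul_prj : forall b c x y,
    aprj (b (+) c) (amul (aprj b x) (aprj c y)) = amul (aprj b x) (aprj c y);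
  amulC : forall b c x y,
    amul (aprj b x) (aprj c y) = (-1) ^+ (b && c) *: amul (aprj c y) (aprj b x);
  adif_prj : forall b x, adif (aprj b x) = aprj (~~ b) (adif x);
  adifM : forall x y, adif (amul x y) =
    amul (adif x) y + amul (ksgn (fun b => aprj b) true x) (adif y);
  adif_sq : forall x, adif (adif x) = 0;
  amul_nil : exists N, forall x (s : seq avec), (N <= size s)%N ->
    foldl amul x s = 0 }.

Record cdga_morphism (k : fieldType) (A B : nil_cdga k) (phi : A -> B) : Prop := {
  morph_prj : forall b x, phi (aprj A b x) = aprj B b (phi x);
  morph_mul : forall x y, phi (amul x y) = amul (phi x) (phi y);
  morph_dif : forall x, phi (adif A x) = adif B (phi x) }.

(* A_+ as an inverse system over a directed set; [ftrans i j] is only relevant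
   for i <= j. *)
Record formal_cdga (k : fieldType) := FormalCdga {
  findex : Type;
  fle : findex -> findex -> Prop;
  fle_refl : forall i, fle i i;
  fle_trans : forall i j l, fle i j -> fle j l -> fle i l;
  findex_inh : inhabited findex;
  fle_dir : forall i j, exists l, fle i l /\ fle j l;
  flev :> findex -> nil_cdga k;
  ftrans : forall i j, {linear flev j -> flev i};
  ftrans_morph : forall i j, fle i j -> cdga_morphism (ftrans i j);
  ftrans_id : forall i x, ftrans i i x = x;
  ftrans_comp : forall i j l x, fle i j -> fle j l ->
    ftrans i j (ftrans j l x) = ftrans i l x }.
Arguments ftrans {k} f i j.

(* the completed tensor product of A_+ and M, i.e. lim_i (A_i (x) M) *)
Record ctensor (k : fieldType) (A : formal_cdga k) (M : lmodType k) := CTensor {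
  ctval :> forall i : findex A, tensor (A i) M;
  ct_compat : forall i j, fle i j -> tmap (ftrans A i j) (ctval j) = ctval i }.

Section Ctensor_zero.
Variables (k : fieldType) (A : formal_cdga k) (M : lmodType k).

Fact ct0_compat (i j : findex A) : fle i j ->
  tmap (ftrans A i j) (0 : tensor (A j) M) = 0.
Proof.
move=> _; rewrite /tmap /tlift big1 // => l _.
by apply/ffunP => n; rewrite !ffunE scaler0.
Qed.

Definition ct0 : ctensor A M := CTensor ct0_compat.
End Ctensor_zero.

Section Maurer_Cartan.
Variables (k : fieldType) (A : formal_cdga k).

Section Level.
Variables (g : dgla_ops k) (i : findex A).
Implicit Types X Y : tensor (A i) g.

Let asgn := ksgn (fun b => aprj (A i) b).

(* [a (x) x, b (x) y] = (-1)^(|x||b|) a b (x) [x, y] *)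
Definition tbra X Y : tensor (A i) g :=
  tlift (fun a x => tlift (fun b y =>
    \sum_(c : bool) pure (amul a (asgn c b)) (gbra (gprj c x) y)) Y) X.

(* (d_A + d_g)(a (x) x) = d a (x) x + (-1)^|a| a (x) d x *)
Definition tdif X : tensor (A i) g :=
  tlift (fun a x => pure (adif (A i) a) x + pure (asgn true a) (gdif x)) X.

Definition todd X := tprj (fun b => aprj (A i) b) (@gprj k g) true X = X.
End Level.

(* [h] is the underlying subspace of a sub-dgla of g. *)
Definition is_MC (g : dgla_ops k) (h : set g) (X : ctensor A g) := forall i,
  [/\ forall j, h (X i j), todd (X i) &
      tdif (X i) + 2^-1 *: tbra (X i) (X i) = 0].

Definition gauge_equiv (g : dgla_ops k) (h : set g) (X0 X1 : ctensor A g) :=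
  exists Z : ctensor A (zdz_ops g), is_MC (zdz_sub h) Z /\
    forall i j, zdz_eval 0 (Z i j) = X0 i j /\ zdz_eval 1 (Z i j) = X1 i j.

End Maurer_Cartan.

(* A = k (+) A_+ *)
Section Unitization.
Variables (k : fieldType) (A : nil_cdga k).

Definition uvec : vectType k := (k^o * A)%type.

Definition uprj (b : bool) (x : uvec) : uvec :=
  (if b then 0 else x.1, aprj A b x.2).
Definition umul (x y : uvec) : uvec :=
  (x.1 * y.1, (x.1 : k) *: y.2 + (y.1 : k) *: x.2 + amul x.2 y.2).
Definition udif (x : uvec) : uvec := (0, adif A x.2).
Definition uone : uvec := (1, 0).
Definition uinc (a : A) : uvec := (0, a).

Variables (U : lmodType k) (pU : bool -> U -> U).

(* The A-multilinear extension of a map mu on sequences of vectors of U: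
   [mext p a t Xs] is a mu(t, Xs) with the coefficients of Xs moved to the left,
   where p is the parity of mu plus that of t, so that
   mu^A(a_1 (x) u_1, ..., a_n (x) u_n) = +- a_1 ... a_n (x) mu(u_1, ..., u_n)
   is the case of t = [::] and a = 1. *)
Fixpoint mext (mu : seq U -> U) (p : bool) (a : uvec) (t : seq U)
    (Xs : seq (tensor uvec U)) : tensor uvec U :=
  if Xs is X :: Xs' then
    tlift (fun b u => \sum_(c : bool)
      mext mu (p (+) c) (umul a (ksgn uprj p b)) (rcons t (pU c u)) Xs') X
  else pure a (mu t).

Definition mext_odd (mu : seq U -> U) (Xs : seq (tensor uvec U)) :=
  mext mu true uone [::] Xs.

Definition unit_tensor (u : U) : tensor uvec U := pure uone u.
Definition inc_tensor (X : tensor A U) : tensor uvec U := tmap uinc X.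

End Unitization.

Section Deformations.
Variables (k : fieldType) (V : linf_algebra k) (A : formal_cdga k).
Notation U := (Pi V).

Definition mA (i : findex A) (Xs : seq (tensor (uvec (A i)) U)) :=
  mext_odd (fun b => sprj U b) (str (ldif V)) Xs.

(* The sum is finite because A_i is nilpotent. *)
Definition linf_MC (xi : ctensor A U) := forall i,
  let xi_i := inc_tensor (xi i) in
  tprj (fun b => aprj (A i) b) (fun b => sprj U b) false (xi i) = xi i /\
  tmap (@udif k (A i)) xi_i +
    \sum_(n \in [set n : nat | (0 < n)%N]) (n`!%:R^-1 : k) *: mA (nseq n xi_i) = 0.

Definition twisted (xi : ctensor A U) (i : findex A) (s : seq U) :=
  \sum_(n \in [set: nat]) (n`!%:R^-1 : k) *:
     mA (nseq n (inc_tensor (xi i)) ++ map (@unit_tensor k (A i) U) s).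

Definition deformation (x : ctensor A (CE_ops V)) :=
  is_MC (@CEbar k U : set (CE_ops V)) x.

Definition equivalent (x y : ctensor A (CE_ops V)) :=
  gauge_equiv (@CEbar k U : set (CE_ops V)) x y.

Definition curved_equivalent (x y : ctensor A (CE_ops V)) :=
  gauge_equiv (@CE k U : set (CE_ops V)) x y.

(* x = m^xi - m^A, as derivations without constant term *)
Definition is_twisting (xi : ctensor A U) (x : ctensor A (CE_ops V)) :=
  forall i (s : seq U), (0 < size s)%N ->
    inc_tensor (tlift (fun a (D : CE_ops V) => pure a (str D s)) (x i)) =
    twisted xi i s - mA (map (@unit_tensor k (A i) U) s).

End Deformations.

(* Main.v *)
(* Let [del v] be the derivation of the completed symmetric algebra that is
   contraction by v, extended A-linearly. A gauge between x and 0 is a pair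
   (P(z), Q(z) dz) such that, for M = m + P,
     (d_A + M)^2 = 0   and   [d_A + M, d/dz + Q] = 0.
   Both equations survive conjugation by exp(ad (del xi)) for a path xi(z) in
   A_+ (x) Pi V, and the conjugate of Q has no constant term precisely when xi'
   is the constant term of exp(ad (del xi)) Q. As A_+ is nilpotent, Picard
   iteration solves this equation with xi(0) = 0 by a polynomial. The second
   equation is then a linear differential equation that propagates absence of
   constant terms from P(0) = x, which conjugation does not change, to P(z). So
   x is equivalent, without constant terms, to
     P(1) = exp(ad (del xi(1))) m - m - del (d_A xi(1)).
   Up to sign conventions the structure maps with n >= 1 inputs of P(1) are those
   of m^xi - m, and the vanishing of its constant term is the Maurer-Cartan
   equation for xi = xi(1). *)
From HB Require Import structures.
From mathcomp Require Import all_boot all_order all_algebra.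
From mathcomp Require Import boolp classical_sets functions fsbigop.
From mathcomp Require Import ring.
Require Import Defs.

Set Implicit Arguments.
Unset Strict Implicit.
Unset Printing Implicit Defensive.

Import GRing.Theory.
Local Open Scope ring_scope.

(** Correcting only the endpoint would not do: equivalence over [CEbar] asks for a whole path
    without constant terms. The conjugation takes place in the associative ring of [k]-linear
    endomorphisms of power series over A (x) Shat U. There d_A and d/dz, which are not elements of
    the Lie algebra, can be conjugated like M and Q, and the contraction by xi, being even, has an
    ordinary commutator as its ad, so that the exponential is multiplicative without Koszul signs.
    The results come back because an element of A (x) CE is determined by its action. The unit is
    adjoined to A_+ so that m + P is a single element. [CEbar] tests constant terms on linear forms
    only; by an Euler formula and continuity their absence extends to all forms, and in that shape
    it passes to brackets. A_+ is nilpotent only level by level, in general without a uniform bound.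
    All exponentials and iterations are therefore finite, cut off at an index chosen for each level,
    and the levels fit together because enlarging the index changes nothing. *)

Section Linear_endomorphisms.
Variables (k : fieldType) (M : lmodType k).

Definition linear_pred : {pred (M -> M)} := fun f => `[< linear f >].

Fact linear_submod_closed : submod_closed linear_pred.
Proof.
split=> [|a f g /asboolP fl /asboolP gl]; apply/asboolP => b u v.
  by change (0 = b *: 0 + 0 :> M); rewrite scaler0 addr0.
by rewrite !fctE fl gl !scalerDr addrACA !scalerA (mulrC a).
Qed.

HB.instance Definition _ :=
  GRing.isSubmodClosed.Build k (M -> M) linear_pred linear_submod_closed.

(** Bundled so that composition gives a ring: commutator identities between operators become ring
    computations. *)
Record lendo := Lendo { lendo_fun :> M -> M; _ : lendo_fun \in linear_pred }.

HB.instance Definition _ := [isSub for lendo_fun].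
HB.instance Definition _ := [Choice of lendo by <:].
HB.instance Definition _ := [SubChoice_isSubLmodule of lendo by <:].

Lemma lendo_linear (f : lendo) : linear f.
Proof. by case: f => f fl; exact/asboolP. Qed.

HB.instance Definition _ (f : lendo) :=
  GRing.isLinear.Build k M M *:%R (lendo_fun f) (lendo_linear f).

Definition mk_lendo (f : M -> M) (fl : linear f) : lendo := Lendo (asboolT fl).

Lemma lendoP (f g : lendo) : f =1 g -> f = g.
Proof. by move=> fg; apply/val_inj/funext. Qed.

Fact lendo_one_linear : linear (@id M). Proof. by []. Qed.
Fact lendo_mul_linear (f g : lendo) : linear (f \o g).
Proof. by move=> a u v /=; rewrite !linearP. Qed.

Let one := mk_lendo lendo_one_linear.
Let mul f g := mk_lendo (lendo_mul_linear f g).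

Fact lendo_mulA : associative mul. Proof. by move=> f g h; exact: lendoP. Qed.
Fact lendo_mul1 : left_id one mul. Proof. by move=> f; exact: lendoP. Qed.
Fact lendo_mulr1 : right_id one mul. Proof. by move=> f; exact: lendoP. Qed.
Fact lendo_mulDl : left_distributive mul +%R.
Proof. by move=> f g h; exact: lendoP. Qed.
Fact lendo_mulDr : right_distributive mul +%R.
Proof. by move=> f g h; apply: lendoP => x; rewrite /= raddfD. Qed.

HB.instance Definition _ := GRing.Zmodule_isPzRing.Build lendo
  lendo_mulA lendo_mul1 lendo_mulr1 lendo_mulDl lendo_mulDr.

Lemma lendoDE (f g : lendo) u : (f + g) u = f u + g u. Proof. by []. Qed.
Lemma lendoNE (f : lendo) u : (- f) u = - f u. Proof. by []. Qed.
Lemma lendoZE c (f : lendo) u : (c *: f) u = c *: f u. Proof. by []. Qed.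
Lemma lendoME (f g : lendo) u : (f * g) u = f (g u). Proof. by []. Qed.

Lemma lendo_scalel c (f g : lendo) : (c *: f) * g = c *: (f * g).
Proof. exact: lendoP. Qed.

Lemma lendo_scaler c (f g : lendo) : f * (c *: g) = c *: (f * g).
Proof. by apply: lendoP => x; rewrite lendoME !lendoZE linearZ. Qed.

End Linear_endomorphisms.

(** The triangle i <= l <= n is reindexed by (i, l - i); this is the associativity of Cauchy
    products of power series. *)
Lemma sum_triangle (M : zmodType) (H : nat -> nat -> M) n :
  \sum_(l < n.+1) \sum_(i < l.+1) H i (l - i)%N =
  \sum_(i < n.+1) \sum_(j < (n - i).+1) H i j.
Proof.
rewrite (eq_bigr (fun l : 'I_n.+1 =>
  \sum_(i < n.+1 | (i <= l)%N) H i (l - i)%N)); last first.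
  by move=> l _; exact: (big_ord_widen n.+1 (fun i => H i (l - i)%N) (ltn_ord l)).
rewrite (exchange_big_dep predT) //=; apply: eq_bigr => i _.
rewrite -(big_mkord (fun l => (i <= l)%N) (fun l => H i (l - i)%N)).
rewrite -(big_mkord predT (H i)).
have le_in : (i <= n.+1)%N by rewrite ltnW // ltn_ord.
rewrite (big_cat_nat (leq0n _) le_in) /= big1_seq ?add0r; last first.
  move=> l /andP[il /[!mem_index_iota] /andP[_ li]].
  by move: li; rewrite ltnNge il.
rewrite -{1}[nat_of_ord i]add0n big_addn -subSn -1?ltnS //.
rewrite big_nat_cond [RHS]big_nat_cond; apply: eq_big => [j|j _].
  by rewrite leq_addl andbT.
by rewrite addnK.
Qed.

Lemma sum_widen (M : zmodType) (X : nat -> M) d d' :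
  (forall n, (d <= n)%N -> X n = 0) -> (d <= d')%N ->
  \sum_(n < d') X n = \sum_(n < d) X n.
Proof.
move=> X0 dd'; rewrite -(subnKC dd') big_split_ord /= [X in _ + X]big1 ?addr0 //.
by move=> i _; rewrite X0 // leq_addr.
Qed.

(** The antidiagonals below N + N cover the N x N square, outside of which F vanishes. *)
Lemma sum_cauchy (M : zmodType) (F : nat -> nat -> M) N :
  (forall i j, (N <= i)%N || (N <= j)%N -> F i j = 0) ->
  \sum_(n < N + N) \sum_(i < n.+1) F i (n - i)%N =
  \sum_(i < N) \sum_(j < N) F i j.
Proof.
case: N => [|N] F0; first by rewrite !big_ord0.
rewrite addnS sum_triangle.
rewrite (@sum_widen _ (fun i => \sum_(j < (N.+1 + N - i).+1) F i j) N.+1); first last.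
- by rewrite ltnS addSn leqW // leq_addr.
- by move=> i Ni; rewrite big1 // => j _; rewrite F0 ?Ni.
apply: eq_bigr => i _; apply: sum_widen => [j Nj|]; first by rewrite F0 ?Nj ?orbT.
have iN : (i <= N.+1)%N by exact: ltnW.
by rewrite ltnS leq_subRL ?leq_add2r // (leq_trans iN) ?leq_addr.
Qed.

(** * Truncated exponentials of inner derivations *)

Section Exponential_of_derivation.
Variables (k : fieldType) (char0 : [pchar k] =i pred0).
Variables (M : lmodType k) (a : lendo M).
Implicit Types x y : lendo M.

Definition ad x := a * x - x * a.

Fact ad_linear : linear ad.
Proof.
move=> c x y; rewrite /ad mulrDr mulrDl lendo_scaler lendo_scalel opprD addrACA.
by rewrite scalerBr.
Qed.
HB.instance Definition _ := GRing.isLinear.Build k _ _ *:%R ad ad_linear.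

Lemma adM x y : ad (x * y) = ad x * y + x * ad y.
Proof. by rewrite /ad mulrBl mulrBr !mulrA addrA subrK. Qed.

Definition dpow n x : lendo M := (n`!%:R^-1 : k) *: iter n ad x.

Lemma dpowS n x : n.+1%:R *: dpow n.+1 x = ad (dpow n x).
Proof.
rewrite /dpow [RHS]linearZ /= scalerA factS natrM invfM mulrA mulfV ?mul1r //.
by rewrite ((pcharf0P k).1 char0).
Qed.

Lemma dpowM n x y : dpow n (x * y) = \sum_(i < n.+1) dpow i x * dpow (n - i) y.
Proof.
elim: n => [|n IH].
  by rewrite big_ord1 subn0 /dpow fact0 invr1 /= !scale1r.
have n0 : n.+1%:R != 0 :> k by rewrite ((pcharf0P k).1 char0).
apply: (scalerI n0); rewrite dpowS IH raddf_sum /=.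
under eq_bigr do rewrite adM -!dpowS lendo_scalel lendo_scaler.
rewrite big_split /= scaler_sumr.
(* Since n + 1 = i + (n + 1 - i), the first half accounts for the derivative falling on x and the
   second for the one falling on y. *)
rewrite [in RHS](eq_bigr (fun i : 'I_n.+2 => i%:R *: (dpow i x * dpow (n.+1 - i) y)
   + (n.+1 - i)%:R *: (dpow i x * dpow (n.+1 - i) y))); last first.
  by move=> i _; rewrite -scalerDl -natrD subnKC // -ltnS.
rewrite big_split /=; congr (_ + _).
  by rewrite [RHS]big_ord_recl scale0r add0r.
rewrite [RHS]big_ord_recr /= subnn scale0r addr0; apply: eq_bigr => i _.
by rewrite subSn // -ltnS.
Qed.

Definition expad N x := \sum_(n < N) dpow n x.

Lemma expad_widen N N' x : (N <= N')%N ->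
  (forall n, (N <= n)%N -> iter n ad x = 0) -> expad N' x = expad N x.
Proof.
move=> NN' x0; rewrite /expad -(subnKC NN') big_split_ord /=.
rewrite [X in _ + X]big1 ?addr0 // => i _.
by rewrite /dpow x0 ?scaler0 ?leq_addr.
Qed.

(** The exponential of a derivation is multiplicative. The doubled cut-off on the left is needed
    because the Leibniz terms of a product vanish only once one factor has been differentiated N
    times. *)
Lemma expadM N x y : (forall n, (N <= n)%N -> iter n ad x = 0) ->
  (forall n, (N <= n)%N -> iter n ad y = 0) ->
  expad (N + N) (x * y) = expad N x * expad N y.
Proof.
move=> x0 y0; rewrite /expad (eq_bigr _ (fun (n : 'I_(N + N)) _ => dpowM n x y)).
rewrite (@sum_cauchy _ (fun i j => dpow i x * dpow j y)).
  by rewrite mulr_suml; apply: eq_bigr => i _; rewrite mulr_sumr.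
by move=> i j /orP[/x0|/y0] /(congr1 ( *:%R _)); rewrite /dpow => ->;
  rewrite scaler0 ?mul0r ?mulr0.
Qed.

End Exponential_of_derivation.

Section Linear_functions.
Variables (k : fieldType) (M W : lmodType k) (f : M -> W).
Hypothesis fl : linear f.

(** Stated for bare functions: partial applications such as [act^~ F] are linear without carrying a
    bundled structure. *)
Lemma linear_fun0 : f 0 = 0.
Proof. by have := fl (-1) 0 0; rewrite scaleN1r oppr0 addr0 scaleN1r addNr. Qed.

Lemma linear_funD : {morph f : x y / x + y}.
Proof. by move=> x y; have := fl 1 x y; rewrite !scale1r. Qed.

Lemma linear_funZ c : {morph f : x / c *: x}.
Proof. by move=> x; rewrite -[c *: x]addr0 fl linear_fun0 addr0. Qed.

Lemma linear_funB : {morph f : x y / x - y}.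
Proof. by move=> x y; rewrite -!scaleN1r linear_funD linear_funZ. Qed.

Lemma linear_funN : {morph f : x / - x}.
Proof. by move=> x; rewrite -!scaleN1r linear_funZ. Qed.

Lemma linear_fun_sum I (r : seq I) (P : pred I) (F : I -> M) :
  f (\sum_(i <- r | P i) F i) = \sum_(i <- r | P i) f (F i).
Proof. by elim/big_rec2: _ => [|i x y _ <-]; [exact: linear_fun0|exact: linear_funD]. Qed.

Lemma linear_funMn n : {morph f : x / x *+ n}.
Proof.
move=> x; elim: n => [|n IH]; first by rewrite !mulr0n linear_fun0.
by rewrite !mulrS linear_funD IH.
Qed.

End Linear_functions.

(** * Tensor products in coordinates *)

Section Tensors.
Variables (k : fieldType) (A : vectType k).
Implicit Types M W : lmodType k.

Definition bilin (M W : lmodType k) (h : A -> M -> W) :=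
  (forall v, linear (h^~ v)) /\ (forall a, linear (h a)).

Section Bilinear.
Variables (M W : lmodType k) (h : A -> M -> W).
Hypothesis hb : bilin h.

Lemma bilinDl a b v : h (a + b) v = h a v + h b v.
Proof. exact: (linear_funD (hb.1 v)). Qed.
Lemma bilinDr a v w : h a (v + w) = h a v + h a w.
Proof. exact: (linear_funD (hb.2 a)). Qed.
Lemma bilin0l v : h 0 v = 0. Proof. exact: (linear_fun0 (hb.1 v)). Qed.
Lemma bilin0r a : h a 0 = 0. Proof. exact: (linear_fun0 (hb.2 a)). Qed.
Lemma bilinZl c a v : h (c *: a) v = c *: h a v.
Proof. exact: (linear_funZ (hb.1 v)). Qed.
Lemma bilinZr c a v : h a (c *: v) = c *: h a v.
Proof. exact: (linear_funZ (hb.2 a)). Qed.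
End Bilinear.

Lemma bilin_sum M W (I : Type) (r : seq I) (h : I -> A -> M -> W) :
  (forall i, bilin (h i)) -> bilin (fun a v => \sum_(i <- r) h i a v).
Proof.
move=> hb; split=> [v|a] c x y; rewrite scaler_sumr -big_split;
  apply: eq_bigr => i _; have [hl hr] := hb i; [exact: hl|exact: hr].
Qed.

Lemma pure_bilin M : bilin (@pure k A M).
Proof.
by split=> [v|a] c x y; apply/ffunP => j; rewrite !ffunE;
  rewrite ?linearP ?scalerDl ?scalerDr !scalerA // mulrC.
Qed.

Lemma tlift_linear M W (h : A -> M -> W) : (forall a, linear (h a)) ->
  linear (tlift h).
Proof.
move=> hl c X Y; rewrite /tlift scaler_sumr -big_split /=.
by apply: eq_bigr => j _; rewrite !ffunE hl.
Qed.

Lemma tlift_pure M W (h : A -> M -> W) a v : bilin h -> tlift h (pure a v) = h a v.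
Proof.
move=> hb; rewrite [in RHS](coord_vbasis (memvf a)) /tlift.
rewrite (big_morph _ (fun x y => bilinDl hb x y v) (bilin0l hb v)).
by apply: eq_bigr => j _; rewrite ffunE (bilinZl hb) (bilinZr hb).
Qed.

Lemma eq_tlift M W (h h' : A -> M -> W) X : (forall a v, h a v = h' a v) ->
  tlift h X = tlift h' X.
Proof. by move=> hh; apply: eq_bigr => j _. Qed.

Lemma tensor_sum M (X : tensor A M) :
  X = \sum_(j < \dim {:A}) pure (vbasis {:A})`_j (X j).
Proof.
apply/ffunP => i; rewrite sum_ffunE (bigD1 i) //= ffunE coord_free; last first.
  exact: basis_free (vbasisP _).
rewrite eqxx scale1r big1 ?addr0 // => j ji.
by rewrite ffunE coord_free ?(basis_free (vbasisP _)) // (negPf ji) scale0r.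
Qed.

(** Finite sums of pure tensors a (x) v with [K a v]. Total parity and order in the filtration are
    both conditions of this form, so that an identity between linear maps on such tensors need only
    be checked on pure ones of the given kind. *)
Inductive tgen M (K : A -> M -> Prop) : tensor A M -> Prop :=
| tgen0 : tgen K 0
| tgen_cons a v X : K a v -> tgen K X -> tgen K (pure a v + X).

Lemma tgen_pure M (K : A -> M -> Prop) a v : K a v -> tgen K (pure a v).
Proof. by move=> Kav; rewrite -[pure a v]addr0; apply: tgen_cons Kav (tgen0 _). Qed.

Lemma tgenD M (K : A -> M -> Prop) X Y : tgen K X -> tgen K Y -> tgen K (X + Y).
Proof.
move=> KX KY; elim: KX => [|a v Z Kav _ IH]; first by rewrite add0r.
by rewrite -addrA; exact: tgen_cons.
Qed.

Lemma tgen_sum M (K : A -> M -> Prop) I (r : seq I) (P : pred I) (F : I -> tensor A M) :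
  (forall i, P i -> tgen K (F i)) -> tgen K (\sum_(i <- r | P i) F i).
Proof. by move=> KF; elim/big_rec: _ => [|i X Pi /(tgenD (KF i Pi))//]; exact: tgen0. Qed.

Lemma tgenZ M (K : A -> M -> Prop) c X : (forall a v, K a v -> K (c *: a) v) ->
  tgen K X -> tgen K (c *: X).
Proof.
move=> Kc; elim=> [|a v Z Kav _ IH]; first by rewrite scaler0; exact: tgen0.
by rewrite scalerDr -(bilinZl (pure_bilin M)); apply: tgen_cons => //; exact: Kc.
Qed.

Lemma tgenW M (K K' : A -> M -> Prop) X : (forall a v, K a v -> K' a v) ->
  tgen K X -> tgen K' X.
Proof.
move=> KK'; elim=> [|a v Z Kav _]; first exact: tgen0.
by apply: tgen_cons; exact: KK'.
Qed.

Lemma tensor_gen M (X : tensor A M) : tgen (fun _ _ => True) X.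
Proof. by rewrite [X]tensor_sum; apply: tgen_sum => j _; exact: tgen_pure. Qed.

Lemma linear_gen_eq M (W : lmodType k) (K : A -> M -> Prop) (f g : tensor A M -> W) X :
  linear f -> linear g -> tgen K X ->
  (forall a v, K a v -> f (pure a v) = g (pure a v)) -> f X = g X.
Proof.
move=> fl gl KX fg; elim: KX => [|a v Z Kav _ IH].
  by rewrite !linear_fun0.
have lD (h : tensor A M -> W) x y : linear h -> h (x + y) = h x + h y.
  by move=> hl; have := hl 1 x y; rewrite !scale1r.
by rewrite !lD // IH fg.
Qed.

Lemma linear_tensor_eq M (W : lmodType k) (f g : tensor A M -> W) :
  linear f -> linear g -> (forall a v, f (pure a v) = g (pure a v)) -> f =1 g.
Proof.
by move=> fl gl fg X; apply: (linear_gen_eq fl gl (tensor_gen X)) => a v _.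
Qed.

Definition tmapr M W (f : M -> W) (X : tensor A M) : tensor A W :=
  [ffun j => f (X j)].

Lemma tmapr_is_linear M W (f : {linear M -> W}) : linear (tmapr f).
Proof. by move=> c X Y; apply/ffunP => j; rewrite !ffunE linearP. Qed.
HB.instance Definition _ M W (f : {linear M -> W}) :=
  GRing.isLinear.Build k _ _ *:%R (tmapr f) (tmapr_is_linear f).

Lemma tmapr_pure M W (f : {linear M -> W}) a v : tmapr f (pure a v) = pure a (f v).
Proof. by apply/ffunP => j; rewrite !ffunE linearZ. Qed.

End Tensors.

Lemma tmap_bilin (k : fieldType) (A B : vectType k) (M : lmodType k) (phi : {linear A -> B}) :
  bilin (fun a (v : M) => pure (phi a) v).
Proof.
have [pl pr] := pure_bilin B M.
by split=> [v|a] c x y; [rewrite linearP pl|rewrite pr].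
Qed.

Section Tmap.
Variables (k : fieldType) (A B : vectType k) (M : lmodType k) (phi : A -> B).

Lemma tmap_is_linear : linear (@tmap k A B M phi).
Proof. by apply: tlift_linear => a; exact: (pure_bilin B M).2. Qed.
HB.instance Definition _ :=
  GRing.isLinear.Build k _ _ *:%R (@tmap k A B M phi) tmap_is_linear.
End Tmap.

Lemma tmap_pure (k : fieldType) (A B : vectType k) (M : lmodType k)
  (phi : {linear A -> B}) a (v : M) : tmap phi (pure a v) = pure (phi a) v.
Proof. by rewrite /tmap tlift_pure //; exact: tmap_bilin. Qed.

Lemma tmapr_tmap (k : fieldType) (A B : vectType k) (M W : lmodType k)
  (phi : {linear A -> B}) (f : {linear M -> W}) X :
  tmapr f (tmap phi X) = tmap phi (tmapr f X).
Proof.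
apply: (linear_tensor_eq (f := fun X => tmapr f (tmap phi X))
  (g := fun X => tmap phi (tmapr f X))) => [c Y Z|c Y Z|a v].
- by rewrite !linearP.
- by rewrite !linearP.
- by rewrite tmapr_pure !tmap_pure tmapr_pure.
Qed.

Lemma tmap_comp (k : fieldType) (A B C : vectType k) (M : lmodType k)
  (phi : {linear A -> B}) (psi : {linear B -> C}) (chi : {linear A -> C}) :
  psi \o phi =1 chi ->
  forall X : tensor A M, tmap psi (tmap phi X) = tmap chi X.
Proof.
move=> E; apply: linear_tensor_eq => [c Y Z|c Y Z|a v]; rewrite ?linearP //.
by rewrite !tmap_pure -E.
Qed.

Lemma tmap_square (k : fieldType) (A B B' C : vectType k) (M : lmodType k)
  (phi : {linear A -> B}) (psi : {linear B -> C}) (phi' : {linear A -> B'})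
  (psi' : {linear B' -> C}) : psi \o phi =1 psi' \o phi' ->
  forall X : tensor A M, tmap psi (tmap phi X) = tmap psi' (tmap phi' X).
Proof.
move=> E; apply: linear_tensor_eq => [c Y Z|c Y Z|a v]; rewrite ?linearP //.
by have /= e := E a; rewrite !tmap_pure e.
Qed.

Lemma tmap_id (k : fieldType) (A : vectType k) (M : lmodType k) (phi : {linear A -> A}) :
  phi =1 id -> forall X : tensor A M, tmap phi X = X.
Proof.
move=> E; apply: (linear_tensor_eq (g := id)) => [c Y Z|//|a v].
  by rewrite linearP.
by rewrite tmap_pure E.
Qed.

Lemma tmap_gen (k : fieldType) (A B : vectType k) (M : lmodType k) (phi : {linear A -> B})
  (K : A -> M -> Prop) (K' : B -> M -> Prop) X :
  (forall a v, K a v -> K' (phi a) v) -> tgen K X -> tgen K' (tmap phi X).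
Proof.
move=> KK'; elim=> [|a v Z Kav _ IH]; first by rewrite linear0; exact: tgen0.
by rewrite raddfD /= tmap_pure; apply: tgen_cons => //; exact: KK'.
Qed.

Lemma tmapr_gen (k : fieldType) (A : vectType k) (M W : lmodType k) (f : {linear M -> W})
  (K : A -> M -> Prop) (K' : A -> W -> Prop) X :
  (forall a v, K a v -> K' a (f v)) -> tgen K X -> tgen K' (tmapr f X).
Proof.
move=> KK'; elim=> [|a v Z Kav _ IH]; first by rewrite linear0; exact: tgen0.
by rewrite raddfD /= tmapr_pure; apply: tgen_cons => //; exact: KK'.
Qed.

(** * The completed symmetric algebra and its derivations *)

Section Separation.
Variables (k : fieldType) (U : lmodType k).

Let lclosed (K : set U) := forall c x y, K x -> K y -> K (c *: x + y).

(** A subspace maximal among those avoiding u is a complement of the line through u, and l is the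
    coefficient of u along it. *)
Lemma linear_separation (u : U) : u != 0 ->
  exists2 l : U -> k, linear (l : U -> k^o) & l u = 1.
Proof.
move=> u0; pose P K := lclosed K /\ ~ K u.
have [F FP Ftot|A [[Al Au] Amax]] := @Zorn_bigcup U P.
  split=> [c x y [X FX Xx] [Y FY Yy]|[X FX Xu]]; last exact: (FP _ FX).2.
  by have [XY|YX] := Ftot _ _ FX FY; [exists Y|exists X] => //;
    apply: (FP _ _).1 => //; [exact: XY|exact: YX].
(* [lclosed] does not exclude the empty set, so 0 is adjoined to be sure of a subspace. *)
pose B x := A x \/ x = 0.
have Bl : lclosed B.
  move=> c x y [Ax|->] [Ay|->].
  - by left; exact: Al.
  - rewrite addr0; left; have := Al (c - 1) x x Ax Ax.
    by rewrite scalerBl scale1r subrK.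
  - by rewrite scaler0 add0r; left.
  - by rewrite scaler0 add0r; right.
have Bu : ~ B u by case=> // /eqP; rewrite (negPf u0).
have BZ c x : B x -> B (c *: x).
  by move=> Bx; rewrite -[_ *: _]addr0; apply: Bl => //; right.
have BN x y : B x -> B y -> B (x - y).
  by move=> Bx By; rewrite addrC -scaleN1r; exact: Bl.
have Bex v : exists c, B (v - c *: u).
  have [Bv|Bv] := pselect (B v); first by exists 0; rewrite scale0r subr0.
  (* C is spanned by B and v. By maximality it contains u, and u - c v in B with c nonzero is solved
     for v. *)
  pose C x := exists c, B (x - c *: v).
  have : ~ P C.
    apply: Amax; split=> [x Ax|CA].
      by exists 0; rewrite scale0r subr0; left.
    by apply: Bv; left; apply: CA; exists 1; rewrite scale1r subrr; right.
  move=> PC; have [c Bc] : C u.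
    apply: contrapT => Cu; apply: PC; split=> // a x y [b Bb] [d Bd].
    exists (a * b + d); rewrite scalerDl -scalerA opprD addrACA -scalerBr.
    exact: Bl.
  have c0 : c != 0 by apply: contra_notN Bu => /eqP c0; rewrite c0 scale0r subr0 in Bc.
  exists c^-1; have := BZ (- c^-1) _ Bc.
  by rewrite scalerBr !scaleNr opprK scalerA mulVf // scale1r addrC.
have Buniq v c d : B (v - c *: u) -> B (v - d *: u) -> c = d.
  move=> Bc Bd; apply/eqP; rewrite -subr_eq0; apply: contra_notT Bu => cd.
  have := BZ (c - d)^-1 _ (BN _ _ Bd Bc).
  have -> : v - d *: u - (v - c *: u) = (c - d) *: u.
    by rewrite opprB addrC addrA subrK scalerBl.
  by rewrite scalerA mulVf // scale1r.
pose l v := projT1 (cid (Bex v)).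
have lP v : B (v - l v *: u) by rewrite /l; case: cid.
exists l => [a x y|].
  apply: (Buniq (a *: x + y)) => //.
  change (B (a *: x + y - (a * l x + l y) *: u)); rewrite scalerDl -scalerA opprD addrACA -scalerBr.
  exact: Bl.
by apply: (Buniq u) => //; rewrite scale1r subrr; right.
Qed.

End Separation.

(** * Forms and finite pieces of homogeneous dual bases *)

Section Forms.
Variables (k : fieldType) (U : superspace k).
Notation S := (Shat U).
Notation usgn := (ksgn (sprj U)).
Implicit Types (f g x : S) (s t : seq U) (u v : U).

Lemma ShatP f g : (forall s, f s = g s) -> f = g.
Proof. by move=> fg; apply/val_inj/funext. Qed.

Lemma Shat_multilinear f : multilinear f.
Proof. by case: f => f /= /symformP[]. Qed.

Lemma Shat_gsymmetric f : gsymmetric f.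
Proof. by case: f => f /= /symformP[]. Qed.

Lemma ShatDE f g s : (f + g) s = f s + g s. Proof. by []. Qed.
Lemma ShatZE c f s : (c *: f) s = c * f s. Proof. by []. Qed.
Lemma ShatNE f s : (- f) s = - f s. Proof. by []. Qed.
Lemma Shat_sumE I (r : seq I) (P : pred I) (F : I -> S) s :
  (\sum_(i <- r | P i) F i) s = \sum_(i <- r | P i) F i s.
Proof. by elim/big_rec2: _ => //= i y z _ <-. Qed.

HB.instance Definition _ b :=
  GRing.isLinear.Build k U U *:%R (usgn b) (usgn_linear b).

Lemma usgnK b : involutive (usgn b).
Proof.
case: b => // u; rewrite {1}/ksgn !prj_usgn /= expr0 expr1 scale1r scaleN1r opprK.
exact: sprjD.
Qed.

Lemma usgn_hom b c u : sprj U c u = u -> usgn b u = (-1) ^+ (b && c) *: u.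
Proof. by move=> uc; rewrite -{1}uc usgn_prj uc. Qed.

Lemma sprj_usgn b c u : sprj U c (usgn b u) = usgn b (sprj U c u).
Proof. by rewrite prj_usgn usgn_prj. Qed.

Fact linear_form_symform (l : U -> k^o) : linear l ->
  (fun s : seq U => if s is [:: u] then l u else 0 : k^o) \in @symform k U.
Proof.
move=> ll; apply/symformP; split.
  move=> [|w [|w' s]] [|w'' t] a u v /=; rewrite ?mulr0 ?addr0 //; exact: ll.
by move=> [|w [|w' s]] t b c u v /=; rewrite mulr0.
Qed.

Definition mk_linear_form (l : U -> k^o) (ll : linear l) : S :=
  MkShat (linear_form_symform ll).

Lemma mk_linear_formP l ll : linear_form (@mk_linear_form l ll).
Proof. by case=> [|u [|]]. Qed.

Lemma linear_form_linear x : linear (fun u => x [:: u] : k^o).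
Proof. by move=> a u v; exact: (Shat_multilinear x [::] [::]). Qed.

Lemma linear_form_inj u v :
  (forall x, linear_form x -> x [:: u] = x [:: v]) -> u = v.
Proof.
move=> uv; apply/eqP; rewrite -subr_eq0; apply/negPn/negP => uv0.
have [l ll l1] := linear_separation uv0.
have : mk_linear_form ll [:: u - v] = 0.
  rewrite addrC -scaleN1r linear_form_linear (uv _ (mk_linear_formP ll)).
  by rewrite scaleN1r addNr.
by rewrite /= l1 => /eqP; rewrite oner_eq0.
Qed.

(* Homogeneous partial dual bases: p = ((e, b), x) with |e| = |x| = b. *)
Definition dual_pair (p : U * bool * S) :=
  [/\ linear_form p.2, sprj U p.1.2 p.1.1 = p.1.1 &
      forall c u, p.2 [:: sprj U c u] = if c == p.1.2 then p.2 [:: u] else 0].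

Definition expand (E : seq (U * bool * S)) u : U :=
  \sum_(p <- E) (p.2 [:: u] : k) *: p.1.1.

Lemma expand_linear E : linear (expand E).
Proof.
move=> a u v; rewrite /expand scaler_sumr -big_split; apply: eq_bigr => p _ /=.
by rewrite linear_form_linear scalerDl scalerA.
Qed.
HB.instance Definition _ E := GRing.isLinear.Build k U U *:%R (expand E) (expand_linear E).

Lemma expand_sprj E b u : (forall p, p \in E -> dual_pair p) ->
  sprj U b (expand E u) = expand E (sprj U b u).
Proof.
move=> Ed; rewrite /expand raddf_sum !big_seq; apply: eq_bigr => p /Ed[_ pe px].
rewrite /= linearZ /= px -{1}pe sprjK; case: (b == p.1.2); first by rewrite pe.
by rewrite scaler0 scale0r.
Qed.

Lemma dual_pairs_hom E b u : (forall p, p \in E -> dual_pair p) -> sprj U b u = u ->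
  exists E', [/\ forall p, p \in E' -> dual_pair p, expand E' u = u &
    forall v, expand E v = v -> expand E' v = v].
Proof.
move=> Ed ub; set u' := u - expand E u.
have u'b : sprj U b u' = u' by rewrite raddfB /= expand_sprj // ub.
have [u'0|u'0] := eqVneq u' 0.
  by exists E; split=> //; apply/esym/eqP; rewrite -subr_eq0; apply/eqP.
have [l ll l1] := linear_separation u'0.
(* This functional is 1 at u and vanishes on every vector already fixed by [expand E], so adding the
   pair (u', h) fixes u and disturbs none of the others. *)
pose h v := l (sprj U b (v - expand E v)).
have hl : linear (h : U -> k^o).
  by move=> a v w; rewrite /h linearP /= opprD addrACA -scalerBr linearP ll.
exists ((u', b, mk_linear_form hl) :: E); split=> [p|| v vE].
- rewrite inE => /predU1P[->|]; last exact: Ed.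
  split=> //= [|c v]; first exact: mk_linear_formP.
  rewrite /h -expand_sprj // -raddfB /= sprjK eq_sym; have [->//|_] := eqVneq c b.
  by rewrite (linear_fun0 ll).
- rewrite /expand big_cons /= -/(expand E u) /h -/u' u'b l1 scale1r subrK //.
- rewrite /expand big_cons /= -/(expand E v) /h vE subrr linear0.
  by rewrite (linear_fun0 ll) scale0r add0r.
Qed.

(** U may have infinite dimension. A continuous operator tests a form at finitely many sequences
    only, and for the vectors occurring in them a finite partial dual basis suffices. *)
Lemma dual_pairs (l : seq U) : exists E, (forall p, p \in E -> dual_pair p) /\
  forall u, u \in l -> expand E u = u.
Proof.
elim: l => [|u l [E [Ed El]]]; first by exists [::].
have [E1 [E1d E1u E1E]] := dual_pairs_hom (b := false) (u := sprj U false u) Ed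
  ltac:(by rewrite sprjK).
have [E2 [E2d E2u E2E]] := dual_pairs_hom (b := true) (u := sprj U true u) E1d
  ltac:(by rewrite sprjK).
exists E2; split=> // v; rewrite inE => /predU1P[->|/El/E1E/E2E//].
by rewrite -{1}(sprjD u) raddfD /= E2u (E2E _ E1u) sprjD.
Qed.

End Forms.

(** * The product of forms and right contractions *)

Section Shat_algebra.
Variables (k : fieldType) (U : superspace k).
Notation S := (Shat U).
Notation usgn := (ksgn (sprj U)).
Implicit Types (f g h : S) (s t : seq U) (u v : U).

Lemma Shat_sgn_linear b : linear (@Shat_sgn k U b).
Proof. by move=> a f g; apply: ShatP. Qed.
HB.instance Definition _ b :=
  GRing.isLinear.Build k S S *:%R (@Shat_sgn k U b) (Shat_sgn_linear b).

Lemma Shat_sgnE b f s : Shat_sgn b f s = f (map (usgn b) s). Proof. by []. Qed.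

Lemma Shat_sgnK b : involutive (@Shat_sgn k U b).
Proof.
by move=> f; apply: ShatP => s; rewrite !Shat_sgnE mapK //; exact: usgnK.
Qed.

Lemma Shat_sgn0 f : Shat_sgn false f = f.
Proof. by apply: ShatP => s; rewrite Shat_sgnE map_id. Qed.

Lemma Shat_sgnC b c f : Shat_sgn b (Shat_sgn c f) = Shat_sgn c (Shat_sgn b f).
Proof. by case: b; case: c; rewrite // !Shat_sgn0. Qed.

Lemma Shat_mulPl a f g h : Shat_mul (a *: f + g) h = a *: Shat_mul f h + Shat_mul g h.
Proof.
apply: ShatP => s; rewrite ShatDE ShatZE.
by transitivity (form_mul s (fun t => a * f t + g t) h); last exact: form_mulDl.
Qed.

Lemma Shat_mulPr a f g h : Shat_mul h (a *: f + g) = a *: Shat_mul h f + Shat_mul h g.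
Proof.
apply: ShatP => s; rewrite ShatDE ShatZE.
by transitivity (form_mul s h (fun t => a * f t + g t)); last exact: form_mulDr.
Qed.

Lemma Shat_mulDl f g h : Shat_mul (f + g) h = Shat_mul f h + Shat_mul g h.
Proof. by have := Shat_mulPl 1 f g h; rewrite !scale1r. Qed.
Lemma Shat_mulDr f g h : Shat_mul h (f + g) = Shat_mul h f + Shat_mul h g.
Proof. by have := Shat_mulPr 1 f g h; rewrite !scale1r. Qed.
Lemma Shat_mul0l h : Shat_mul 0 h = 0.
Proof. by apply: ShatP => s; exact: form_mul0l. Qed.
Lemma Shat_mul0r h : Shat_mul h 0 = 0.
Proof. by apply: ShatP => s; exact: form_mul0r. Qed.
Lemma Shat_mulZl a f h : Shat_mul (a *: f) h = a *: Shat_mul f h.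
Proof. by have := Shat_mulPl a f 0 h; rewrite !addr0 Shat_mul0l addr0. Qed.
Lemma Shat_mulZr a f h : Shat_mul h (a *: f) = a *: Shat_mul h f.
Proof. by have := Shat_mulPr a f 0 h; rewrite !addr0 Shat_mul0r addr0. Qed.

Fact Shat_one_symform :
  (fun s : seq U => if s is [::] then 1 else 0 : k^o) \in @symform k U.
Proof.
apply/symformP; split; first by case=> [|w s] t a u v /=; rewrite mulr0 addr0.
by case=> [|w s] t b c u v /=; rewrite mulr0.
Qed.
Definition Shat_one : S := MkShat Shat_one_symform.

Lemma form_mul_const (c : k) s (f g : seq U -> k^o) :
  (forall t, f t = if t is [::] then c else 0) -> form_mul s f g = c * g s.
Proof.
elim: s f g => [|v s IH] f g fE /=; first by rewrite fE.
rewrite IH // big1 ?addr0 // => b _; rewrite -[RHS](form_mul0l s (form_sgn b g)).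
by congr form_mul; apply: funext => t; rewrite fE.
Qed.

Lemma Shat_mul1 f : Shat_mul Shat_one f = f.
Proof. by apply: ShatP => s; rewrite /= (@form_mul_const 1) ?mul1r. Qed.

Lemma Shat_sgn1 b : Shat_sgn b Shat_one = Shat_one.
Proof. by apply: ShatP; case. Qed.

Lemma multilinear_prj (f : seq U -> k^o) s v : multilinear f ->
  f (v :: s) = f (sprj U false v :: s) + f (sprj U true v :: s).
Proof.
move=> fl; rewrite -{1}(sprjD v) -[sprj U false v]scale1r (fl [::]) /=.
by rewrite scale1r mul1r.
Qed.

(** The last vector is moved to the front by graded symmetry; the sign of each transposition is
    absorbed into the vector that is passed. *)
Lemma form_rcons (f : seq U -> k^o) b e s : multilinear f -> gsymmetric f ->
  sprj U b e = e -> f (rcons s e) = f (e :: map (usgn b) s).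
Proof.
elim: s f => [//|v s IH] f fl fs eb /=.
rewrite (IH (fun t => f (v :: t)) (multilinear_contract _ fl)
  (gsymmetric_contract _ fs) eb) /=.
rewrite (multilinear_prj _ _ fl) -eb (fs [::]) (fs [::] _ true) eb !cat0s.
rewrite -!(multilinearZ (f := f) [:: e] _ _ _ fl) andbC (andbC true) -!usgn_prj /=.
rewrite -!sprj_usgn -[RHS](_ : f (e :: sprj U false (usgn b v) :: [seq usgn b i | i <- s])
 + f (e :: sprj U true (usgn b v) :: [seq usgn b i | i <- s]) = _) //.
by rewrite -(multilinear_prj _ _ (multilinear_contract e fl)).
Qed.

(** Contraction in the last slot: under the sign conventions of [form_mul] and [derivation] it is
    this one that is a derivation, whereas contraction by an odd vector in the first slot puts its
    sign on the second factor. *)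
Definition rcontr_fun v (f : seq U -> k^o) : seq U -> k^o := fun s => f (rcons s v).

Lemma rcontr_multilinear v f : multilinear f -> multilinear (rcontr_fun v f).
Proof. by move=> fl s t a u w; rewrite /rcontr_fun !rcons_cat fl. Qed.

Lemma rcontr_gsymmetric v f : gsymmetric f -> gsymmetric (rcontr_fun v f).
Proof. by move=> fs s t b c u w; rewrite /rcontr_fun !rcons_cat fs. Qed.

Fact rcontr_symform v f : rcontr_fun v f \in @symform k U.
Proof.
apply/symformP; split; [apply: rcontr_multilinear; exact: Shat_multilinear|].
by apply: rcontr_gsymmetric; exact: Shat_gsymmetric.
Qed.
Definition rcontr v f : S := MkShat (rcontr_symform v f).

Lemma form_mul_rcons b v s (f g : seq U -> k^o) : multilinear f -> multilinear g ->
  sprj U b v = v -> form_mul (rcons s v) f g =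
  form_mul s (rcontr_fun v f) g + form_mul s (form_sgn b f) (rcontr_fun v g).
Proof.
move=> fl gl vb; elim: s f g fl gl => [|w s IH] f g fl gl.
  rewrite -{1}vb /= big_bool /form_sgn /rcontr_fun /= !sprjK vb.
  have /= f0 := multilinear0 [::] [::] fl.
  by case: b vb => vb; rewrite /= f0 mul0r ?addr0 ?add0r addrC //.
rewrite /= IH //; last exact: multilinear_contract.
under eq_bigr => c _.
  rewrite IH; [|exact: multilinear_contract|exact: multilinear_sgn].
  over.
rewrite big_split /= addrACA; congr (_ + (_ + _)); apply: eq_bigr => c _.
(* Exchanging [form_sgn b] with the contraction by w, and [form_sgn c] with the contraction by v,
   gives the same sign (-1)^(b c) twice; the two cancel. *)
have -> : form_sgn b (fun t => f (sprj U c w :: t)) =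
    (fun t => (-1) ^+ (b && c) * (fun t => form_sgn b f (sprj U c w :: t)) t).
  apply: funext => t; rewrite /form_sgn /= usgn_prj (multilinearZ [::]) // mulrA.
  by rewrite -expr2 sqrr_sign mul1r.
have -> : rcontr_fun v (form_sgn c g) =
    (fun t => (-1) ^+ (b && c) * form_sgn c (rcontr_fun v g) t).
  apply: funext => t; rewrite /rcontr_fun /form_sgn map_rcons -cats1.
  by rewrite (usgn_hom _ vb) multilinearZ // andbC cats1.
by rewrite form_mulZl form_mulZr mulrA -expr2 sqrr_sign mul1r.
Qed.

Lemma rcontrM b v f g : sprj U b v = v -> rcontr v (Shat_mul f g) =
  Shat_mul (rcontr v f) g + Shat_mul (Shat_sgn b f) (rcontr v g).
Proof.
move=> vb; apply: ShatP => s.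
exact: (form_mul_rcons s (Shat_multilinear f) (Shat_multilinear g) vb).
Qed.

Lemma rcontr_linear v : linear (rcontr v).
Proof. by move=> a f g; apply: ShatP => s; rewrite ShatDE ShatZE. Qed.
HB.instance Definition _ v := GRing.isLinear.Build k S S *:%R (rcontr v) (rcontr_linear v).

Lemma rcontrP a u v f : rcontr (a *: u + v) f = a *: rcontr u f + rcontr v f.
Proof.
apply: ShatP => s; rewrite ShatDE ShatZE /= /rcontr_fun -!cats1.
by rewrite (Shat_multilinear f).
Qed.

Lemma rcontr_sgn b v f : sprj U b v = v ->
  rcontr v (Shat_sgn true f) = (-1) ^+ b *: Shat_sgn true (rcontr v f).
Proof.
move=> vb; apply: ShatP => s; rewrite ShatZE /= /rcontr_fun /form_sgn map_rcons -cats1.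
by rewrite (usgn_hom _ vb) multilinearZ ?cats1 //; exact: Shat_multilinear.
Qed.

Lemma rcontrC b c u v f : sprj U b u = u -> sprj U c v = v ->
  rcontr u (rcontr v f) = (-1) ^+ (b && c) *: rcontr v (rcontr u f).
Proof.
move=> ub vc; apply: ShatP => s; rewrite ShatZE /= /rcontr_fun -!cats1 -!catA /=.
by rewrite -ub -vc (Shat_gsymmetric f).
Qed.

End Shat_algebra.

Lemma char0_neq0 (k : fieldType) (char0 : [pchar k] =i pred0) n : n.+1%:R != 0 :> k.
Proof. by rewrite ((pcharf0P k).1 char0). Qed.

(** * Parity of operators and closure properties of [CE] *)

Section Derivations.
Variables (k : fieldType) (nz2 : 2 != 0 :> k) (U : superspace k).
Notation S := (Shat U).
Notation sgn := (@Shat_sgn k U true).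
Implicit Types (f g : S) (D E : S -> S) (b c : bool).

Lemma Shat_prj_linear b : linear (@Shat_prj k U b).
Proof.
move=> a f g; apply: ShatP => s; rewrite /Shat_prj linearP.
by rewrite !(ShatZE, ShatDE); ring.
Qed.

(** The parity parts of an operator are its averages over conjugation by the grading automorphism
    [sgn], which makes parity a plain commutation rule with [sgn]. *)
Lemma End_prjE b D f : linear D ->
  End_prj b D f = 2^-1 *: (D f + (-1) ^+ b *: sgn (D (sgn f))).
Proof.
move=> Dl; rewrite /End_prj big_bool /Shat_prj /=.
have DZ a g : D (a *: g) = a *: D g.
  by rewrite -[a *: g]addr0 Dl (linear_fun0 Dl) addr0.
have DD g h : D (g + h) = D g + D h by have := Dl 1 g h; rewrite !scale1r.
rewrite !DZ !DD !DZ; apply: ShatP => s.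
rewrite !(ShatZE, ShatDE, Shat_sgnE, ShatZE, ShatDE).
by case: b => /=; rewrite ?expr0 ?expr1; field.
Qed.

Lemma End_prjP b a D E : End_prj b (a *: D + E) = a *: End_prj b D + End_prj b E.
Proof.
apply: funext => f; rewrite !fctE /End_prj scaler_sumr -big_split.
by apply: eq_bigr => c _; rewrite Shat_prj_linear.
Qed.

Lemma End_prj_linear_fun b D : linear D -> linear (End_prj b D).
Proof.
move=> Dl a f g; rewrite /End_prj scaler_sumr -big_split /=.
by apply: eq_bigr => c _; rewrite Shat_prj_linear Dl Shat_prj_linear.
Qed.

Definition parity b D := forall f, D (sgn f) = (-1) ^+ b *: sgn (D f).

Lemma End_prj_parity b D : linear D -> parity b (End_prj b D).
Proof.
move=> Dl f; rewrite !End_prjE // Shat_sgnK.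
apply: ShatP => s; rewrite !(ShatZE, ShatDE, Shat_sgnE) (mapK (@usgnK _ _ true)).
by case: b => /=; rewrite ?expr0 ?expr1; field.
Qed.

Lemma parity_End_prj b c D : linear D -> parity b D ->
  End_prj c D = if c == b then D else 0.
Proof.
move=> Dl Db; apply: funext => f; rewrite End_prjE // Db.
apply: ShatP => s; rewrite !(ShatZE, ShatDE, Shat_sgnE) (mapK (@usgnK _ _ true)).
case: b Db => _; case: c => /=; rewrite ?expr0 ?expr1; first [by field|by transitivity (0 : k); [field|]].
Qed.

Lemma End_prjD D : linear D -> End_prj false D + End_prj true D = D.
Proof.
move=> Dl; apply: funext => f; rewrite fctE !End_prjE //.
by apply: ShatP => s; rewrite !(ShatZE, ShatDE) /= expr0 expr1; field.
Qed.

Definition hderivation b D :=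
  [/\ linear D, pointwise_continuous D, parity b D & derivation b D].

Lemma continuousP a D E : pointwise_continuous D -> pointwise_continuous E ->
  pointwise_continuous (a *: D + E).
Proof.
move=> Dc Ec s; have [[L LD] [L' LE]] := (Dc s, Ec s).
exists (L ++ L') => f f0; rewrite !fctE ShatDE ShatZE LD ?LE ?mulr0 ?addr0 //.
  by move=> t tL; rewrite f0 // mem_cat tL orbT.
by move=> t tL; rewrite f0 // mem_cat tL.
Qed.

Lemma continuous_comp D E : pointwise_continuous D -> pointwise_continuous E ->
  pointwise_continuous (D \o E).
Proof.
move=> Dc Ec s; have [L LD] := Dc s.
have [L' LE] : exists L' : seq (seq U), forall f : S, (forall t, t \in L' -> f t = 0) ->
    forall t, t \in L -> E f t = 0.
  elim: L {LD} => [|t L [L' LE]]; first by exists [::].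
  have [Lt LtE] := Ec t; exists (Lt ++ L') => f f0 r.
  rewrite inE => /predU1P[->|rL]; [apply: LtE|apply: LE rL] => q qL.
    by rewrite f0 // mem_cat qL.
  by rewrite f0 // mem_cat qL orbT.
exists L' => f f0; exact: LD (LE f f0).
Qed.

Lemma continuous_sgn : pointwise_continuous sgn.
Proof. by move=> s; exists [:: map (ksgn (sprj U) true) s] => f /(_ _ (mem_head _ _)). Qed.

Lemma continuous_End_prj b D : linear D -> pointwise_continuous D ->
  pointwise_continuous (End_prj b D).
Proof.
move=> Dl Dc.
have -> : End_prj b D = 2^-1 *: ((-1) ^+ b *: (sgn \o (D \o sgn)) + D) + 0.
  apply: funext => f; rewrite End_prjE // !fctE.
  by rewrite addrC (addrC (D f)) add0r.
apply: continuousP; last by move=> s; exists [::].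
apply: continuousP => //; apply: continuous_comp; first exact: continuous_sgn.
by apply: continuous_comp => //; exact: continuous_sgn.
Qed.

Lemma derivationP b a D E : derivation b D -> derivation b E ->
  derivation b (a *: D + E).
Proof.
move=> Dd Ed f g; rewrite !fctE Dd Ed Shat_mulPl Shat_mulPr scalerDr !addrA.
by congr (_ + _); rewrite -!addrA; congr (_ + _); rewrite addrC.
Qed.

Lemma derivation0 b : derivation b (0 : S -> S).
Proof. by move=> f g; rewrite [LHS](_ : _ = 0) // Shat_mul0l Shat_mul0r addr0. Qed.

Lemma hderivation0 b : hderivation b (0 : S -> S).
Proof.
split; last exact: derivation0.
- by move=> a f g; change (0 = a *: 0 + 0 :> S); rewrite scaler0 addr0.
- by move=> s; exists [::].
- by move=> f; change (0 = (-1) ^+ b *: sgn 0); rewrite linear0 scaler0.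
Qed.

Lemma CE_linear D : CE D -> linear D. Proof. by case. Qed.

Lemma CE_hderivation b D : CE D -> hderivation b (End_prj b D).
Proof.
move=> [Dl Dc Dd]; split=> //; first exact: End_prj_linear_fun.
  exact: continuous_End_prj.
exact: End_prj_parity.
Qed.

Lemma hderivation_CE b D : hderivation b D -> CE D.
Proof.
move=> [Dl Dc Db Dd]; split=> // c; rewrite (parity_End_prj c Dl Db).
by have [->|_] := eqVneq c b; [|exact: derivation0].
Qed.

Lemma CE_P a D E : CE D -> CE E -> CE (a *: D + E).
Proof.
move=> [Dl Dc Dd] [El Ec Ed]; split.
- move=> c f g; rewrite !fctE Dl El !scalerDr !addrA !scalerA (mulrC a).
  by congr (_ + _); rewrite -!addrA; congr (_ + _); rewrite addrC.
- exact: continuousP.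
- by move=> b; rewrite End_prjP; apply: derivationP.
Qed.

Lemma CE0 : CE (0 : S -> S).
Proof. exact: hderivation_CE (hderivation0 false). Qed.

Lemma CE_End_prj b D : CE D -> CE (End_prj b D).
Proof. by move/(CE_hderivation b)/hderivation_CE. Qed.

Definition hcomm b c D E : S -> S := D \o E - (-1) ^+ (b && c) *: (E \o D).

Lemma hcommE b c D E f :
  hcomm b c D E f = D (E f) - (-1) ^+ (b && c) *: E (D f).
Proof. by []. Qed.

Lemma linear_fun_comp D E : linear D -> linear E -> linear (D \o E).
Proof. by move=> Dl El a f g /=; rewrite El Dl. Qed.

Lemma linear_funP a D E : linear D -> linear E -> linear (a *: D + E).
Proof.
move=> Dl El c f g; rewrite !fctE Dl El !scalerDr !addrA !scalerA (mulrC a).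
by congr (_ + _); rewrite -!addrA; congr (_ + _); rewrite addrC.
Qed.

Lemma hcomm_hderivation b c D E : hderivation b D -> hderivation c E ->
  hderivation (b (+) c) (hcomm b c D E).
Proof.
move=> [Dl Dc Db Dd] [El Ec Eb Ed].
have hE : hcomm b c D E = (- (-1) ^+ (b && c)) *: (E \o D) + (D \o E).
  by apply: funext => f; rewrite hcommE !fctE scaleNr addrC.
have DZ a f : D (a *: f) = a *: D f.
  by rewrite -[a *: f]addr0 Dl (linear_fun0 Dl) addr0.
have EZ a f : E (a *: f) = a *: E f.
  by rewrite -[a *: f]addr0 El (linear_fun0 El) addr0.
have DD f g : D (f + g) = D f + D g by have := Dl 1 f g; rewrite !scale1r.
have ED f g : E (f + g) = E f + E g by have := El 1 f g; rewrite !scale1r.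
have sgnD d f : D (Shat_sgn d f) = (-1) ^+ (d && b) *: Shat_sgn d (D f).
  by case: d => /=; [exact: Db|rewrite !Shat_sgn0 scale1r].
have sgnE d f : E (Shat_sgn d f) = (-1) ^+ (d && c) *: Shat_sgn d (E f).
  by case: d => /=; [exact: Eb|rewrite !Shat_sgn0 scale1r].
split.
- by rewrite hE; apply: linear_funP; exact: linear_fun_comp.
- by rewrite hE; apply: continuousP; exact: continuous_comp.
- move=> f; rewrite !hcommE Eb Db DZ EZ Eb Db; apply: ShatP => s.
  rewrite !(ShatZE, ShatDE, ShatNE, Shat_sgnE).
  by case: (b); case: (c); rewrite /= ?expr0 ?expr1; ring.
- move=> f g; rewrite !hcommE Ed Dd DD ED !Dd !Ed Shat_mulDl Shat_mulDr.
  rewrite sgnD sgnE -[- ((-1) ^+ _ *: E (D f))]scaleNr -[- ((-1) ^+ _ *: E (D g))]scaleNr.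
  rewrite !Shat_mulZl !Shat_mulZr.
  have -> : Shat_sgn (b (+) c) f = Shat_sgn b (Shat_sgn c f).
    by case: b {Db Dd sgnD hE}; case: c {Eb Ed sgnE}; rewrite /= ?Shat_sgn0 ?Shat_sgnK.
  rewrite (Shat_sgnC c b) (andbC c b).
  apply: ShatP => s; rewrite !(ShatZE, ShatDE, ShatNE).
  have e2 : (-1) ^+ (b && c) * (-1) ^+ (b && c) = 1 :> k by rewrite -expr2 sqrr_sign.
  by case: (b && c) e2 => /= _; rewrite ?expr0 ?expr1; ring.
Qed.

Lemma CE_commutator D E : CE D -> CE E -> CE (commutator D E).
Proof.
move=> DC EC; rewrite /commutator.
have CED D' E' : CE D' -> CE E' -> CE (D' + E').
  by move=> D'C E'C; rewrite -[D']scale1r; exact: CE_P.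
do 2![apply: big_ind => [||? _]; [exact: CE0|exact: CED|]].
by apply: hderivation_CE (hcomm_hderivation (CE_hderivation _ DC) (CE_hderivation _ EC)).
Qed.

Lemma rcontr_hderivation b v : sprj U b v = v -> hderivation b (rcontr v).
Proof.
move=> vb; split; first exact: rcontr_linear.
- by move=> s; exists [:: rcons s v] => f /(_ _ (mem_head _ _)).
- by move=> f; exact: rcontr_sgn.
- by move=> f g; exact: rcontrM.
Qed.

Lemma rcontrD u v : rcontr (u + v) = rcontr u + rcontr v :> (S -> S).
Proof. by apply: funext => f; rewrite -[u]scale1r rcontrP !scale1r. Qed.

Lemma sprj_idem b v : sprj U b (sprj U b v) = sprj U b v.
Proof. by rewrite sprjK eqxx. Qed.

Lemma CE_rcontr v : @CE k U (rcontr v).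
Proof.
rewrite -(sprjD v) rcontrD -[rcontr (sprj U false v) : S -> S]scale1r.
by apply: CE_P; apply: hderivation_CE (rcontr_hderivation (sprj_idem _ _)).
Qed.

Lemma End_prj_rcontr b v : End_prj b (rcontr v) = rcontr (sprj U b v).
Proof.
rewrite -{1}(sprjD v) rcontrD -[rcontr (sprj U false v) : S -> S]scale1r End_prjP.
have [h0l _ h0p _] := rcontr_hderivation (sprj_idem false v).
have [h1l _ h1p _] := rcontr_hderivation (sprj_idem true v).
by rewrite (parity_End_prj b h0l h0p) (parity_End_prj b h1l h1p);
  case: b; rewrite /= ?scale1r ?scaler0 ?add0r ?addr0.
Qed.

End Derivations.

(** * Constant terms and the vectors dual to a derivation *)

Section Constant_terms.
Variables (k : fieldType) (U : superspace k).
Notation S := (Shat U).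
Notation usgn := (ksgn (sprj U)).
Implicit Types (f g x : S) (D : S -> S) (b c : bool).

Lemma linear_form_contract x (w : U) : linear_form x ->
  forall t, x (w :: t) = if t is [::] then x [:: w] else 0.
Proof. by move=> xl [|v t] //; rewrite xl. Qed.

Lemma linear_form_sgn b x : linear_form x -> linear_form (Shat_sgn b x).
Proof. by move=> xl s s1; rewrite Shat_sgnE xl ?size_map. Qed.

Lemma form_expand (E : seq (U * bool * S)) (f : seq U -> k^o) u s : multilinear f ->
  \sum_(p <- E) p.2 [:: u] * f (p.1.1 :: s) = f (@expand k U E u :: s).
Proof.
move=> fl; have f0 : f (0 :: s) = 0 by apply: (multilinear0 [::] s fl).
rewrite /expand; elim: E => [|p E IH]; first by rewrite !big_nil f0.
by rewrite !big_cons IH (fl [::]).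
Qed.

(* sum_i x_i (d f / d x_i) is n f in degree n; here [p.2] is x_i and the right
   contraction by [p.1.1] is d / d x_i. *)
Lemma euler_identity (E : seq (U * bool * S)) s (f : seq U -> k^o) :
  (forall p, p \in E -> dual_pair p) -> multilinear f -> gsymmetric f ->
  (forall u, u \in s -> expand E u = u) ->
  \sum_(p <- E) form_mul s p.2 (rcontr_fun p.1.1 f) = (size s)%:R * f s.
Proof.
move=> Ed; elim: s f => [|v s IH] f fl fs sE.
  rewrite mul0r big_seq big1 // => p /Ed[xl _ _] /=.
  by rewrite xl // mul0r.
rewrite /= big_split /=.
rewrite (IH _ (multilinear_contract v fl) (gsymmetric_contract v fs)); last first.
  by move=> u us; rewrite sE // inE us orbT.
rewrite -[in RHS]natr1 mulrDl mul1r; congr (_ + _).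
rewrite -{2}(sE v (mem_head _ _)) -(form_expand _ _ _ fl) !big_seq.
apply: eq_bigr => -[[e b] x] /Ed[/= xl eb xb].
rewrite (bigD1 b) //= big1 ?addr0 => [|c cb].
  rewrite (form_mul_const _ _ (linear_form_contract _ xl)) xb eqxx; congr (_ * _).
  by rewrite /form_sgn /rcontr_fun (form_rcons _ fl fs eb) mapK //; exact: usgnK.
by rewrite (form_mul_const _ _ (linear_form_contract _ xl)) xb (negPf cb) mul0r.
Qed.

Fact deg_inv_symform f :
  (fun s : seq U => (size s)%:R^-1 * f s : k^o) \in @symform k U.
Proof.
apply/symformP; split.
  by move=> s t a u v; rewrite (Shat_multilinear f) mulrDr mulrCA !size_cat.
by move=> s t b c u v; rewrite (Shat_gsymmetric f) mulrCA !size_cat.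
Qed.
(** Inverts the Euler operator in positive degrees. In degree 0 the factor 0^-1 is 0, so a constant
    term has to be restored separately. *)
Definition deg_inv f : S := MkShat (deg_inv_symform f).

Lemma derivation1_const b D : derivation b D -> D (Shat_one U) [::] = 0.
Proof.
move=> Dd; have := congr1 (fun f : S => f [::]) (Dd (Shat_one U) (Shat_one U)).
rewrite Shat_sgn1 Shat_mul1 ShatDE /= mulr1 mul1r => /eqP.
by rewrite -subr_eq0 opprD addrA subrr sub0r oppr_eq0 => /eqP.
Qed.

(** By continuity D f at the empty sequence depends on finitely many values of f. On these f agrees
    with its constant term plus the sum of x_i times the i-th partial derivative of f / deg. The
    Leibniz rule finishes, because neither x_i nor D x_i has a constant term and D 1 has none. *)
Lemma derivation_const (char0 : [pchar k] =i pred0) b D :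
  linear D -> pointwise_continuous D -> derivation b D ->
  (forall x, linear_form x -> D x [::] = 0) -> forall f, D f [::] = 0.
Proof.
move=> Dl Dc Dd Dx f; have [L LD] := Dc [::].
have [E [Ed El]] := dual_pairs (flatten L).
pose g (p : U * bool * S) := rcontr p.1.1 (deg_inv f).
pose h : S := (f [::] : k) *: Shat_one U + \sum_(p <- E) Shat_mul p.2 (g p).
have hE t : t \in L -> h t = f t.
  move=> tL; rewrite ShatDE ShatZE Shat_sumE.
  have -> : \sum_(p <- E) Shat_mul p.2 (g p) t = (size t)%:R * deg_inv f t.
    apply: euler_identity Ed (Shat_multilinear _) (Shat_gsymmetric _) _.
    by move=> u ut; apply: El; apply/flattenP; exists t.
  case: t tL => [|v t] _ /=; first by rewrite mulr1 mul0r addr0.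
  by rewrite mulr0 add0r mulrA mulfV ?mul1r // (char0_neq0 char0).
have DZ a x : D (a *: x) = a *: D x.
  by rewrite -[a *: x]addr0 Dl (linear_fun0 Dl) addr0.
have DD x y : D (x + y) = D x + D y by have := Dl 1 x y; rewrite !scale1r.
have fh : D (f - h) [::] = 0.
  by apply: LD => t tL; rewrite ShatDE ShatNE hE // subrr.
rewrite -[f](subrK h) DD ShatDE fh add0r DD ShatDE DZ ShatZE.
rewrite (derivation1_const Dd) mulr0 add0r (big_morph D DD (linear_fun0 Dl)).
rewrite Shat_sumE big_seq big1 // => p /Ed[xl _ _].
by rewrite Dd ShatDE /= Dx // mul0r add0r /form_sgn /= xl // mul0r.
Qed.

Definition const_free D := forall f, D f [::] = 0.

(** Replaces the condition on linear forms by one on all forms, which is evidently stable under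
    composition and hence under brackets. *)
Lemma CEbar_const_free (char0 : [pchar k] =i pred0) D : CEbar D -> const_free D.
Proof.
move=> [DC Dx] f; rewrite -(End_prjD (char0_neq0 char0 1) (CE_linear DC)) fctE ShatDE.
suff H b : End_prj b D f [::] = 0 by rewrite !H addr0.
have [Dl Dc _ Dd] := CE_hderivation (char0_neq0 char0 1) b DC.
apply: (derivation_const char0 Dl Dc Dd) => x xl.
rewrite (End_prjE (char0_neq0 char0 1)); last exact: CE_linear.
by rewrite !(ShatZE, ShatDE) Shat_sgnE /= !Dx ?mulr0 ?addr0 ?mulr0 //; exact: linear_form_sgn.
Qed.

(** The functional sending x to D x s lies a priori in the double dual of U. Continuity makes it
    depend on finitely many values of x, so that it is evaluation at a vector. *)
Lemma str_vec_exists D s : CE D ->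
  exists u, forall x, linear_form x -> D x s = x [:: u].
Proof.
move=> [Dl Dc _]; have [L LD] := Dc s.
have [E [Ed El]] := dual_pairs (flatten L).
have DZ a x : D (a *: x) = a *: D x.
  by rewrite -[a *: x]addr0 Dl (linear_fun0 Dl) addr0.
have DD x y : D (x + y) = D x + D y by have := Dl 1 x y; rewrite !scale1r.
exists (\sum_(p <- E) (D p.2 s : k) *: p.1.1) => x xl.
(* The part of x seen by the partial dual basis: y is x composed with [expand E], hence equal to x
   on all vectors that D inspects. *)
pose y : S := \sum_(p <- E) (x [:: p.1.1] : k) *: p.2.
have yE u : y [:: u] = x [:: expand E u].
  rewrite /y Shat_sumE -(form_expand _ _ _ (Shat_multilinear x)).
  by apply: eq_bigr => p _; rewrite ShatZE mulrC.
have /eqP : D (x - y) s = 0.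
  apply: LD => t tL; rewrite ShatDE ShatNE; have [t1|t1] := eqVneq (size t) 1%N.
    case: t t1 tL => [|u [|]] // _ uL; rewrite yE El ?subrr //.
    by apply/flattenP; exists [:: u] => //; rewrite mem_head.
  rewrite xl // /y Shat_sumE big_seq big1 ?subrr // => p /Ed[pl _ _].
  by rewrite ShatZE pl // mulr0.
rewrite -scaleN1r DD DZ ShatDE ShatZE mulN1r subr_eq0 => /eqP->.
rewrite (big_morph D DD (linear_fun0 Dl)) Shat_sumE.
have xsum (F : U * bool * S -> k) : x [:: \sum_(p <- E) F p *: p.1.1] =
    \sum_(p <- E) F p * x [:: p.1.1].
  elim: {Ed El y yE} E => [|p E IH].
    by rewrite !big_nil (multilinear0 [::] [::] (Shat_multilinear x)).
  by rewrite !big_cons (Shat_multilinear x [::] [::]) IH.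
by rewrite xsum; apply: eq_bigr => p _; rewrite DZ ShatZE mulrC.
Qed.

Definition str_vec D s : U := xget 0 [set u | forall x, linear_form x -> D x s = x [:: u]].

Lemma str_vecP D s x : CE D -> linear_form x -> D x s = x [:: str_vec D s].
Proof.
move=> DC; rewrite /str_vec; case: xgetP => [u _ /(_ x)//|no].
by have [u uP] := str_vec_exists s DC; have := no u uP.
Qed.

Lemma linear_formN x u : x [:: - u] = - x [:: u].
Proof.
have := multilinearZ [::] [::] (-1) u (Shat_multilinear x).
by rewrite scaleN1r mulN1r.
Qed.

Lemma linear_formD x u v : x [:: u + v] = x [:: u] + x [:: v].
Proof.
have := linear_form_linear x 1 u v.
by rewrite !scale1r.
Qed.

(** Brings both parities of [str] to the single form [Shat_sgn true x]. For the even part, x is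
    written as sgn (sgn x) and the outer sgn commutes with the operator, to end up on the
    arguments. *)
Lemma str_pairing (char0 : [pchar k] =i pred0) D s x : CE D -> linear_form x ->
  x [:: str D s] =
  - \sum_(b : bool) End_prj b D (Shat_sgn true x) (map (usgn (~~ b)) s).
Proof.
move=> DC xl; pose DbC b := CE_End_prj (char0_neq0 char0 1) b DC.
have str_prjP b y : linear_form y ->
    End_prj b D y s = - y [:: usgn b (str_prj b D s)].
  rewrite /str_prj; case: xgetP => [u _ /(_ y)//|no yl].
  have := no (usgn b (- str_vec (End_prj b D) s)); case=> z zl.
  by rewrite usgnK (str_vecP _ (DbC b) zl) linear_formN opprK.
have xE b : x [:: str_prj b D s] = - End_prj b D (Shat_sgn b x) s.
  rewrite str_prjP; last exact: linear_form_sgn.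
  by rewrite opprK Shat_sgnE /= usgnK.
rewrite /str !big_bool linear_formD !xE -opprD /= map_id; congr (- (_ + _)).
have DP := End_prj_parity (char0_neq0 char0 1) false (CE_linear DC).
rewrite Shat_sgn0 -{1}(Shat_sgnK true x) DP scale1r Shat_sgnE.
by [].
Qed.

End Constant_terms.

(* In characteristic 2 all parity projections of Shat vanish, so CE is still
   closed under the operations below. *)
Section CE_closure.
Variables (k : fieldType) (U : superspace k).
Notation S := (Shat U).

Lemma End_prj_char2 b (D : S -> S) : 2 = 0 :> k -> End_prj b D = 0.
Proof.
move=> k2; apply: funext => f; rewrite /End_prj big1 // => c _.
by rewrite /Shat_prj k2 invr0 scale0r.
Qed.

Lemma CE_End_prj_gen b (D : S -> S) : CE D -> CE (End_prj b D).
Proof.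
move=> DC; have [k2|nz2] := eqVneq (2 : k) 0; last exact: CE_End_prj.
rewrite End_prj_char2 //; split=> [a f g|s|c].
- by rewrite /= [RHS](_ : _ = a *: 0 + 0) // scaler0 addr0.
- by exists [::].
- by rewrite End_prj_char2 //; exact: derivation0.
Qed.

Lemma CE_commutator_gen (D E : S -> S) : CE D -> CE E -> CE (commutator D E).
Proof.
move=> DC EC; have [k2|nz2] := eqVneq (2 : k) 0; last exact: CE_commutator.
have -> : commutator D E = End_prj false D.
  apply: funext => f; rewrite /commutator !big_bool /= !End_prj_char2 //.
  by rewrite !fctE /= !scaler0 !subr0 !addr0.
exact: CE_End_prj_gen.
Qed.

Lemma CE_rcontr_gen v : @CE k U (rcontr v).
Proof.
have [k2|nz2] := eqVneq (2 : k) 0; last exact: CE_rcontr.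
split=> [|s|c]; first exact: rcontr_linear.
- by exists [:: rcons s v] => f /(_ _ (mem_head _ _)).
- by rewrite End_prj_char2 //; exact: derivation0.
Qed.

Lemma CE_zero : @CE k U 0.
Proof.
split=> [a f g|s|c].
- by rewrite /= [RHS](_ : _ = a *: 0 + 0) // scaler0 addr0.
- by exists [::].
- have -> : End_prj c (0 : S -> S) = 0; last exact: derivation0.
  apply: funext => f; rewrite /End_prj big1 // => d _.
  exact: (linear_fun0 (@Shat_prj_linear k U _)).
Qed.

Lemma commutatorE (D E : S -> S) f : commutator D E f =
  \sum_(b : bool) \sum_(c : bool) (End_prj b D (End_prj c E f)
    - (-1) ^+ (b && c) *: End_prj c E (End_prj b D f)).
Proof. by rewrite /commutator !big_bool. Qed.

End CE_closure.

(** * The module of derivations *)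

Section CE_type.
Variables (k : fieldType) (U : superspace k).
Notation S := (Shat U).

Definition CE_pred : {pred (S -> S)} := fun D => `[< CE D >].

Lemma CE_predP (D : S -> S) : reflect (CE D) (D \in CE_pred).
Proof. exact: asboolP. Qed.

Fact CE_submod_closed : submod_closed CE_pred.
Proof.
split=> [|a D E /CE_predP DC /CE_predP EC]; apply/CE_predP; first exact: CE_zero.
exact: CE_P.
Qed.
HB.instance Definition _ :=
  GRing.isSubmodClosed.Build k (S -> S) CE_pred CE_submod_closed.

(** A type of its own for the elements of [CE]: the commutator is bilinear only among linear
    operators, and extension of scalars requires bilinear operations. *)
Record der := MkDer { der_fun :> S -> S; _ : der_fun \in CE_pred }.
HB.instance Definition _ := [isSub for der_fun].
HB.instance Definition _ := [Choice of der by <:].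
HB.instance Definition _ := [SubChoice_isSubLmodule of der by <:].

Lemma der_CE (D : der) : CE D. Proof. by case: D => D /= /CE_predP. Qed.

Definition mk_der (D : S -> S) (DC : CE D) : der := MkDer (introT (CE_predP D) DC).

Lemma derP (D E : der) : (forall f, D f = E f) -> D = E.
Proof. by move=> DE; apply/val_inj/funext. Qed.

Lemma der_linear (D : der) : linear D. Proof. exact: CE_linear (der_CE D). Qed.
HB.instance Definition _ (D : der) := GRing.isLinear.Build k S S *:%R D (der_linear D).

Lemma der_fun_is_linear : linear (der_fun : der -> (S -> S)).
Proof. by []. Qed.
HB.instance Definition _ :=
  GRing.isLinear.Build k der (S -> S) *:%R der_fun der_fun_is_linear.

Lemma derDE (D E : der) f : (D + E) f = D f + E f. Proof. by []. Qed.
Lemma derZE c (D : der) f : (c *: D) f = c *: D f. Proof. by []. Qed.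

Definition der_prj b (D : der) : der := mk_der (CE_End_prj_gen b (der_CE D)).

Lemma der_prj_linear b : linear (der_prj b).
Proof. by move=> a D E; apply/val_inj; exact: End_prjP. Qed.
HB.instance Definition _ b := GRing.isLinear.Build k der der *:%R (der_prj b) (der_prj_linear b).

Definition der_bra (D E : der) : der := mk_der (CE_commutator_gen (der_CE D) (der_CE E)).

Lemma End_prj_P b a (D E : S -> S) f :
  End_prj b (a *: D + E) f = a *: End_prj b D f + End_prj b E f.
Proof. by rewrite End_prjP. Qed.

Lemma der_bra_linearr D : linear (der_bra D).
Proof.
move=> a E F; apply: derP => f; rewrite derDE derZE /= !commutatorE.
rewrite scaler_sumr -big_split; apply: eq_bigr => b _ /=.
rewrite scaler_sumr -big_split; apply: eq_bigr => c _ /=.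
rewrite !(End_prj_P c a E F).
rewrite (End_prj_linear_fun b (der_linear D)); apply: ShatP => s.
by rewrite !(ShatZE, ShatDE, ShatNE); ring.
Qed.

Lemma der_bra_linearl E : linear (der_bra^~ E).
Proof.
move=> a D F; apply: derP => f; rewrite derDE derZE /= !commutatorE.
rewrite scaler_sumr -big_split; apply: eq_bigr => b _ /=.
rewrite scaler_sumr -big_split; apply: eq_bigr => c _ /=.
rewrite !(End_prj_P b a D F) (End_prj_linear_fun c (der_linear E)); apply: ShatP => s.
by rewrite !(ShatZE, ShatDE, ShatNE); ring.
Qed.

Definition der_rcontr (v : U) : der := mk_der (CE_rcontr_gen v).

Lemma der_rcontr_linear : linear der_rcontr.
Proof. by move=> a u v; apply: derP => f; rewrite derDE derZE /= rcontrP. Qed.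
HB.instance Definition _ := GRing.isLinear.Build k U der *:%R der_rcontr der_rcontr_linear.

Definition der_vec s (D : der) : U := str_vec D s.

Lemma der_vecP s (D : der) x : linear_form x -> D x s = x [:: der_vec s D].
Proof. exact: str_vecP (der_CE D). Qed.

Lemma der_vec_linear s : linear (der_vec s).
Proof.
move=> a D E; apply: linear_form_inj => x xl.
by rewrite -der_vecP // linear_form_linear -!der_vecP.
Qed.
HB.instance Definition _ s := GRing.isLinear.Build k der U *:%R (der_vec s) (der_vec_linear s).

Lemma der_vec_rcontr v : der_vec [::] (der_rcontr v) = v.
Proof. by apply: linear_form_inj => x xl; rewrite -der_vecP. Qed.

End CE_type.

(** * Homogeneous derivations and absence of constant terms *)

Section Derivation_parity.
Variables (k : fieldType) (char0 : [pchar k] =i pred0) (U : superspace k).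
Notation S := (Shat U).
Implicit Types (D E : der U) (b c : bool).

Let nz2 : 2 != 0 :> k. Proof. exact: (char0_neq0 char0 1). Qed.

Lemma der_prj_hom b D : parity b D -> der_prj b D = D.
Proof.
by move=> Db; apply/val_inj; rewrite /= (parity_End_prj nz2 _ (der_linear D) Db) eqxx.
Qed.

Lemma der_prjP b D : parity b (der_prj b D).
Proof. exact: (End_prj_parity nz2 b (der_linear D)). Qed.

Lemma hom_der_parity b D : der_prj b D = D -> parity b D.
Proof. by move=> <-; exact: der_prjP. Qed.

Lemma der_prjK b c D : der_prj b (der_prj c D) = if b == c then der_prj c D else 0.
Proof.
apply/val_inj; rewrite /= (parity_End_prj nz2 b (End_prj_linear_fun c (der_linear D)) (der_prjP c D)).
by case: (b == c).
Qed.

Lemma der_prjD D : der_prj false D + der_prj true D = D.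
Proof.
apply: derP => f; rewrite derDE.
by have /(congr1 (fun D : S -> S => D f)) := End_prjD nz2 (der_linear D).
Qed.

Lemma hom_der_hderivation b D : der_prj b D = D -> hderivation b D.
Proof. by move=> <-; exact: (CE_hderivation nz2 b (der_CE D)). Qed.

Lemma der_braE b c D E f : der_prj b D = D -> der_prj c E = E ->
  der_bra D E f = D (E f) - (-1) ^+ (b && c) *: E (D f).
Proof.
move=> Db Ec; rewrite /= commutatorE.
have DE b' : End_prj b' D = if b' == b then D : S -> S else 0.
  exact: (parity_End_prj nz2 _ (der_linear D) (hom_der_parity Db)).
have EE c' : End_prj c' E = if c' == c then E : S -> S else 0.
  exact: (parity_End_prj nz2 _ (der_linear E) (hom_der_parity Ec)).
have zE (g : S) : (0 : S -> S) g = 0 by [].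
rewrite (bigD1 b) //= [X in _ + X]big1 ?addr0 => [|b' /negPf bb].
  rewrite (bigD1 c) //= big1 ?addr0 => [|c' /negPf cc].
    by rewrite DE EE !eqxx.
  by rewrite EE cc DE eqxx /= !zE linear0 scaler0 subr0.
rewrite big1 // => c' _; rewrite DE bb EE.
by case: (c' == c); rewrite /= !zE; rewrite ?(linear_fun0 (der_linear E)) scaler0 subr0.
Qed.

Lemma der_prj_bra b c D E : der_prj b D = D -> der_prj c E = E ->
  der_prj (b (+) c) (der_bra D E) = der_bra D E.
Proof.
move=> Db Ec; apply: der_prj_hom => f.
have [_ _ p _] := hcomm_hderivation (hom_der_hderivation Db) (hom_der_hderivation Ec).
by have := p f; rewrite !hcommE !(der_braE _ Db Ec).
Qed.

Lemma der_prj_rcontr b v : der_prj b (der_rcontr v) = der_rcontr (sprj U b v).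
Proof. by apply/val_inj; exact: (End_prj_rcontr nz2). Qed.

Lemma der_bra_rcontr b c u v : sprj U b u = u -> sprj U c v = v ->
  der_bra (der_rcontr u) (der_rcontr v) = 0.
Proof.
move=> ub vc; apply: derP => f.
rewrite (@der_braE b c) ?der_prj_rcontr ?ub ?vc //=.
by rewrite (rcontrC f ub vc) subrr.
Qed.

Lemma sprj_der_vec b D : sprj U b (der_vec [::] D) = der_vec [::] (der_prj b D).
Proof.
apply: linear_form_inj => x xl; rewrite -der_vecP //= End_prjE //; last exact: der_linear.
rewrite !(ShatZE, ShatDE, Shat_sgnE) (der_vecP _ _ xl) /=.
rewrite (der_vecP _ _ (linear_form_sgn true xl)) Shat_sgnE /=.
set v := der_vec _ _.
have -> : x [:: v] = x [:: sprj U false v] + x [:: sprj U true v].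
  by rewrite -linear_formD sprjD.
rewrite linear_formD linear_formN.
by case: b; rewrite /= ?expr0 ?expr1; field.
Qed.

Definition dfree D := const_free D.

Lemma dfreeP a D E : dfree D -> dfree E -> dfree (a *: D + E).
Proof. by move=> D0 E0 f; rewrite derDE derZE ShatDE ShatZE D0 E0 mulr0 addr0. Qed.

Lemma dfree_prj b D : dfree D -> dfree (der_prj b D).
Proof.
move=> D0 f; rewrite /= End_prjE //; last exact: der_linear.
by rewrite !(ShatZE, ShatDE, Shat_sgnE) /= !D0 mulr0 addr0 mulr0.
Qed.

Lemma dfree_bra D E : dfree D -> dfree E -> dfree (der_bra D E).
Proof.
move=> D0 E0 f; rewrite /= commutatorE !big_bool !(ShatDE, ShatNE, ShatZE).
by rewrite -![End_prj _ _]/(der_fun (der_prj _ _)) !dfree_prj // !mulr0 !subr0 !addr0.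
Qed.

Lemma dfree_vec D : der_vec [::] D = 0 -> dfree D.
Proof.
move=> D0; apply: (CEbar_const_free char0); split; first exact: der_CE.
move=> x xl; rewrite (der_vecP _ _ xl) D0.
by rewrite (multilinear0 [::] [::] (Shat_multilinear x)).
Qed.

Lemma dfree_CEbar D : dfree D <-> CEbar D.
Proof.
split=> [D0|]; last exact: CEbar_const_free.
by split=> [|f _]; [exact: der_CE|exact: D0].
Qed.

End Derivation_parity.

(** * Coefficients in A *)

Section Unital_algebra.
Variables (k : fieldType) (A : nil_cdga k).
Notation B := (uvec A).
Implicit Types (x y z : B) (a : A) (b c : bool).
Notation uprj := (@uprj k A).
Notation umul := (@umul k A).
Notation uinc := (@uinc k A).
Notation uone := (uone A).

Lemma amul_linearl (z : A) : linear ((@amul k A)^~ z). Proof. by move=> c x y; exact: amulPl. Qed.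
Lemma amul_linearr (z : A) : linear (@amul k A z). Proof. by move=> c x y; exact: amulPr. Qed.
Lemma amulDl (x y z : A) : amul (x + y) z = amul x z + amul y z.
Proof. exact: (linear_funD (amul_linearl z)). Qed.
Lemma amulDr (x y z : A) : amul x (y + z) = amul x y + amul x z.
Proof. exact: (linear_funD (amul_linearr x)). Qed.
Lemma amul0l (z : A) : amul 0 z = 0. Proof. exact: (linear_fun0 (amul_linearl z)). Qed.
Lemma amul0r (z : A) : amul z 0 = 0. Proof. exact: (linear_fun0 (amul_linearr z)). Qed.
Lemma amulZl (c : k) (y z : A) : amul (c *: y) z = c *: amul y z.
Proof. exact: (linear_funZ (amul_linearl z)). Qed.
Lemma amulZr (c : k) (y z : A) : amul z (c *: y) = c *: amul z y.
Proof. exact: (linear_funZ (amul_linearr z)). Qed.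

Lemma uprj_linear b : linear (uprj b).
Proof.
move=> c x y; rewrite /Defs.uprj; congr pair; rewrite /= ?linearP //.
by case: b; rewrite // scaler0 addr0.
Qed.
HB.instance Definition _ b := GRing.isLinear.Build k B B *:%R (uprj b) (uprj_linear b).

Lemma udif_linear : linear (@udif k A).
Proof. by move=> c x y; rewrite /udif; congr pair; rewrite /= ?linearP ?scaler0 ?addr0. Qed.
HB.instance Definition _ := GRing.isLinear.Build k B B *:%R (@udif k A) udif_linear.

Lemma uinc_linear : linear uinc.
Proof. by move=> c x y; rewrite /uinc; congr pair; rewrite /= scaler0 addr0. Qed.
HB.instance Definition _ := GRing.isLinear.Build k A B *:%R uinc uinc_linear.

Lemma umul_linearr x : linear (umul x).
Proof.
move=> c y z; rewrite /umul; congr pair => /=.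
  by rewrite mulrDr mulrCA.
rewrite !scalerDr amulPr scalerDl !scalerA (mulrC x.1) [c *: y.1](_ : _ = c * y.1) //.
by rewrite [RHS]addrACA; congr (_ + _); rewrite addrACA.
Qed.
HB.instance Definition _ x := GRing.isLinear.Build k B B *:%R (umul x) (umul_linearr x).

Lemma umul_linearl y : linear (umul^~ y).
Proof.
move=> c x z; rewrite /umul; congr pair => /=.
  by rewrite mulrDl [c *: x.1](_ : _ = c * x.1) // -mulrA.
rewrite !scalerDr amulPl scalerDl !scalerA (mulrC y.1) [c *: x.1](_ : _ = c * x.1) //.
by rewrite [RHS]addrACA; congr (_ + _); rewrite addrACA.
Qed.

Lemma umul_bilin : bilin umul.
Proof. by split; [exact: umul_linearl|exact: umul_linearr]. Qed.

Lemma umul1 x : umul uone x = x.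
Proof. by case: x => x1 x2; rewrite /umul /= mul1r scale1r scaler0 amul0l !addr0. Qed.
Lemma umulr1 x : umul x uone = x.
Proof. by case: x => x1 x2; rewrite /umul /= mulr1 scale1r scaler0 amul0r addr0 add0r. Qed.

Lemma umulA x y z : umul x (umul y z) = umul (umul x y) z.
Proof.
case: x y z => [x1 x2] [y1 y2] [z1 z2]; rewrite /umul /= mulrA; congr pair.
rewrite !scalerDr !amulDr !amulDl !amulZl !amulZr !scalerA amulA !addrA (mulrC z1 x1).
rewrite (mulrC z1 y1) [LHS](ACl (1 * 2 * 4 * 6 * 3 * 5 * 7)) /=.
by [].
Qed.

Lemma uprjK b c x : uprj b (uprj c x) = if b == c then uprj c x else 0.
Proof. by rewrite /Defs.uprj /= aprjK; case: b; case: c. Qed.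

Lemma uprjD x : uprj false x + uprj true x = x.
Proof. by case: x => x1 x2; rewrite /Defs.uprj; congr pair; rewrite /= ?addr0 ?aprjD. Qed.

Lemma uprj_idem b x : uprj b (uprj b x) = uprj b x.
Proof. by rewrite uprjK eqxx. Qed.

Lemma uprj_hom b x : uprj b x = x -> forall c, uprj c x = if c == b then x else 0.
Proof. by move=> xb c; rewrite -{1}xb uprjK xb. Qed.

Lemma uprj_uinc b a : uprj b (uinc a) = uinc (aprj A b a).
Proof. by rewrite /Defs.uprj /=; case: b. Qed.

Lemma uprj_uone : uprj false uone = uone.
Proof. by rewrite /Defs.uprj /= linear0. Qed.

Lemma umul_hom b c x y : uprj b x = x -> uprj c y = y ->
  uprj (b (+) c) (umul x y) = umul x y.
Proof.
case: x y => [x1 x2] [y1 y2]; rewrite /Defs.uprj /umul /= => -[x10 x2b] [y10 y2c].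
congr pair.
  by case: b {x2b} x10 => /= x10; case: c {y2c} y10 => /= y10 //;
    first [by rewrite -x10 mul0r|by rewrite -y10 mulr0].
rewrite raddfD /= linearD !linearZ /= -x2b -y2c amul_prj x2b y2c; congr (_ + _ + _).
  case: b {x2b} x10 => [<-|_]; first by rewrite !scale0r.
  by rewrite addFb y2c.
case: c {y2c} y10 => [<-|_]; first by rewrite !scale0r.
by rewrite addbF x2b.
Qed.

Lemma umulC_hom b c x y : uprj b x = x -> uprj c y = y ->
  umul x y = (-1) ^+ (b && c) *: umul y x.
Proof.
case: x y => [x1 x2] [y1 y2]; rewrite /Defs.uprj /umul /= => -[x10 x2b] [y10 y2c].
have e (z : k) (w : A) : (-1) ^+ (b && c) *: ((z, w) : B) =
    ((-1) ^+ (b && c) * z, (-1) ^+ (b && c) *: w) by [].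
rewrite e; congr pair.
  case: b x10 {x2b e} => [<-|_]; first by rewrite mul0r mulr0 mulr0.
  by rewrite /= expr0 mul1r mulrC.
have -> : amul x2 y2 = (-1) ^+ (b && c) *: amul y2 x2.
  by rewrite -{1}x2b -{1}y2c amulC x2b y2c.
rewrite !scalerDr; congr (_ + _).
rewrite addrC; congr (_ + _).
  case: c y10 {y2c e} => [<-|_]; first by rewrite !scale0r scaler0.
  by rewrite andbF expr0 scale1r.
case: b x10 {x2b e} => [<-|_]; first by rewrite !scale0r scaler0.
by rewrite expr0 scale1r.
Qed.

Definition usgnA b (x : B) : B := ksgn uprj b x.

Lemma usgnA_linear b : linear (usgnA b).
Proof.
move=> c x y; rewrite /usgnA /ksgn; case: b => //.
by rewrite 2!linearP /= opprD addrACA scalerBr.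
Qed.
HB.instance Definition _ b := GRing.isLinear.Build k B B *:%R (usgnA b) (usgnA_linear b).

Lemma usgnA_hom b c x : uprj c x = x -> usgnA b x = (-1) ^+ (b && c) *: x.
Proof.
move=> xc; rewrite /usgnA /ksgn !(uprj_hom xc); case: b; last by rewrite scale1r.
by case: c {xc}; rewrite /= ?expr1 ?expr0 ?scaleN1r ?scale1r ?subr0 ?sub0r.
Qed.

Lemma usgnA_uinc b a : usgnA b (uinc a) = uinc (ksgn (fun b => aprj A b) b a).
Proof. by rewrite /usgnA /ksgn; case: b; rewrite // !uprj_uinc -raddfB. Qed.

Lemma hom_ind (P : B -> Prop) : (forall x y, P x -> P y -> P (x + y)) ->
  (forall b x, uprj b x = x -> P x) -> forall x, P x.
Proof. by move=> PD Ph x; rewrite -(uprjD x); apply: PD; apply: Ph (uprj_idem _ _). Qed.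

Lemma usgnAM b x y : usgnA b (umul x y) = umul (usgnA b x) (usgnA b y).
Proof.
move: x; apply: hom_ind => [x x' IH IH'|c x xc].
  by rewrite (bilinDl umul_bilin) !raddfD /= IH IH' (bilinDl umul_bilin).
move: y; apply: hom_ind => [y y' IH IH'|d y yd].
  by rewrite !raddfD /= IH IH'.
rewrite !(usgnA_hom b xc, usgnA_hom b yd, usgnA_hom b (umul_hom xc yd)).
rewrite (bilinZl umul_bilin) (bilinZr umul_bilin) scalerA; congr (_ *: _).
by rewrite -signr_addb -andb_addr.
Qed.

Lemma udif_hom b x : uprj b x = x -> uprj (~~ b) (@udif k A x) = udif x.
Proof.
case: x => [x1 x2]; rewrite /Defs.uprj /udif /= => -[_ xb].
by rewrite -adif_prj xb; case: b {xb}.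
Qed.

Lemma udif_sq x : udif (@udif k A x) = 0.
Proof. by rewrite /udif /= adif_sq. Qed.

Lemma udif_uone : @udif k A uone = 0.
Proof. by rewrite /udif /= linear0. Qed.

Lemma udifM x y : @udif k A (umul x y) =
  umul (udif x) y + umul (usgnA true x) (udif y).
Proof.
case: x y => [x1 x2] [y1 y2]; rewrite /umul /udif /usgnA /ksgn /Defs.uprj /=.
congr pair; first by rewrite /= mul0r mulr0 addr0.
rewrite !raddfD /= !linearZ /= adifM /ksgn /= !scale0r !addr0 add0r subr0.
by rewrite [X in X + _ = _]addrC addrACA.
Qed.

(* The filtration by powers of the augmentation ideal. *)
Inductive fil : nat -> B -> Prop :=
| fil_all x : fil 0 x
| fil_zero r : fil r 0
| fil_cons r x a y : fil r x -> fil r.+1 y -> fil r.+1 (umul x (uinc a) + y).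

Lemma filD r x y : fil r x -> fil r y -> fil r (x + y).
Proof.
move=> fx; elim: fx y => [x'|r'|r' x' a z fx' _ fz IH] y fy; first exact: fil_all.
  by rewrite add0r.
by rewrite -addrA; apply: fil_cons => //; exact: IH.
Qed.

Lemma filZ r (c : k) x : fil r x -> fil r (c *: x).
Proof.
elim=> [x'|r'|r' x' a z fx' IH fz IH']; first exact: fil_all.
  by rewrite scaler0; exact: fil_zero.
by rewrite scalerDr -(bilinZl umul_bilin); exact: fil_cons.
Qed.

Lemma fil_mulr r x a : fil r x -> fil r.+1 (umul x (uinc a)).
Proof. by move=> fx; rewrite -[umul _ _]addr0; apply: fil_cons => //; exact: fil_zero. Qed.

Lemma umul_uincl a x : umul (uinc a) x = uinc ((x.1 : k) *: a + amul a x.2).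
Proof. by rewrite /umul /uinc /= mul0r scale0r add0r. Qed.

Lemma umul_uincr a x : umul x (uinc a) = uinc ((x.1 : k) *: a + amul x.2 a).
Proof. by rewrite /umul /uinc /= mulr0 scale0r addr0. Qed.

Lemma umul_uinc (a a' : A) : umul (uinc a) (uinc a') = uinc (amul a a').
Proof. by rewrite umul_uincl /= scale0r add0r. Qed.

Lemma fil_uinc a : fil 1 (uinc a).
Proof. by rewrite -[uinc a]umul1; apply: fil_mulr; exact: fil_all. Qed.

(** [fil] is generated by multiplication on the right; a factor on the left passes through by
    associativity. *)
Lemma fil_mull r x a : fil r x -> fil r.+1 (umul (uinc a) x).
Proof.
elim=> [x'|r'|r' x' a' z fx' IH fz IH'].
- by rewrite umul_uincl; exact: fil_uinc.
- by rewrite linear0; exact: fil_zero.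
- by rewrite raddfD /= umulA; exact: fil_cons.
Qed.

Lemma filW_pred r x : fil r x -> fil r.-1 x.
Proof.
elim=> [x'|r'|[|r'] x' a' z fx' IH fz IH']; try exact: fil_all; first exact: fil_zero.
by apply: filD IH'; exact: fil_mulr.
Qed.

Lemma filS r x : fil r.+1 x -> fil r x. Proof. exact: filW_pred. Qed.

Lemma fil_usgnA r b x : fil r x -> fil r (usgnA b x).
Proof.
elim=> [x'|r'|r' x' a' z fx' IH fz IH']; first exact: fil_all.
  by rewrite linear0; exact: fil_zero.
by rewrite raddfD /= usgnAM usgnA_uinc; exact: fil_cons.
Qed.

Lemma fil_aug r x : fil r x -> (0 < r)%N -> x = uinc x.2.
Proof.
elim=> // {r x} r x a y _ _ _ IH _.
by rewrite umul_uincr (IH isT) -raddfD.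
Qed.

Lemma fil_udif x : fil 1 (@udif k A x). Proof. exact: fil_uinc. Qed.

Lemma fil_nilpotent : exists N, forall r x, (N <= r)%N -> fil r x -> x = 0.
Proof.
(* The additional factor is for order 0, where an element may have a scalar component: only after
   multiplication by a first element of A does it lie in A, where [amul_nil] applies. *)
have [N nilN] := amul_nil A; exists N.+1 => r x Nr fx.
pose m s y := foldl (fun x a => umul x (uinc a)) y s.
have mD s : {morph m s : y z / y + z}.
  by elim: s => [//|a s IH] y z; rewrite /m /= (bilinDl umul_bilin); exact: IH.
have m0 s : m s 0 = 0 by apply: (addrI (m s 0)); rewrite -mD !addr0.
have minc s a : m s (uinc a) = uinc (foldl (@amul k A) a s).
  by elim: s a => [//|a' s IH] a; rewrite /m /= umul_uinc; exact: IH.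
(* Generalized over the factors s still to be multiplied: unfolding [fil] moves one factor from the
   order r to the list s. *)
suff H (s : seq A) : (N < r + size s)%N -> m s x = 0 by apply: (H [::]); rewrite addn0.
elim: fx s {Nr} => [y|r'|r' y a z _ IH _ IH'] s Ns; last first.
- by rewrite mD IH' // addr0; apply: (IH (a :: s)); rewrite /= addnS.
- exact: m0.
case: s Ns => // a s; rewrite add0n ltnS /m /= umul_uincr => Ns.
by rewrite -/(m s _) minc nilN.
Qed.

End Unital_algebra.

(** * Extension of scalars with Koszul signs *)

Section Koszul_extension.
Variables (k : fieldType) (char0 : [pchar k] =i pred0) (A : nil_cdga k).
Variables (U : superspace k).
Notation B := (uvec A).
Notation uprj := (@uprj k A).

(** Total parity |a| + |v| = b, with every summand homogeneous in both factors so that its Koszul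
    signs are explicit. *)
Definition hom_tensor (M : lmodType k) (pM : bool -> M -> M) b : tensor B M -> Prop :=
  tgen (fun a v => exists c, uprj (b (+) c) a = a /\ pM c v = v).

Definition fil_tensor (M : lmodType k) r : tensor B M -> Prop :=
  tgen (fun a _ => fil r a).

Section Operation.
Variables (M W : lmodType k) (op : der U -> M -> W).
Hypothesis opl : forall v, linear (op^~ v).
Hypothesis opr : forall D, linear (op D).

(* (a (x) D, b (x) v) |-> (-1)^(|D||b|) a b (x) op D v *)
Definition kop (X : tensor B (der U)) (Y : tensor B M) : tensor B W :=
  tlift (fun a D => tlift (fun b v =>
    \sum_(c : bool) pure (umul a (usgnA c b)) (op (der_prj c D) v)) Y) X.

Let term c a D b v := pure (A := B) (umul a (@usgnA k A c b)) (op (der_prj c D) v).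

Let term_r c a D : bilin (term c a D).
Proof.
have [pl pr] := pure_bilin B W; split=> [v|b] e x y; rewrite /term.
  by rewrite linearP linearP pl.
by rewrite opr pr.
Qed.

Let term_l c b v : bilin (fun a D => term c a D b v).
Proof.
have [pl pr] := pure_bilin B W; split=> [D|a] e x y; rewrite /term.
  by rewrite (umul_linearl _ e) pl.
by rewrite linearP opl pr.
Qed.

Let inner_bilin Y : bilin (fun a D => tlift (fun b v => \sum_(c : bool) term c a D b v) Y).
Proof.
split=> [D|a] e x y; rewrite /tlift scaler_sumr -big_split; apply: eq_bigr => j _ /=.
  rewrite scaler_sumr -big_split; apply: eq_bigr => c _ /=.
  exact: (term_l _ _ _).1.
rewrite scaler_sumr -big_split; apply: eq_bigr => c _ /=.
exact: (term_l _ _ _).2.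
Qed.

Lemma kop_linearl Y : linear (kop^~ Y).
Proof. by apply: tlift_linear => a; exact: (inner_bilin Y).2. Qed.

Lemma kop_linearr X : linear (kop X).
Proof.
move=> e Y Z; rewrite /kop /tlift scaler_sumr -big_split; apply: eq_bigr => i _ /=.
apply: (tlift_linear (h := fun b v => \sum_(c : bool) term c _ _ b v)) => b f x y.
rewrite scaler_sumr -big_split; apply: eq_bigr => c _ /=.
exact: (term_r _ _ _).2.
Qed.

Lemma kop_pure a D b v : kop (pure a D) (pure b v) =
  \sum_(c : bool) pure (umul a (usgnA c b)) (op (der_prj c D) v).
Proof.
rewrite /kop tlift_pure; last exact: inner_bilin.
by rewrite tlift_pure //; apply: bilin_sum => c; exact: term_r.
Qed.

Lemma kop_hom a p D b v : der_prj p D = D ->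
  kop (pure a D) (pure b v) = pure (umul a (usgnA p b)) (op D v).
Proof.
move=> Dp; rewrite kop_pure (bigD1 p) //= Dp big1 ?addr0 // => c cp.
rewrite -Dp (der_prjK char0) (negPf cp) (linear_fun0 (opl v)).
exact: (bilin0r (pure_bilin B W)).
Qed.

Lemma kop_fil1 r X Y : fil_tensor 1 X -> fil_tensor r Y -> fil_tensor r.+1 (kop X Y).
Proof.
move=> X1; elim: X1 Y => [|a D X' fa _ IH] Y Yr.
  by rewrite (linear_fun0 (kop_linearl Y)); exact: tgen0.
have := kop_linearl Y 1 (pure a D) X'; rewrite !scale1r => ->; apply: tgenD (IH _ Yr).
elim: Yr => [|b v Z fb _ IHZ]; first by rewrite (linear_fun0 (kop_linearr _)); exact: tgen0.
have := kop_linearr (pure a D) 1 (pure b v) Z; rewrite !scale1r => ->.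
apply: tgenD IHZ; rewrite kop_pure; apply: tgen_sum => c _; apply: tgen_pure.
by rewrite (fil_aug fa) //; apply: fil_mull; exact: fil_usgnA.
Qed.

Lemma kop_fil2 r X Y : fil_tensor r X -> fil_tensor 1 Y -> fil_tensor r.+1 (kop X Y).
Proof.
move=> Xr; elim: Xr Y => [|a D X' fa _ IH] Y Y1.
  by rewrite (linear_fun0 (kop_linearl Y)); exact: tgen0.
have := kop_linearl Y 1 (pure a D) X'; rewrite !scale1r => ->; apply: tgenD (IH _ Y1).
elim: Y1 => [|b v Z fb _ IHZ]; first by rewrite (linear_fun0 (kop_linearr _)); exact: tgen0.
have := kop_linearr (pure a D) 1 (pure b v) Z; rewrite !scale1r => ->.
apply: tgenD IHZ; rewrite kop_pure; apply: tgen_sum => c _; apply: tgen_pure.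
by rewrite (fil_aug fb) // usgnA_uinc; exact: fil_mulr.
Qed.

Lemma kop_parity (pM : bool -> M -> M) (pW : bool -> W -> W) p q X Y :
  (forall b c D v, der_prj b D = D -> pM c v = v -> pW (b (+) c) (op D v) = op D v) ->
  hom_tensor (@der_prj k U) p X -> hom_tensor pM q Y -> hom_tensor pW (p (+) q) (kop X Y).
Proof.
move=> hop hX; elim: hX Y => [|a D X' [b [ab Db]] _ IH] Y hY.
  by rewrite (linear_fun0 (kop_linearl Y)); exact: tgen0.
have := kop_linearl Y 1 (pure a D) X'; rewrite !scale1r => ->; apply: tgenD (IH _ hY).
elim: hY => [|e v Z [c [ec vc]] _ IHZ]; first by rewrite (linear_fun0 (kop_linearr _)); exact: tgen0.
have := kop_linearr (pure a D) 1 (pure e v) Z; rewrite !scale1r => ->.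
apply: tgenD IHZ; rewrite (kop_hom _ _ _ Db); apply: tgen_pure.
exists (b (+) c); split; last exact: hop.
rewrite (usgnA_hom _ ec) linearZ linearZ /=; congr (_ *: _).
have := umul_hom ab ec; rewrite addbACA.
by rewrite (addbC p) -addbA (addbC p) addbA.
Qed.

End Operation.
End Koszul_extension.

(** * The action of A (x) CE on A (x) Shat U *)

Section Action.
Variables (k : fieldType) (char0 : [pchar k] =i pred0) (A : nil_cdga k).
Variables (U : superspace k).
Notation B := (uvec A).
Notation S := (Shat U).
Notation uprj := (@uprj k A).
Notation TD := (tensor B (der U)).
Notation TS := (tensor B S).
Notation homD := (hom_tensor (@der_prj k U)).

Definition act : TD -> TS -> TS := kop (fun (D : der U) f => D f).
Definition bra : TD -> TD -> TD := kop (@der_bra k U).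

Lemma app_linearl (f : S) : linear (fun D : der U => D f).
Proof. by []. Qed.

Lemma act_linearl F : linear (act^~ F).
Proof. exact: (kop_linearl app_linearl F). Qed.
Lemma act_linearr X : linear (act X).
Proof. exact: (kop_linearr (@der_linear k U) X). Qed.
Lemma bra_linearl Y : linear (bra^~ Y).
Proof. exact: (kop_linearl (@der_bra_linearl k U) Y). Qed.
Lemma bra_linearr X : linear (bra X).
Proof. exact: (kop_linearr (@der_bra_linearr k U) X). Qed.
HB.instance Definition _ X := GRing.isLinear.Build k TS TS *:%R (act X) (act_linearr X).
HB.instance Definition _ X := GRing.isLinear.Build k TD TD *:%R (bra X) (bra_linearr X).

Lemma act_hom a p D b f : der_prj p D = D ->
  act (pure a D) (pure b f) = pure (umul a (usgnA p b)) (D f).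
Proof. exact: (kop_hom char0 app_linearl (@der_linear k U)). Qed.

Lemma bra_hom a p D b E : der_prj p D = D ->
  bra (pure a D) (pure b E) = pure (umul a (usgnA p b)) (der_bra D E).
Proof. exact: (kop_hom char0 (@der_bra_linearl k U) (@der_bra_linearr k U)). Qed.

Lemma tensor_gen_hom (M : lmodType k) (X : tensor B M) :
  tgen (fun a _ => exists c, uprj c a = a) X.
Proof.
elim: (tensor_gen X) => [|a v Y _ _ IH]; first exact: tgen0.
apply: tgenD => //; rewrite -(uprjD a) (bilinDl (pure_bilin B M)).
by apply: tgenD; apply: tgen_pure; [exists false|exists true]; exact: uprj_idem.
Qed.

(** The separate parities of coefficients and derivations are dealt with here once and for all;
    afterwards a bracket is a commutator of operators whose sign depends on total parities only. *)
Lemma act_bra p q X Y F : homD p X -> homD q Y ->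
  act (bra X Y) F = act X (act Y F) - (-1) ^+ (p && q) *: act Y (act X F).
Proof.
move=> hX hY.
apply: (linear_gen_eq (f := fun X => act (bra X Y) F)
  (g := fun X => act X (act Y F) - (-1) ^+ (p && q) *: act Y (act X F)) _ _ hX).
- by move=> c x y; rewrite bra_linearl act_linearl.
- move=> c x y; rewrite !act_linearl act_linearr scalerDr opprD addrACA.
  by rewrite !scalerBr !scalerA mulrC.
move=> a x [b [ab xb]] {hX X}.
apply: (linear_gen_eq (f := fun Y => act (bra (pure a x) Y) F)
  (g := fun Y => act (pure a x) (act Y F) - (-1) ^+ (p && q) *: act Y (act (pure a x) F))
  _ _ hY).
- by move=> c y z; rewrite bra_linearr act_linearl.
- move=> c y z; rewrite !act_linearl act_linearr scalerDr opprD addrACA.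
  by rewrite !scalerBr !scalerA mulrC.
move=> d y [c [dc yc]] {hY Y}.
apply: (linear_gen_eq (f := act (bra (pure a x) (pure d y)))
  (g := fun F => act (pure a x) (act (pure d y) F)
     - (-1) ^+ (p && q) *: act (pure d y) (act (pure a x) F)) _ _ (tensor_gen_hom F)).
- exact: act_linearr.
- move=> e G H; rewrite !act_linearr scalerDr opprD addrACA.
  by rewrite !scalerBr !scalerA mulrC.
move=> e f [g eg] {F}.
rewrite (bra_hom _ _ _ xb) (act_hom _ _ _ (der_prj_bra char0 xb yc)).
rewrite (der_braE char0 f xb yc) !(act_hom _ _ _ xb) !(act_hom _ _ _ yc) (act_hom _ _ _ xb).
have bZ := bilinZl (pure_bilin B S); have bD := bilinDr (pure_bilin B S).
have bZr := bilinZr (pure_bilin B S).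
have uZ := bilinZl (@umul_bilin k A); have uZr := bilinZr (@umul_bilin k A).
have sZ c' := linear_funZ (@usgnA_linear k A c').
rewrite !(usgnA_hom _ eg) !(usgnA_hom _ dc) !(uZ, uZr, sZ).
rewrite !(usgnA_hom _ (umul_hom dc eg)) !(usgnA_hom _ (umul_hom ab eg)).
rewrite !(uZ, uZr, bZ) !umulA (umulC_hom dc ab) uZ !bZ !scalerA.
rewrite -scaleNr bD bZr scalerDr scalerA -[in RHS]scaleNr; congr (_ *: _ + _ *: _).
  by rewrite -!signr_addb; case: (p) (q) (b) (c) (g) => [] [] [] [] [].
rewrite mulrN; congr (- _); rewrite -!signr_addb.
by case: (p) (q) (b) (c) (g) => [] [] [] [] [].
Qed.

Lemma usgnA_uone b : usgnA b (uone A) = uone A.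
Proof. by rewrite (usgnA_hom _ (uprj_uone A)) andbF scale1r. Qed.

Lemma act_one X f : act X (pure (uone A) f) = [ffun j => X j f].
Proof.
have evl : linear (fun D : der U => D f) by [].
apply: (linear_tensor_eq (f := fun X => act X (pure (uone A) f))
  (g := fun X : TD => [ffun j => X j f])) => [c x y|c x y|a D].
- by rewrite act_linearl.
- by apply/ffunP => j; rewrite !ffunE.
rewrite /act kop_pure //; last exact: der_linear.
under eq_bigr => c _ do rewrite usgnA_uone umulr1.
transitivity (pure a (D f)); last by apply/ffunP => j; rewrite !ffunE.
rewrite -[in RHS](der_prjD char0 D) derDE (bilinDr (pure_bilin B S)) big_bool.
exact: addrC.
Qed.

(** Acting on 1 (x) f reads off the coordinates of an element. Identities in A (x) CE can thus be
    proved for operators, where associativity is available. *)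
Lemma act_inj X Y : (forall F, act X F = act Y F) -> X = Y.
Proof.
move=> XY; apply/ffunP => j; apply: derP => f.
by have /ffunP/(_ j) := XY (pure (uone A) f); rewrite !act_one !ffunE.
Qed.

Lemma bra_hom_parity p q X Y : homD p X -> homD q Y -> homD (p (+) q) (bra X Y).
Proof.
apply: (kop_parity char0 (@der_bra_linearl k U) (@der_bra_linearr k U)) => b c D E.
exact: der_prj_bra.
Qed.

Lemma bra_anti p q X Y : homD p X -> homD q Y ->
  bra X Y = - (-1) ^+ (p && q) *: bra Y X.
Proof.
move=> hX hY; apply: act_inj => F; rewrite (act_bra F hX hY).
rewrite (linear_funZ (act_linearl F)) (act_bra F hY hX) scalerBr !scaleNr opprK.
by rewrite scalerA (andbC q) -expr2 sqrr_sign scale1r addrC.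
Qed.

Lemma bra_fil1 r X Y : fil_tensor 1 X -> fil_tensor r Y -> fil_tensor r.+1 (bra X Y).
Proof. exact: (kop_fil1 (@der_bra_linearl k U) (@der_bra_linearr k U)). Qed.

Lemma bra_fil2 r X Y : fil_tensor r X -> fil_tensor 1 Y -> fil_tensor r.+1 (bra X Y).
Proof. exact: (kop_fil2 (@der_bra_linearl k U) (@der_bra_linearr k U)). Qed.

Notation udif := (@udif k A).

Lemma act_udif p X F : homD p X ->
  tmap udif (act X F) = act (tmap udif X) F + (-1) ^+ p *: act X (tmap udif F).
Proof.
move=> hX.
apply: (linear_gen_eq (f := fun X => tmap udif (act X F))
  (g := fun X => act (tmap udif X) F + (-1) ^+ p *: act X (tmap udif F)) _ _ hX).
- by move=> c x y; rewrite act_linearl tmap_is_linear.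
- move=> c x y; rewrite tmap_is_linear !act_linearl scalerDr addrACA.
  by rewrite scalerDr !scalerA mulrC.
move=> a x [b [ab xb]] {hX X}.
apply: (linear_gen_eq (f := fun F => tmap udif (act (pure a x) F))
  (g := fun F => act (tmap udif (pure a x)) F + (-1) ^+ p *: act (pure a x) (tmap udif F))
  _ _ (tensor_gen_hom F)).
- by move=> c G H; rewrite act_linearr tmap_is_linear.
- move=> c G H; rewrite tmap_is_linear !act_linearr scalerDr addrACA.
  by rewrite scalerDr !scalerA mulrC.
move=> e f [g eg] {F}.
rewrite !tmap_pure !(act_hom _ _ _ xb) tmap_pure.
have bZ := bilinZl (pure_bilin B S); have bD := bilinDl (pure_bilin B S).
have uZ := bilinZl (@umul_bilin k A); have uZr := bilinZr (@umul_bilin k A).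
have dZ := linear_funZ (@udif_linear k A).
rewrite /= (usgnA_hom _ eg) (usgnA_hom _ (udif_hom eg)) !(uZr, bZ, dZ) udifM.
rewrite (usgnA_hom _ ab) uZ bD bZ scalerDr !scalerA; congr (_ + _ *: _).
by rewrite -!signr_addb; case: (p) (b) (g) => [] [] [].
Qed.

End Action.

(** * Gauge transformations of paths *)

Section Series.
Variables (k : fieldType) (char0 : [pchar k] =i pred0) (A : nil_cdga k).
Variables (U : superspace k).
Notation B := (uvec A).
Notation S := (Shat U).
Notation udif := (@udif k A).
Notation TD := (tensor B (der U)).
Notation TS := (tensor B S).
Notation homD := (hom_tensor (@der_prj k U)).
Implicit Types (X Y : nat -> TD) (F : nat -> TS).

(* X(z) acts on power series F(z) with coefficients in A (x) Shat U, so that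
   Maurer-Cartan and flow equations become commutation relations between
   d_A + M and d/dz + Q; see [MC_eqP] and [flow_eqP]. *)
Definition ser_fun X F : nat -> TS := fun n => \sum_(i < n.+1) act (X i) (F (n - i)%N).

Fact ser_fun_linear X : linear (ser_fun X).
Proof.
move=> a F G; apply: funext => n; rewrite !fctE /ser_fun scaler_sumr -big_split.
by apply: eq_bigr => i _; rewrite act_linearr.
Qed.
Definition ser X : lendo (nat -> TS) := mk_lendo (@ser_fun_linear X).

Lemma serE X F n : ser X F n = \sum_(i < n.+1) act (X i) (F (n - i)%N).
Proof. by []. Qed.

Lemma ser_linear : linear ser.
Proof.
move=> a X Y; apply: lendoP => F; apply: funext => n.
rewrite lendoDE lendoZE !fctE !serE scaler_sumr -big_split.
by apply: eq_bigr => i _; rewrite act_linearl.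
Qed.
HB.instance Definition _ :=
  GRing.isLinear.Build k (nat -> TD) (lendo (nat -> TS)) *:%R ser ser_linear.

Lemma ser_inj X Y : ser X = ser Y -> X = Y.
Proof.
move=> XY; apply: funext => n; apply: (act_inj char0) => F.
(* On a series concentrated in degree 0 the n-th coefficient of the result is that of X alone. *)
have := congr1 (fun f : lendo _ => f (fun i => if i is 0 then F else 0) n) XY.
rewrite !serE !big_ord_recr /= !subnn !big1 ?add0r // => i _;
  by rewrite -(subnSK (ltn_ord i)) linear0.
Qed.

Definition cbra X Y : nat -> TD := fun n => \sum_(i < n.+1) bra (X i) (Y (n - i)%N).

Lemma cbra_linearr X : linear (cbra X).
Proof.
move=> a Y Z; apply: funext => n; rewrite !fctE /cbra scaler_sumr -big_split.
by apply: eq_bigr => i _; rewrite bra_linearr.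
Qed.
HB.instance Definition _ X :=
  GRing.isLinear.Build k (nat -> TD) (nat -> TD) *:%R (cbra X) (cbra_linearr X).

Lemma cbra_linearl Y : linear (cbra^~ Y).
Proof.
move=> a X Z; apply: funext => n; rewrite !fctE /cbra scaler_sumr -big_split.
by apply: eq_bigr => i _; rewrite bra_linearl.
Qed.

Lemma ser_cbra p q X Y : (forall n, homD p (X n)) -> (forall n, homD q (Y n)) ->
  ser (cbra X Y) = ser X * ser Y - (-1) ^+ (p && q) *: (ser Y * ser X).
Proof.
move=> hX hY; apply: lendoP => F; apply: funext => n.
rewrite lendoDE lendoNE lendoZE !lendoME !fctE !serE.
have actsum (I : Type) (r : seq I) (Z : I -> TD) G :
    act (\sum_(i <- r) Z i) G = \sum_(i <- r) act (Z i) G.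
  exact: (linear_fun_sum (act_linearl G)).
under eq_bigr => l _.
  rewrite actsum; under eq_bigr => i _.
    rewrite (act_bra char0 _ (hX i) (hY _)); over.
  rewrite sumrB -scaler_sumr; over.
rewrite sumrB -scaler_sumr; congr (_ - _ *: _).
  transitivity (\sum_(l < n.+1) \sum_(i < l.+1) act (X i) (act (Y (l - i)%N) (F (n - i - (l - i))%N))).
    apply: eq_bigr => l _; apply: eq_bigr => i _.
    by rewrite -subnDA subnKC // -ltnS.
  rewrite (sum_triangle (fun i j => act (X i) (act (Y j) (F (n - i - j)%N)))).
  by apply: eq_bigr => i _; rewrite raddf_sum.
transitivity (\sum_(l < n.+1) \sum_(i < l.+1) act (Y i) (act (X (l - i)%N) (F (n - i - (l - i))%N))).
  apply: eq_bigr => l _; rewrite [RHS](reindex_inj rev_ord_inj) /=.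
  apply: eq_bigr => i _; have il : (i <= l)%N by rewrite -ltnS.
  by rewrite subSS subKn // -subnDA subnK.
rewrite (sum_triangle (fun i j => act (Y i) (act (X j) (F (n - i - j)%N)))).
by apply: eq_bigr => i _; rewrite raddf_sum.
Qed.

Fact dA_linear : linear (fun F (n : nat) => tmap udif (F n) : TS).
Proof. by move=> a F G; apply: funext => n; rewrite tmap_is_linear. Qed.
Definition dA : lendo (nat -> TS) := mk_lendo dA_linear.

Fact dz_linear : linear (fun F (n : nat) => F n.+1 *+ n.+1 : TS).
Proof. by move=> a F G; apply: funext => n; rewrite !fctE mulrnDl scalerMnr. Qed.
Definition dz : lendo (nat -> TS) := mk_lendo dz_linear.

Definition dAs (M : lmodType k) (X : nat -> tensor B M) : nat -> tensor B M :=
  fun n => tmap udif (X n).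
Definition dzs (M : lmodType k) (X : nat -> M) : nat -> M := fun n => X n.+1 *+ n.+1.

Lemma ser_dA p X : (forall n, homD p (X n)) ->
  ser (dAs X) = dA * ser X - (-1) ^+ p *: (ser X * dA).
Proof.
move=> hX; apply: lendoP => F; apply: funext => n.
rewrite lendoDE lendoNE lendoZE !lendoME !fctE !serE [dA _ _]raddf_sum.
apply/esym/eqP; rewrite subr_eq scaler_sumr -big_split; apply/eqP.
by apply: eq_bigr => i _; rewrite /= (act_udif char0 _ (hX i)).
Qed.

Lemma ser_dz X : ser (dzs X) = dz * ser X - ser X * dz.
Proof.
apply: lendoP => F; apply: funext => n.
rewrite lendoDE lendoNE !lendoME !fctE !serE /=; apply/esym/eqP; rewrite subr_eq.
rewrite /ser_fun -sumrMnl.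
(* Leibniz rule for d/dz: the exponent n + 1 is shared out as i + (n + 1 - i) between the two
   factors. *)
rewrite (eq_bigr (fun i : 'I_n.+2 => act (X i) (F (n.+1 - i)%N) *+ i
   + act (X i) (F (n.+1 - i)%N) *+ (n.+1 - i))); last first.
  by move=> i _; rewrite -mulrnDr subnKC // -ltnS.
rewrite big_split /=; apply/eqP; congr (_ + _).
  rewrite big_ord_recl mulr0n add0r; apply: eq_bigr => i _.
  by rewrite /dzs (linear_funMn (act_linearl _)).
rewrite big_ord_recr /= subnn mulr0n addr0; apply: eq_bigr => i _.
by rewrite subSn -1?ltnS // raddfMn.
Qed.

Lemma dAdA : dA * dA = 0.
Proof.
apply: lendoP => F; apply: funext => n; rewrite lendoME /=.
apply: (linear_tensor_eq (f := fun X : TS => tmap udif (tmap udif X)) (g := fun=> 0))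
  => [c x y|c x y|a v].
- by rewrite !tmap_is_linear.
- by rewrite scaler0 addr0.
by rewrite !tmap_pure /= udif_sq (bilin0l (pure_bilin B S)).
Qed.

Lemma dAdz : dA * dz = dz * dA.
Proof. by apply: lendoP => F; apply: funext => n; rewrite !lendoME /= raddfMn. Qed.

End Series.

(** * Conjugation by the exponential of a contraction *)

Section Gauge.
Variables (k : fieldType) (char0 : [pchar k] =i pred0) (A : nil_cdga k).
Variables (U : superspace k).
Notation B := (uvec A).
Notation udif := (@udif k A).
Notation TD := (tensor B (der U)).
Notation TU := (tensor B U).
Notation homD := (hom_tensor (@der_prj k U)).
Notation homU := (hom_tensor (fun b => sprj U b)).
Implicit Types (xi : nat -> TU).

(* The contraction by v is the derivation of Shat U with constant term v. *)
Definition cst : TU -> TD := tmapr (@der_rcontr k U).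

Lemma cst_linear : linear cst. Proof. exact: tmapr_is_linear. Qed.
HB.instance Definition _ := GRing.isLinear.Build k TU TD *:%R cst cst_linear.

Definition csts xi : nat -> TD := fun n => cst (xi n).

Lemma cst_hom p X : homU p X -> homD p (cst X).
Proof.
apply: tmapr_gen => a v [c [ac vc]]; exists c; split=> //.
by rewrite (der_prj_rcontr char0) vc.
Qed.

Lemma cst_fil r X : fil_tensor r X -> fil_tensor r (cst X).
Proof. exact: tmapr_gen. Qed.

Lemma bra_cst p q X Y : homU p X -> homU q Y -> bra (cst X) (cst Y) = 0.
Proof.
move=> hX hY.
apply: (linear_gen_eq (f := fun X => bra (cst X) (cst Y)) (g := fun=> 0) _ _ hX).
- by move=> c x y; rewrite cst_linear bra_linearl.
- by move=> c x y; rewrite scaler0 addr0.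
move=> a u [b [ab ub]].
apply: (linear_gen_eq (f := fun Y => bra (cst (pure a u)) (cst Y)) (g := fun=> 0) _ _ hY).
- by move=> c x y; rewrite cst_linear bra_linearr.
- by move=> c x y; rewrite scaler0 addr0.
move=> d v [c [dc vc]].
have uD : der_prj b (der_rcontr u) = der_rcontr u by rewrite (der_prj_rcontr char0) ub.
rewrite /cst !tmapr_pure (bra_hom char0 _ _ _ uD).
by rewrite (der_bra_rcontr char0 ub vc) (bilin0r (pure_bilin B _)).
Qed.

Lemma tmap_udif_hom (M : lmodType k) (pM : bool -> M -> M) p (X : tensor B M) :
  hom_tensor pM p X -> hom_tensor pM (~~ p) (tmap udif X).
Proof.
apply: tmap_gen => a v [c [ac vc]]; exists c; split=> //.
by have := udif_hom ac; rewrite addNb.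
Qed.

Lemma tmap_udif_fil (M : lmodType k) (X : tensor B M) : fil_tensor 1 (tmap udif X).
Proof. by apply: tmap_gen (tensor_gen X) => a v _; exact: fil_udif. Qed.

Lemma dAs_csts xi : dAs (csts xi) = csts (dAs xi).
Proof. by apply: funext => n; rewrite /dAs /csts /cst tmapr_tmap. Qed.

Lemma dzs_csts xi : dzs (csts xi) = csts (dzs xi).
Proof. by apply: funext => n; rewrite /dzs /csts raddfMn. Qed.

Lemma fil_tensorD (M : lmodType k) r (X Y : tensor B M) :
  fil_tensor r X -> fil_tensor r Y -> fil_tensor r (X + Y).
Proof. exact: tgenD. Qed.

Lemma fil_tensorZ (M : lmodType k) r c (X : tensor B M) :
  fil_tensor r X -> fil_tensor r (c *: X).
Proof. by apply: tgenZ => a _; exact: filZ. Qed.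

Lemma fil_tensor0 (M : lmodType k) (X : tensor B M) : fil_tensor 0 X.
Proof. by apply: tgenW (tensor_gen X) => a v _; exact: fil_all. Qed.

Lemma fil_tensorS (M : lmodType k) r (X : tensor B M) :
  fil_tensor r.+1 X -> fil_tensor r X.
Proof. by apply: tgenW => a v; exact: filS. Qed.

Lemma hom_tensorD (M : lmodType k) (pM : bool -> M -> M) p (X Y : tensor B M) :
  hom_tensor pM p X -> hom_tensor pM p Y -> hom_tensor pM p (X + Y).
Proof. exact: tgenD. Qed.

Lemma hom_tensorZ (M : lmodType k) (pM : bool -> M -> M) p c (X : tensor B M) :
  hom_tensor pM p X -> hom_tensor pM p (c *: X).
Proof.
by apply: tgenZ => a v [d [ad vd]]; exists d; split=> //; rewrite linearZ /= ad.
Qed.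

Lemma fil_tensor_nil (M : lmodType k) r (X : tensor B M) :
  (forall x : B, fil r x -> x = 0) -> fil_tensor r X -> X = 0.
Proof.
move=> nil; elim=> // a v Y fa _ ->.
by rewrite (nil _ fa) (bilin0l (pure_bilin B M)) addr0.
Qed.

Definition adx xi X := cbra (csts xi) X.
(** The cut-off is a parameter, since levels with different nilpotency indices have to be
    compared. *)
Definition gexp N xi X : nat -> TD :=
  \sum_(l < N) (l`!%:R^-1 : k) *: iter l (adx xi) X.

Lemma fct_sum_nE (M : zmodType) I (r : seq I) (P : pred I) (F : I -> nat -> M) n :
  (\sum_(i <- r | P i) F i) n = \sum_(i <- r | P i) F i n.
Proof. by elim/big_rec2: _ => // i x y _ <-. Qed.

Section Fixed_xi.
Variable xi : nat -> TU.
Hypothesis xi_fil : forall n, fil_tensor 1 (xi n).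
Hypothesis xi_hom : forall n, homU false (xi n).

Lemma adx_fil r X : (forall n, fil_tensor r (X n)) -> forall n, fil_tensor r.+1 (adx xi X n).
Proof.
move=> Xr n; rewrite /adx /cbra; apply: tgen_sum => i _.
by apply: bra_fil1 => //; exact: cst_fil.
Qed.

Lemma iter_adx_fil l X n : fil_tensor l (iter l (adx xi) X n).
Proof. by elim: l n => [|l IH] n; [exact: fil_tensor0|exact: adx_fil]. Qed.

Lemma adx_hom p X : (forall n, homD p (X n)) -> forall n, homD p (adx xi X n).
Proof.
move=> Xp n; rewrite /adx /cbra; apply: tgen_sum => i _.
by apply: (bra_hom_parity char0 (p := false)) => //; exact: cst_hom.
Qed.

Lemma iter_adx_hom p l X n : (forall n, homD p (X n)) -> homD p (iter l (adx xi) X n).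
Proof. by move=> Xp; elim: l n => [//|l IH] n; exact: adx_hom. Qed.

Lemma gexp_hom p N X : (forall n, homD p (X n)) -> forall n, homD p (gexp N xi X n).
Proof.
move=> Xp n; rewrite /gexp fct_sum_nE; apply: tgen_sum => l _.
by apply: hom_tensorZ; exact: iter_adx_hom.
Qed.

Let a := ser (csts xi).

Lemma ad_ser p X : (forall n, homD p (X n)) -> ad a (ser X) = ser (adx xi X).
Proof.
move=> Xp; have hc n : homD false (csts xi n) by exact: cst_hom.
by rewrite /adx (ser_cbra char0 hc Xp) scale1r.
Qed.

Lemma iter_ad_ser p l X : (forall n, homD p (X n)) ->
  iter l (ad a) (ser X) = ser (iter l (adx xi) X).
Proof.
move=> Xp; elim: l => [//|l IH]; rewrite !iterS IH (ad_ser (p := p)) // => n.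
exact: iter_adx_hom.
Qed.

(** Although d_A lies outside of A (x) CE, its commutator with a contraction is again a contraction;
    the same happens for d/dz. *)
Lemma ad_dA : ad a (dA A U) = - ser (csts (dAs xi)).
Proof.
rewrite -dAs_csts (ser_dA char0 (p := false)) ?scale1r ?opprB // => n.
exact: cst_hom.
Qed.

Lemma ad_dz : ad a (dz A U) = - ser (csts (dzs xi)).
Proof. by rewrite -dzs_csts ser_dz opprB. Qed.

Lemma adx_csts q (eta : nat -> TU) : (forall n, homU q (eta n)) -> adx xi (csts eta) = 0.
Proof.
move=> hq; apply: funext => n; rewrite /adx /cbra big1 // => i _.
by rewrite (bra_cst (xi_hom _) (hq _)).
Qed.

Lemma dAs_hom (eta : nat -> TU) p : (forall n, homU p (eta n)) -> forall n, homU (~~ p) (dAs eta n).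
Proof. by move=> hp n; exact: tmap_udif_hom. Qed.

Lemma homMn (M : lmodType k) (pM : bool -> M -> M) p (X : tensor B M) n :
  hom_tensor pM p X -> hom_tensor pM p (X *+ n).
Proof. by move=> hX; rewrite -scaler_nat; exact: hom_tensorZ. Qed.

Lemma dzs_hom (eta : nat -> TU) p : (forall n, homU p (eta n)) -> forall n, homU p (dzs eta n).
Proof. by move=> hp n; exact: homMn. Qed.

(** A second ad vanishes because contractions commute with each other. *)
Lemma ad_ad_const q eta x : (forall n, homU q (eta n)) -> ad a x = - ser (csts eta) ->
  forall l, (1 < l)%N -> iter l (ad a) x = 0.
Proof.
move=> hq adx1; case=> [|[|l]] // _; rewrite 2!iterSr adx1 raddfN /=.
rewrite (ad_ser (p := q)); last by move=> n; exact: cst_hom.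
rewrite (adx_csts hq) linear0 oppr0.
by elim: l => [//|l IH]; rewrite iterS IH linear0.
Qed.

(** The exponential series ends with its linear term, which the cut-off must retain; hence 1 < N. *)
Lemma expad_const q eta x N : (1 < N)%N -> (forall n, homU q (eta n)) ->
  ad a x = - ser (csts eta) -> expad a N x = x - ser (csts eta).
Proof.
move=> N1 hq adx1; rewrite (expad_widen N1) /expad.
  by rewrite !big_ord_recr big_ord0 /= add0r /dpow fact0 invr1 !scale1r /= adx1.
exact: (ad_ad_const hq adx1).
Qed.

Lemma expad_ser p N X : (forall n, homD p (X n)) -> expad a N (ser X) = ser (gexp N xi X).
Proof.
move=> Xp; rewrite /gexp raddf_sum /expad; apply: eq_bigr => l _.
by rewrite /dpow (iter_ad_ser _ Xp) [RHS]linearZ.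
Qed.

Lemma ad_iterD n x y : iter n (ad a) (x + y) = iter n (ad a) x + iter n (ad a) y.
Proof. by elim: n => [//|n IH]; rewrite !iterS IH raddfD. Qed.

Lemma expadD N x y : expad a N (x + y) = expad a N x + expad a N y.
Proof.
rewrite /expad -big_split; apply: eq_bigr => l _.
by rewrite /dpow ad_iterD scalerDr.
Qed.

Lemma expad0 N : expad a N 0 = 0.
Proof. by apply: (addrI (expad a N 0)); rewrite -expadD !addr0. Qed.

Lemma expadN N x : expad a N (- x) = - expad a N x.
Proof. by apply/eqP; rewrite -addr_eq0 -expadD addNr expad0. Qed.

Variable N : nat.
Hypothesis N1 : (1 < N)%N.
Hypothesis N_nil : forall r (x : B), (N <= r)%N -> fil r x -> x = 0.

Lemma iter_adx0 l X : (N <= l)%N -> iter l (adx xi) X = 0.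
Proof.
move=> Nl; apply: funext => n.
exact: (fil_tensor_nil (fun x => N_nil Nl (x := x)) (iter_adx_fil l X n)).
Qed.

Definition MC_eq (M : nat -> TD) := dAs M + 2^-1 *: cbra M M = 0.
Definition flow_eq (M Q : nat -> TD) := dzs M = dAs Q + cbra M Q.

(** The new connection form: the conjugate of d_A + M is d_A plus this, and the subtracted
    contraction is what conjugation adds to d_A itself. [gaugeQ] does the same for d/dz. *)
Definition gaugeM (M : nat -> TD) := gexp N xi M - csts (dAs xi).
Definition gaugeQ (Q : nat -> TD) := gexp N xi Q - csts (dzs xi).

Let opD (M : nat -> TD) := dA A U + ser M.
Let opN (Q : nat -> TD) := dz A U + ser Q.

Let nz2 : 2 != 0 :> k. Proof. exact: (char0_neq0 char0 1). Qed.

(** For odd M the square of d_A + M is [d_A, M] + M^2, where M^2 is half the bracket of M with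
    itself. Faithfulness of the action gives the converse. *)
Lemma MC_eqP M : (forall n, homD true (M n)) -> MC_eq M <-> opD M * opD M = 0.
Proof.
move=> hM; suff -> : opD M * opD M = ser (dAs M + 2^-1 *: cbra M M).
  split=> [->|H]; first by rewrite linear0.
  by apply: (ser_inj char0); rewrite H linear0.
rewrite linearD linearZ /= (ser_dA char0 hM) (ser_cbra char0 hM hM) expr1 !scaleN1r opprK.
rewrite opprK -mulr2n -scaler_nat scalerA mulVf // scale1r.
by rewrite /opD mulrDl !mulrDr dAdA add0r addrA.
Qed.

Lemma flow_eqP M Q : (forall n, homD true (M n)) -> (forall n, homD false (Q n)) ->
  flow_eq M Q <-> opD M * opN Q - opN Q * opD M = 0.
Proof.
move=> hM hQ; suff -> : opD M * opN Q - opN Q * opD M = ser (dAs Q + cbra M Q - dzs M).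
  split=> [->|H]; first by rewrite subrr linear0.
  by apply/esym/eqP; rewrite -subr_eq0; apply/eqP/(ser_inj char0); rewrite H linear0.
rewrite linearB linearD /= (ser_dA char0 hQ) (ser_cbra char0 hM hQ) ser_dz !scale1r.
rewrite /opD /opN !mulrDl !mulrDr dAdz.
set x1 := dz _ _ * dA _ _; set x2 := dA _ _ * ser Q; set x3 := ser M * dz _ _.
set x4 := ser M * _; set x5 := dz _ _ * ser M; set x6 := ser Q * dA _ _.
set x7 := ser Q * ser M; rewrite !opprD !opprK !addrA.
rewrite [LHS](ACl (1 * 5 * 2 * 7 * 4 * 8 * 6 * 3)) /= subrr add0r.
by [].
Qed.

Lemma opD_nil M : (forall n, homD true (M n)) ->
  forall n, (N <= n)%N -> iter n (ad a) (opD M) = 0.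
Proof.
move=> hM n Nn; rewrite ad_iterD (iter_ad_ser _ hM) (iter_adx0 _ Nn) linear0 addr0.
by apply: (ad_ad_const (dAs_hom xi_hom) ad_dA); exact: leq_trans Nn.
Qed.

Lemma opN_nil Q : (forall n, homD false (Q n)) ->
  forall n, (N <= n)%N -> iter n (ad a) (opN Q) = 0.
Proof.
move=> hQ n Nn; rewrite ad_iterD (iter_ad_ser _ hQ) (iter_adx0 _ Nn) linear0 addr0.
by apply: (ad_ad_const (dzs_hom xi_hom) ad_dz); exact: leq_trans Nn.
Qed.

Lemma expad_opD M : (forall n, homD true (M n)) -> expad a N (opD M) = opD (gaugeM M).
Proof.
move=> hM; rewrite /opD expadD (expad_const N1 (dAs_hom xi_hom) ad_dA).
by rewrite (expad_ser _ hM) /gaugeM raddfB -addrA [- _ + _]addrC.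
Qed.

Lemma expad_opN Q : (forall n, homD false (Q n)) -> expad a N (opN Q) = opN (gaugeQ Q).
Proof.
move=> hQ; rewrite /opN expadD (expad_const N1 (dzs_hom xi_hom) ad_dz).
by rewrite (expad_ser _ hQ) /gaugeQ raddfB -addrA [- _ + _]addrC.
Qed.

Lemma homB (M : lmodType k) (pM : bool -> M -> M) p (X Y : tensor B M) :
  hom_tensor pM p X -> hom_tensor pM p Y -> hom_tensor pM p (X - Y).
Proof. by move=> hX hY; rewrite -scaleN1r; apply: hom_tensorD => //; exact: hom_tensorZ. Qed.

Lemma gaugeM_hom M : (forall n, homD true (M n)) -> forall n, homD true (gaugeM M n).
Proof.
by move=> hM n; apply: homB; [exact: gexp_hom|apply: cst_hom; exact: (dAs_hom xi_hom)].
Qed.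

Lemma gaugeQ_hom Q : (forall n, homD false (Q n)) -> forall n, homD false (gaugeQ Q n).
Proof.
by move=> hQ n; apply: homB; [exact: gexp_hom|apply: cst_hom; exact: (dzs_hom xi_hom)].
Qed.

Lemma gauge_MC M : (forall n, homD true (M n)) -> MC_eq M -> MC_eq (gaugeM M).
Proof.
move=> hM /(MC_eqP hM) MC; apply/(MC_eqP (gaugeM_hom hM)).
rewrite -(expad_opD hM) -(expadM char0 (opD_nil hM) (opD_nil hM)) MC.
exact: expad0.
Qed.

Lemma gauge_flow M Q : (forall n, homD true (M n)) -> (forall n, homD false (Q n)) ->
  flow_eq M Q -> flow_eq (gaugeM M) (gaugeQ Q).
Proof.
move=> hM hQ /(flow_eqP hM hQ) fl; apply/(flow_eqP (gaugeM_hom hM) (gaugeQ_hom hQ)).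
rewrite -(expad_opD hM) -(expad_opN hQ) -(expadM char0 (opD_nil hM) (opN_nil hQ)).
rewrite -(expadM char0 (opN_nil hQ) (opD_nil hM)) -expadN -expadD fl.
exact: expad0.
Qed.

End Fixed_xi.
End Gauge.

(** * Polynomial paths and their values at 1 *)

Section Finite_support.
Variable k : fieldType.

(* X is a polynomial with value x at z = 1. *)
Definition evals (M : lmodType k) (X : nat -> M) (x : M) :=
  exists d, (forall n, (d <= n)%N -> X n = 0) /\ \sum_(n < d) X n = x.

Lemma evalsP (M : lmodType k) (X Y : nat -> M) x y c :
  evals X x -> evals Y y -> evals (c *: X + Y) (c *: x + y).
Proof.
move=> [d [Xd <-]] [e [Ye <-]]; exists (maxn d e); split=> [n|].
  by rewrite geq_max => /andP[dn en]; rewrite !fctE Xd // Ye // scaler0 addr0.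
rewrite -(sum_widen Xd (leq_maxl d e)) -(sum_widen Ye (leq_maxr d e)).
by rewrite scaler_sumr -big_split.
Qed.

Lemma evals0 (M : lmodType k) : evals (0 : nat -> M) 0.
Proof. by exists 0%N; split=> //; rewrite big_ord0. Qed.

Lemma evalsD (M : lmodType k) (X Y : nat -> M) x y :
  evals X x -> evals Y y -> evals (X + Y) (x + y).
Proof. by move=> hX hY; rewrite -[X]scale1r -[x]scale1r; exact: evalsP. Qed.

Lemma evalsZ (M : lmodType k) (X : nat -> M) x c : evals X x -> evals (c *: X) (c *: x).
Proof.
by move=> hX; rewrite -[c *: X]addr0 -[c *: x]addr0; apply: evalsP => //; exact: evals0.
Qed.

Lemma evalsB (M : lmodType k) (X Y : nat -> M) x y :
  evals X x -> evals Y y -> evals (X - Y) (x - y).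
Proof. by move=> hX hY; rewrite -!(scaleN1r Y) -!(scaleN1r y); exact/evalsD/evalsZ. Qed.

Lemma evals_sum (M : lmodType k) (I : Type) (r : seq I) (X : I -> nat -> M) x :
  (forall i, evals (X i) (x i)) -> evals (\sum_(i <- r) X i) (\sum_(i <- r) x i).
Proof.
move=> hX; elim: r => [|i r IH]; first by rewrite !big_nil; exact: evals0.
by rewrite !big_cons; exact: evalsD.
Qed.

Lemma evals_lin (M W : lmodType k) (f : M -> W) X x : linear f ->
  evals X x -> evals (fun n => f (X n)) (f x).
Proof.
move=> fl [d [Xd <-]]; exists d; split=> [n dn|]; first by rewrite Xd // linear_fun0.
by rewrite (linear_fun_sum fl).
Qed.

Lemma evals_inj (M : lmodType k) (X : nat -> M) x y : evals X x -> evals X y -> x = y.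
Proof.
move=> [d [Xd <-]] [e [Xe <-]].
by rewrite -(sum_widen Xd (leq_maxl d e)) -(sum_widen Xe (leq_maxr d e)).
Qed.

Definition fsupp (M : lmodType k) (X : nat -> M) := exists x, evals X x.

Lemma fsuppP (M : lmodType k) (X : nat -> M) d : (forall n, (d <= n)%N -> X n = 0) -> fsupp X.
Proof. by move=> Xd; exists (\sum_(n < d) X n), d. Qed.

End Finite_support.

(** * Picard iteration for the gauge parameter *)

Section Picard.
Variables (k : fieldType) (char0 : [pchar k] =i pred0) (A : nil_cdga k).
Variables (U : superspace k).
Notation B := (uvec A).
Notation udif := (@udif k A).
Notation TD := (tensor B (der U)).
Notation TU := (tensor B U).
Notation homD := (hom_tensor (@der_prj k U)).
Notation homU := (hom_tensor (fun b => sprj U b)).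
Implicit Types (xi : nat -> TU).

Lemma evals_cbra (X Y : nat -> TD) x y : evals X x -> evals Y y ->
  evals (cbra X Y) (bra x y).
Proof.
move=> [d [Xd <-]] [e [Ye <-]]; pose N := maxn d e.
have F0 i j : (N <= i)%N || (N <= j)%N -> bra (X i) (Y j) = 0.
  rewrite /N !geq_max => /orP[/andP[di _]|/andP[_ ej]].
    by rewrite Xd // (linear_fun0 (bra_linearl _)).
  by rewrite Ye // linear0.
exists (N + N)%N; split=> [n Nn|].
  rewrite /cbra big1 // => i _; apply: F0; apply/orP.
  have [|iN] := leqP N i; [by left|right].
  by rewrite leq_subRL ?(leq_trans _ Nn) // ?leq_add2r ltnW // (leq_trans iN) // leq_addr.
rewrite /cbra (sum_cauchy F0).
rewrite -(sum_widen Xd (leq_maxl d e)) -(sum_widen Ye (leq_maxr d e)).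
rewrite (linear_fun_sum (bra_linearl _)); apply: eq_bigr => i _.
by rewrite (linear_fun_sum (bra_linearr _)).
Qed.

Definition gexp1 N (Xi : TU) (x : TD) : TD :=
  \sum_(l < N) (l`!%:R^-1 : k) *: iter l (bra (cst Xi)) x.

Lemma evals_gexp N xi Xi X x : evals xi Xi -> evals X x ->
  evals (gexp N xi X) (gexp1 N Xi x).
Proof.
move=> hxi hX; apply: evals_sum => l; apply: evalsZ.
elim: (nat_of_ord l) => [//|n IH]; rewrite !iterS.
by apply: evals_cbra IH; exact: (evals_lin (@cst_linear k A U)).
Qed.

Lemma evals_csts xi Xi : evals xi Xi -> evals (csts xi) (cst Xi).
Proof. exact: (evals_lin (@cst_linear k A U)). Qed.

Lemma evals_dAs (M : lmodType k) (X : nat -> tensor B M) x :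
  evals X x -> evals (dAs X) (tmap udif x).
Proof. exact: evals_lin (@tmap_is_linear _ _ _ _ _). Qed.

Lemma fsupp_dzs (M : lmodType k) (X : nat -> M) : fsupp X -> fsupp (dzs X).
Proof.
move=> [x [d [Xd _]]]; apply: (@fsuppP _ _ _ d) => n dn.
by rewrite /dzs Xd ?mul0rn // ltnW.
Qed.

(* The constant term, a left inverse of [cst]. *)
Definition kap : TD -> TU := tmapr (@der_vec k U [::]).

Lemma kap_linear : linear kap. Proof. exact: tmapr_is_linear. Qed.

Lemma kap_hom p X : homD p X -> homU p (kap X).
Proof.
apply: tmapr_gen => a v [c [ac vc]]; exists c; split=> //.
by rewrite (sprj_der_vec char0) vc.
Qed.

Lemma kap_fil r X : fil_tensor r X -> fil_tensor r (kap X).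
Proof. exact: tmapr_gen. Qed.

Lemma kap_cst X : kap (cst X) = X.
Proof. by apply/ffunP => j; rewrite !ffunE der_vec_rcontr. Qed.

(* Picard iteration for xi' = kap (exp (ad xi) Q), xi(0) = 0. *)
Definition pstep N (Q : nat -> TD) xi : nat -> TU := fun n =>
  if n is n'.+1 then (n'.+1%:R^-1 : k) *: kap (gexp N xi Q n') else 0.

Definition pic N Q r := iter r (pstep N Q) (0 : nat -> TU).

Variable Q : nat -> TD.
Hypothesis Q_fil : forall n, fil_tensor 1 (Q n).
Hypothesis Q_hom : forall n, homD false (Q n).
Hypothesis Q_fsupp : fsupp Q.

Definition adm xi := (forall n, fil_tensor 1 (xi n)) /\ (forall n, homU false (xi n)).

Lemma iter_adx_fil1 xi l : adm xi -> forall n, fil_tensor 1 (iter l (adx xi) Q n).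
Proof.
move=> [xi1 _]; elim: l => [//|l IH] n; rewrite iterS; apply: fil_tensorS.
exact: adx_fil.
Qed.

Lemma gexp_fil1 N xi : adm xi -> forall n, fil_tensor 1 (gexp N xi Q n).
Proof.
move=> xia n; rewrite /gexp fct_sum_nE; apply: tgen_sum => l _.
by apply: fil_tensorZ; exact: iter_adx_fil1.
Qed.

Lemma adm0 : adm 0. Proof. by split=> n; exact: tgen0. Qed.

Lemma pstep_adm N xi : adm xi -> adm (pstep N Q xi).
Proof.
move=> xia; split=> -[|n]; try exact: tgen0.
  by apply/fil_tensorZ/kap_fil; exact: gexp_fil1.
by apply/hom_tensorZ/kap_hom; apply: gexp_hom => //; exact: xia.2.
Qed.

Lemma pic_adm N r : adm (pic N Q r).
Proof. by elim: r => [|r IH]; [exact: adm0|exact: pstep_adm]. Qed.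

(** The reason for iterating rather than solving coefficient by coefficient: every iterate is
    visibly a polynomial, whereas a recursively defined power series would still have to be shown to
    terminate. *)
Lemma pic_fsupp N r : fsupp (pic N Q r).
Proof.
elim: r => [|r [x hx]]; first by exists 0; exact: evals0.
have [q hq] := Q_fsupp; have [d [Gd _]] := evals_gexp N hx hq.
apply: (@fsuppP _ _ _ d.+1) => -[//|n] dn.
by rewrite /pic iterS /= Gd // (linear_fun0 kap_linear) scaler0.
Qed.

(** One order is gained because Q has coefficients in A_+: a difference of order r is bracketed
    either with an iterate starting from Q or, if it is a difference of iterates, with xi', both of
    order at least 1. *)
Lemma gexp_contract N r xi xi' : adm xi -> adm xi' ->
  (forall n, fil_tensor r (xi n - xi' n)) ->
  forall n, fil_tensor r.+1 (gexp N xi Q n - gexp N xi' Q n).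
Proof.
move=> xia xia' dxi n; rewrite /gexp !fct_sum_nE -sumrB.
apply: tgen_sum => l _; rewrite !fctE -scalerBr; apply: fil_tensorZ.
elim: (nat_of_ord l) n => [|{}l IH] n; first by rewrite subrr; exact: tgen0.
rewrite !iterS.
set X := iter l (adx xi) Q in IH *; set X' := iter l (adx xi') Q in IH *.
(* [xi, X] - [xi', X'] = [xi - xi', X] + [xi', X - X']. *)
have -> : adx xi X n - adx xi' X' n =
    cbra (csts (fun i => xi i - xi' i)) X n + cbra (csts xi') (X - X') n.
  rewrite /adx /cbra -sumrB -big_split; apply: eq_bigr => i _ /=.
  rewrite /csts (linear_funB (@cst_linear k A U)) (linear_funB (bra_linearl _)).
  by rewrite [(X - X') (n - i)%N](_ : _ = X (n - i)%N - X' (n - i)%N) // (linear_funB (bra_linearr _)) addrA subrK.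
apply: tgenD; rewrite /cbra; apply: tgen_sum => i _.
  apply: bra_fil2; first exact: cst_fil.
  exact: iter_adx_fil1.
by apply: fil_tensorS; apply: bra_fil1 (IH _); apply: cst_fil; exact: xia'.1.
Qed.

Lemma pic_cauchy N r n : fil_tensor r.+1 (pic N Q r.+1 n - pic N Q r n).
Proof.
elim: r n => [|r IH] n.
  by rewrite [pic N Q 0 n](_ : _ = 0) // subr0; apply: (pic_adm N 1).1.
case: n => [|n]; first by rewrite /pic !iterS /= subrr; exact: tgen0.
rewrite {1}/pic iterS -/(pic N Q r.+1) {2}/pic iterS -/(pic N Q r) /=.
rewrite -scalerBr; apply: fil_tensorZ.
rewrite -scaleN1r addrC -kap_linear scaleN1r addrC; apply: kap_fil.
by apply: gexp_contract; [apply: pstep_adm; exact: pic_adm|exact: pic_adm|exact: IH].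
Qed.

Variable N : nat.
Hypothesis N_nil : forall r (x : B), (N <= r)%N -> fil r x -> x = 0.

(** The difference of consecutive iterates has order beyond the nilpotency index, so the iteration
    becomes stationary instead of merely converging. *)
Lemma pic_stable r : (N <= r)%N -> pic N Q r = pic N Q N.
Proof.
move=> Nr; rewrite -(subnKC Nr); elim: (r - N)%N => [|d IH]; first by rewrite addn0.
rewrite -IH addnS; apply: funext => n; apply/eqP; rewrite -subr_eq0; apply/eqP.
apply: (fil_tensor_nil _ (pic_cauchy N (N + d) n)) => x; apply: N_nil.
by rewrite -addnS leq_addr.
Qed.

Lemma gexp_widen N' xi X : adm xi -> (N <= N')%N -> gexp N' xi X = gexp N xi X.
Proof.
move=> xia NN'; rewrite /gexp -(subnKC NN') big_split_ord /=.
rewrite [Y in _ + Y]big1 ?addr0 // => i _.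
by rewrite (iter_adx0 xia.1 N_nil) ?scaler0 ?leq_addr.
Qed.

Lemma pic_widen N' r : (N <= N')%N -> pic N' Q r = pic N Q r.
Proof.
move=> NN'; elim: r => [//|r IH]; rewrite /pic !iterS -!/(pic _ Q r) IH.
apply: funext => -[//|n] /=.
by rewrite gexp_widen //; exact: pic_adm.
Qed.

Definition psol := pic N Q N.

(** Independence of the cut-off and of the number of iterations, for comparing solutions at two
    levels through the maximum of their indices. *)
Lemma psol_widen N' : (N <= N')%N -> pic N' Q N' = psol.
Proof. by move=> NN'; rewrite pic_widen // pic_stable. Qed.

Lemma psol_adm : adm psol. Proof. exact: pic_adm. Qed.
Lemma psol_fsupp : fsupp psol. Proof. exact: pic_fsupp. Qed.
Lemma psol0 : psol 0 = 0.
Proof. by rewrite /psol; case: N => [|n]. Qed.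

Lemma psol_eq : dzs psol = fun n => kap (gexp N psol Q n).
Proof.
(* One more iteration changes nothing: the solution is a fixed point of the integral equation. *)
have e : pstep N Q psol = psol := pic_stable (leqnSn N).
apply: funext => n; rewrite /dzs -{1}e /=.
by rewrite -scaler_nat scalerA mulfV ?scale1r // (char0_neq0 char0).
Qed.

Lemma kap_gaugeQ n : kap (gaugeQ psol N Q n) = 0.
Proof.
rewrite /gaugeQ -scaleN1r addrC [X in kap X](_ : _ = -1 *: csts (dzs psol) n + gexp N psol Q n) //.
by rewrite kap_linear kap_cst psol_eq scaleN1r addNr.
Qed.

End Picard.

(** * Propagation of absence of constant terms *)

Section Constant_free_tensors.
Variables (k : fieldType) (char0 : [pchar k] =i pred0) (A : nil_cdga k).
Variables (U : superspace k).
Notation B := (uvec A).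
Notation udif := (@udif k A).
Notation TD := (tensor B (der U)).

Definition dfreeT (X : TD) := forall j, dfree (X j).

Lemma dfreeTP c X Y : dfreeT X -> dfreeT Y -> dfreeT (c *: X + Y).
Proof. by move=> hX hY j; rewrite !ffunE; exact: dfreeP. Qed.

Lemma dfree0 : dfree (0 : der U). Proof. by []. Qed.

Lemma dfreeT0 : dfreeT 0. Proof. by move=> j; rewrite ffunE; exact: dfree0. Qed.

Lemma dfreeZ c (D : der U) : dfree D -> dfree (c *: D).
Proof. by move=> hD; rewrite -[c *: D]addr0; exact: dfreeP. Qed.

Lemma dfreeTZ c X : dfreeT X -> dfreeT (c *: X).
Proof. by move=> hX; rewrite -[c *: X]addr0; apply: dfreeTP => //; exact: dfreeT0. Qed.

Lemma dfreeTD X Y : dfreeT X -> dfreeT Y -> dfreeT (X + Y).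
Proof. by move=> hX hY; rewrite -[X]scale1r; exact: dfreeTP. Qed.

Lemma dfreeT_sum I (r : seq I) (P : pred I) (F : I -> TD) :
  (forall i, P i -> dfreeT (F i)) -> dfreeT (\sum_(i <- r | P i) F i).
Proof. by move=> hF; apply: big_ind => //; [exact: dfreeT0|exact: dfreeTD]. Qed.

Lemma dfreeT_pure a D : dfree D -> dfreeT (pure a D).
Proof. by move=> hD j; rewrite ffunE; exact: dfreeZ. Qed.

Lemma dfreeT_udif X : dfreeT X -> dfreeT (tmap udif X).
Proof. by move=> hX; apply: dfreeT_sum => j _; exact: dfreeT_pure. Qed.

Lemma dfreeT_bra X Y : dfreeT X -> dfreeT Y -> dfreeT (bra X Y).
Proof.
move=> hX hY; apply: dfreeT_sum => i _; apply: dfreeT_sum => j _.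
by apply: dfreeT_sum => c _; apply: dfreeT_pure; apply: dfree_bra => //; exact: dfree_prj.
Qed.

Lemma dfreeT_kap X : kap X = 0 -> dfreeT X.
Proof.
move=> X0 j; apply: (dfree_vec char0); have /ffunP/(_ j) := X0.
by rewrite !ffunE.
Qed.

(** Coefficientwise the flow equation is a recursion that expresses (n + 1) M_(n+1) through M_0,
    ..., M_n and Q, and n + 1 is invertible. *)
Lemma flow_dfree (M Q : nat -> TD) : flow_eq M Q -> (forall n, dfreeT (Q n)) ->
  dfreeT (M 0) -> forall n, dfreeT (M n).
Proof.
move=> fl hQ hM0 n.
suff H i : (i <= n)%N -> dfreeT (M i) by exact: H.
elim: n i => [|n IH] i; first by rewrite leqn0 => /eqP->.
rewrite leq_eqVlt => /predU1P[->|]; last exact: IH.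
have /(congr1 (fun F => n.+1%:R^-1 *: F n)) := fl.
rewrite /dzs -scaler_nat scalerA mulVf ?scale1r; last exact: (char0_neq0 char0).
move=> ->; apply/dfreeTZ/dfreeTD; first exact: dfreeT_udif.
by apply: dfreeT_sum => j _; apply: dfreeT_bra => //; apply: IH; rewrite -ltnS.
Qed.

Lemma gexp0 N (xi : nat -> tensor B U) X : (0 < N)%N -> xi 0 = 0 -> gexp N xi X 0 = X 0.
Proof.
case: N => // N _ xi0; rewrite /gexp fct_sum_nE big_ord_recl /= fact0 invr1.
rewrite [(1 *: X) 0](_ : _ = 1 *: X 0) // scale1r big1 ?addr0 // => l _.
rewrite fctE /bump leq0n add1n /adx /cbra big_ord1 /csts xi0 linear0.
by rewrite (linear_fun0 (bra_linearl _)) scaler0.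
Qed.

End Constant_free_tensors.

(** * Comparison with g[z,dz] *)

Section Augmentation_ideal.
Variables (k : fieldType) (char0 : [pchar k] =i pred0) (A : nil_cdga k).
Variables (U : superspace k).
Notation B := (uvec A).
Notation uinc := (@uinc k A).
Notation uprj := (@uprj k A).
Notation aprjs := (fun b => aprj A b).
Notation LD := (tensor A (der U)).

Definition usnd (x : B) : A := x.2.
Lemma usnd_linear : linear usnd. Proof. by []. Qed.
HB.instance Definition _ := GRing.isLinear.Build k B A *:%R usnd usnd_linear.

Lemma usnd_uinc (M : lmodType k) (X : tensor A M) : tmap usnd (tmap uinc X) = X.
Proof.
rewrite (tmap_comp (chi := GRing.Linear.clone _ _ _ _ (@idfun A) _)) //.
exact: tmap_id.
Qed.

Lemma tmap_uinc_inj (M : lmodType k) : injective (@tmap k A B M uinc).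
Proof. by move=> X Y /(congr1 (tmap usnd)); rewrite !usnd_uinc. Qed.

(** Coefficients of positive order have no scalar component, so for them nothing is lost on
    returning from the unitization to A_+. *)
Lemma uinc_usnd (M : lmodType k) r (X : tensor B M) : (0 < r)%N -> fil_tensor r X ->
  tmap uinc (tmap usnd X) = X.
Proof.
move=> r0; elim=> [|a v Y fa _ IH]; first by rewrite !linear0.
by rewrite !raddfD /= IH !tmap_pure /= -[uinc _](fil_aug fa r0).
Qed.

Lemma fil_tensor_uinc (M : lmodType k) (X : tensor A M) : fil_tensor 1 (tmap uinc X).
Proof. by apply: tmap_gen (tensor_gen X) => a v _; exact: fil_uinc. Qed.

Lemma tprj_linear (M : lmodType k) (pM : bool -> {linear M -> M}) b :
  linear (tprj aprjs (fun c => pM c) b).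
Proof.
apply: tlift_linear => a c x y; rewrite scaler_sumr -big_split; apply: eq_bigr => d _.
by rewrite /= linearP (pure_bilin A M).2.
Qed.

Lemma tprj_pure (M : lmodType k) (pM : bool -> {linear M -> M}) b a v :
  tprj aprjs (fun c => pM c) b (pure a v) =
  \sum_(c : bool) pure (aprj A (b (+) c) a) (pM c v).
Proof.
rewrite /tprj tlift_pure //; apply: bilin_sum => c.
have [pl pr] := pure_bilin A M.
by split=> [w|w] e x y; [rewrite linearP pl|rewrite linearP pr].
Qed.

Lemma tprj_hom (M : lmodType k) (pM : bool -> {linear M -> M}) b (X : tensor A M) :
  (forall c v, pM c (pM c v) = pM c v) ->
  tprj aprjs (fun c => pM c) b X = X -> hom_tensor (fun c => pM c) b (tmap uinc X).
Proof.
move=> pMK <-; rewrite /tprj /tlift (linear_fun_sum (@tmap_is_linear _ _ _ _ _)).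
apply: tgen_sum => j _; rewrite (linear_fun_sum (@tmap_is_linear _ _ _ _ _)).
apply: tgen_sum => c _; rewrite tmap_pure; apply: tgen_pure; exists c; split=> //.
by rewrite /= uprj_uinc aprjK eqxx.
Qed.

Lemma hom_tprj (M : lmodType k) (pM : bool -> {linear M -> M}) b (X : tensor B M) :
  (forall c d v, pM c (pM d v) = if c == d then pM d v else 0) ->
  hom_tensor (fun c => pM c) b X -> tprj aprjs (fun c => pM c) b (tmap usnd X) = tmap usnd X.
Proof.
move=> pMK hX; apply: (linear_gen_eq (f := fun X => tprj aprjs (fun c => pM c) b (tmap usnd X))
  (g := fun X => tmap usnd X) _ _ hX).
- by move=> c x y; rewrite tmap_is_linear tprj_linear.
- exact: tmap_is_linear.
move=> a v [c [ac vc]]; rewrite tmap_pure tprj_pure (bigD1 c) //= vc big1 ?addr0.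
  by rewrite -{2}ac.
move=> d dc; rewrite -vc pMK (negPf dc); exact: (bilin0r (pure_bilin A M)).
Qed.

Definition asg c (a : A) : A := ksgn aprjs c a.

Lemma asg_linear c : linear (asg c).
Proof.
move=> e x y; rewrite /asg /ksgn; case: c => //.
by rewrite 2!linearP /= opprD addrACA scalerBr.
Qed.
HB.instance Definition _ c := GRing.isLinear.Build k A A *:%R (asg c) (asg_linear c).

Definition der_sgn (D : der U) : der U := ksgn (@der_prj k U) true D.
Lemma der_sgn_linear : linear der_sgn.
Proof. by move=> e x y; rewrite /der_sgn /ksgn 2!linearP /= opprD addrACA scalerBr. Qed.
HB.instance Definition _ := GRing.isLinear.Build k (der U) (der U) *:%R der_sgn der_sgn_linear.

Definition ltbra (X Y : LD) : LD := tlift (fun a D => tlift (fun b E =>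
  \sum_(c : bool) pure (amul a (asg c b)) (der_bra (der_prj c D) E)) Y) X.

Definition lsgn (X : LD) : LD := tlift (fun a D => pure (asg true a) (der_sgn D)) X.

(* The term [q dz, p] of the bracket of g[z,dz]. *)
Definition ltbra' (X Y : LD) : LD := tlift (fun a D => tlift (fun b E =>
  \sum_(c : bool) pure (amul a (asg c b)) (der_bra (der_prj (~~ c) D) (der_sgn E))) Y) X.

Let term_bilin a (D : der U) : bilin (fun b E =>
  \sum_(c : bool) pure (amul a (asg c b)) (der_bra (der_prj c D) E)).
Proof.
apply: bilin_sum => c; have [pl pr] := pure_bilin A (der U).
split=> [v|b] e x y; last by rewrite der_bra_linearr pr.
by rewrite linearP amulPr pl.
Qed.

Lemma ltbra_uinc X Y : tmap uinc (ltbra X Y) = bra (tmap uinc X) (tmap uinc Y).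
Proof.
have tl := @tmap_is_linear k A B (der U) uinc.
rewrite [in RHS](tensor_sum X) [in RHS](tensor_sum Y) !(linear_fun_sum tl) /=.
rewrite (linear_fun_sum (bra_linearl _)); rewrite /ltbra /tlift.
apply: eq_bigr => i _; rewrite (linear_fun_sum tl) (linear_fun_sum (bra_linearr _)).
apply: eq_bigr => j _; rewrite !tmap_pure (linear_fun_sum tl) /bra kop_pure.
- by apply: eq_bigr => c _; rewrite tmap_pure usgnA_uinc umul_uinc.
- exact: der_bra_linearl.
- exact: der_bra_linearr.
Qed.

(** q dz has the parity opposite to that of q. Replacing c by its negation turns this shift into a
    sign on the coefficients of Y, which joins the sign on the derivations to form the total sign
    [lsgn]. *)
Lemma ltbra'E X Y : ltbra' X Y = ltbra X (lsgn Y).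
Proof.
apply: eq_tlift => a D; rewrite /lsgn [X in _ = tlift _ X]/tlift.
rewrite (linear_fun_sum (tlift_linear (term_bilin a D).2)).
apply: eq_bigr => j _; rewrite (tlift_pure _ _ (term_bilin a D)).
rewrite (reindex_inj negb_inj) /=; apply: eq_bigr => c _; rewrite negbK.
congr (pure (amul a _) _); rewrite /asg /ksgn; case: c => //=.
rewrite !linearB /= !aprjK /= subr0 oppr0 sub0r opprK aprjD.
by [].
Qed.

Lemma lsgn_linear : linear lsgn.
Proof.
by apply: tlift_linear => a c x y; rewrite linearP (pure_bilin A (der U)).2.
Qed.

Lemma lsgn_odd X : tprj aprjs (@der_prj k U) true X = X -> lsgn X = - X.
Proof.
move=> <-; rewrite /tprj /tlift (linear_fun_sum lsgn_linear) -sumrN.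
apply: eq_bigr => j _; rewrite (linear_fun_sum lsgn_linear) -sumrN; apply: eq_bigr => c _.
have pb := pure_bilin A (der U).
rewrite {1}/lsgn tlift_pure; last first.
  by split=> [v|b] e x y; [rewrite linearP pb.1|rewrite linearP pb.2].
rewrite /asg /der_sgn /ksgn !aprjK !(der_prjK char0) /=.
case: c; rewrite /= ?subr0 ?sub0r.
  by rewrite -[- der_prj _ _]scaleN1r (bilinZr pb) scaleN1r.
by rewrite -[- aprj _ _ _]scaleN1r (bilinZl pb) scaleN1r.
Qed.

Variable m : der U.
Hypothesis m_odd : der_prj true m = m.
Hypothesis m_sq : forall f, m (m f) = 0.

Definition ltdif (X : LD) : LD :=
  tlift (fun a D => pure (adif A a) D + pure (asg true a) (der_bra m D)) X.

Definition mB : tensor B (der U) := pure (uone A) m.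
(** The structure m as a constant path. Its coefficient is the unit, so that it and a path in A_+
    (x) CE become summands of one element whose bracket contains the differential [m, -]. *)
Definition m0 : nat -> tensor B (der U) := fun n => if n is 0 then mB else 0.

Lemma mB_hom : hom_tensor (@der_prj k U) true mB.
Proof. by apply: tgen_pure; exists true; split=> //; exact: uprj_uone. Qed.

Lemma m0_hom n : hom_tensor (@der_prj k U) true (m0 n).
Proof. by case: n => [|n]; [exact: mB_hom|exact: tgen0]. Qed.

Lemma ltdif_uinc X : tmap uinc (ltdif X) =
  tmap (@udif k A) (tmap uinc X) + bra mB (tmap uinc X).
Proof.
have tl := @tmap_is_linear k A B (der U) uinc.
have dl := @tmap_is_linear k B B (der U) (@udif k A).
rewrite [in RHS](tensor_sum X) !(linear_fun_sum tl).
rewrite (linear_fun_sum dl) (linear_fun_sum (bra_linearr _)) -big_split.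
apply: eq_bigr => j _ /=; rewrite (linear_funD tl) !tmap_pure (bra_hom char0 _ _ _ m_odd).
by rewrite umul1 usgnA_uinc.
Qed.

Lemma udif_mB : tmap (@udif k A) mB = 0.
Proof. by rewrite tmap_pure /= udif_uone (bilin0l (pure_bilin B _)). Qed.

Lemma bra_mB : bra mB mB = 0.
Proof.
rewrite (bra_hom char0 _ _ _ m_odd) usgnA_uone umul1.
rewrite [der_bra m m](_ : _ = 0) ?(bilin0r (pure_bilin B _)) //.
by apply: derP => f; rewrite (der_braE char0 _ m_odd m_odd) !m_sq scaler0 subr0.
Qed.

Definition inB (p : nat -> LD) : nat -> tensor B (der U) := fun n => tmap uinc (p n).

Lemma cbra_m0l (X : nat -> tensor B (der U)) n : cbra m0 X n = bra mB (X n).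
Proof.
rewrite /cbra big_ord_recl subn0 big1 ?addr0 // => i _.
by rewrite [m0 _](_ : _ = 0) // (linear_fun0 (bra_linearl _)).
Qed.

Lemma cbra_m0r (X : nat -> tensor B (der U)) n : cbra X m0 n = bra (X n) mB.
Proof.
rewrite /cbra big_ord_recr /= subnn big1 ?add0r // => i _.
by rewrite -(subnSK (ltn_ord i)) /= (linear_fun0 (bra_linearr _)).
Qed.

Lemma dAs_m0 : dAs m0 = 0.
Proof. by apply: funext => -[|n]; rewrite /dAs ?udif_mB // linear0. Qed.

Section Components.
Variables p q : nat -> LD.
Hypothesis p_odd : forall n, tprj aprjs (@der_prj k U) true (p n) = p n.
Hypothesis q_even : forall n, tprj aprjs (@der_prj k U) false (q n) = q n.

Lemma der_prj_idem c (D : der U) : der_prj c (der_prj c D) = der_prj c D.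
Proof. by rewrite (der_prjK char0) eqxx. Qed.

Lemma inB_p_hom n : hom_tensor (@der_prj k U) true (inB p n).
Proof. exact: (tprj_hom der_prj_idem (p_odd n)). Qed.

Lemma inB_q_hom n : hom_tensor (@der_prj k U) false (inB q n).
Proof. exact: (tprj_hom der_prj_idem (q_even n)). Qed.

Let uinc_linear' := @tmap_is_linear k A B (der U) uinc.

Lemma uinc_sum n (F : nat -> LD) :
  tmap uinc (\sum_(i < n) F i) = \sum_(i < n) tmap uinc (F i).
Proof. exact: (linear_fun_sum uinc_linear'). Qed.

(** In half the bracket of m + p with itself, [m, m] vanishes and the two mixed brackets of odd
    elements coincide; together they are the differential [m, p]. *)
Lemma MC_components : (forall n,
    ltdif (p n) + 2^-1 *: \sum_(i < n.+1) ltbra (p i) (p (n - i)%N) = 0) <->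
  MC_eq (m0 + inB p).
Proof.
have key n : tmap uinc (ltdif (p n) + 2^-1 *: \sum_(i < n.+1) ltbra (p i) (p (n - i)%N)) =
    (dAs (m0 + inB p) + 2^-1 *: cbra (m0 + inB p) (m0 + inB p)) n.
  rewrite (linear_funD uinc_linear') (linear_funZ uinc_linear') ltdif_uinc.
  rewrite (uinc_sum _ (fun i => ltbra (p i) (p (n - i)%N))).
  under eq_bigr => i _ do rewrite ltbra_uinc.
  rewrite -/(cbra (inB p) (inB p) n) fctE.
  have -> : dAs (m0 + inB p) n = tmap (@udif k A) (inB p n).
    rewrite /dAs [(m0 + inB p) n](_ : _ = m0 n + inB p n) //.
    rewrite (linear_funD (@tmap_is_linear _ _ _ _ _)).
    by rewrite -/(dAs m0 n) dAs_m0 add0r.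
  rewrite [cbra (m0 + _) _](_ : _ = cbra m0 m0 + cbra m0 (inB p) +
     (cbra (inB p) m0 + cbra (inB p) (inB p))); last first.
    rewrite (linear_funD (@cbra_linearl k A U _)) !(linear_funD (@cbra_linearr k A U _)).
    by [].
  rewrite -addrA; congr (_ + _); rewrite !fctE.
  rewrite !cbra_m0l cbra_m0r (bra_anti char0 (inB_p_hom n) mB_hom) expr1 opprK scale1r.
  have -> : bra mB (m0 n) = 0 by case: n => [|n]; rewrite ?bra_mB ?linear0.
  rewrite add0r addrA scalerDr -mulr2n -scaler_nat scalerA mulVf ?scale1r //.
  exact: (char0_neq0 char0 1).
split=> [H|H n]; first by apply: funext => n; rewrite -key H linear0.
by apply: tmap_uinc_inj; rewrite key H linear0.
Qed.

(** As p is odd, [lsgn] is -1 on it. This gives the term -p' and turns the bracket of q dz with p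
    into [p, q], so that the two halves of the bracket add up to [p, q]. *)
Lemma flow_components : (forall n,
    ltdif (q n) + lsgn (p n.+1) *+ n.+1 +
    2^-1 *: (\sum_(i < n.+1) ltbra (p i) (q (n - i)%N) +
             \sum_(i < n.+1) ltbra' (q i) (p (n - i)%N)) = 0) <->
  flow_eq (m0 + inB p) (inB q).
Proof.
have key n : tmap uinc (ltdif (q n) + lsgn (p n.+1) *+ n.+1 +
    2^-1 *: (\sum_(i < n.+1) ltbra (p i) (q (n - i)%N) +
             \sum_(i < n.+1) ltbra' (q i) (p (n - i)%N))) =
    (dAs (inB q) + cbra (m0 + inB p) (inB q) - dzs (m0 + inB p)) n.
  rewrite !(linear_funD uinc_linear') (linear_funZ uinc_linear') ltdif_uinc.
  rewrite (linear_funMn uinc_linear') (linear_funD uinc_linear').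
  rewrite (uinc_sum _ (fun i => ltbra (p i) (q (n - i)%N))).
  rewrite (uinc_sum _ (fun i => ltbra' (q i) (p (n - i)%N))).
  under eq_bigr => i _ do rewrite ltbra_uinc.
  rewrite -/(cbra (inB p) (inB q) n).
  have -> : \sum_(i < n.+1) tmap uinc (ltbra' (q i) (p (n - i)%N)) = cbra (inB p) (inB q) n.
    rewrite /cbra (reindex_inj rev_ord_inj); apply: eq_bigr => i _ /=.
    have in_ : (i <= n)%N by rewrite -ltnS.
    rewrite subSS subKn // ltbra'E (lsgn_odd (p_odd _)) ltbra_uinc.
    rewrite (linear_funN uinc_linear') (linear_funN (bra_linearr _)).
    by rewrite (bra_anti char0 (inB_q_hom _) (inB_p_hom _)) scaleN1r opprK.
  rewrite (lsgn_odd (p_odd _)) (linear_funN uinc_linear').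
  have half (W : tensor B (der U)) : 2^-1 *: (W + W) = W.
    by rewrite -mulr2n -scaler_nat scalerA mulVf ?scale1r //; exact: (char0_neq0 char0 1).
  rewrite half !fctE (linear_funD (@cbra_linearl k A U _)) !fctE cbra_m0l.
  rewrite [dzs _ _](_ : _ = inB p n.+1 *+ n.+1); last first.
    by rewrite /dzs -[inB p n.+1 in RHS]add0r.
  by rewrite mulNrn [LHS]addrAC -[tmap _ _ + _ + _]addrA.
split=> [H|H n].
  by apply/esym/eqP; rewrite -subr_eq0; apply/eqP/funext => n; rewrite -key H linear0.
by apply: tmap_uinc_inj; rewrite key H subrr linear0.
Qed.

End Components.
End Augmentation_ideal.

Section Structure_derivation.
Variables (k : fieldType) (V : linf_algebra k).
Notation U := (Pi V).

Definition ldif_der : der U := mk_der (ldif_CEbar V).1.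

Lemma ldif_der_odd : der_prj true ldif_der = ldif_der.
Proof. by apply/val_inj; exact: ldif_odd. Qed.

Lemma ldif_der_sq f : ldif_der (ldif_der f) = 0. Proof. exact: ldif_sq. Qed.

Lemma ldif_der_free (char0 : [pchar k] =i pred0) : dfree ldif_der.
Proof. by apply: (CEbar_const_free char0); exact: ldif_CEbar. Qed.

End Structure_derivation.

(** * Coordinates for the operations of [CE_ops] and its path object *)

Section Level.
Variables (k : fieldType) (V : linf_algebra k) (A : formal_cdga k) (i : findex A).
Notation U := (Pi V).
Notation g := (CE_ops V).
Notation Ai := (A i).
Notation LD := (tensor Ai (der U)).
Notation m := (ldif_der V).
Notation aprjs := (fun b => aprj Ai b).

(** Leads from tensors over [der], where the bracket is bilinear, to tensors over the space of all
    functions, for which deformations are defined. *)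
Definition valT (X : LD) : tensor Ai g := [ffun j => der_fun (X j)].

Lemma valT_linear : linear valT.
Proof. by move=> c X Y; apply/ffunP => j; rewrite !ffunE. Qed.

Lemma valT_pure a D : valT (pure a D) = pure a (der_fun D).
Proof. by apply/ffunP => j; rewrite !ffunE. Qed.

Lemma valT_inj : injective valT.
Proof.
move=> X Y XY; apply/ffunP => j; apply: val_inj.
by have /ffunP/(_ j) := XY; rewrite !ffunE.
Qed.

Lemma tbra_valT X Y : tbra (g := g) (valT X) (valT Y) = valT (ltbra X Y).
Proof.
rewrite /ltbra /tbra /tlift (linear_fun_sum valT_linear); apply: eq_bigr => a _.
rewrite (linear_fun_sum valT_linear); apply: eq_bigr => b _.
rewrite (linear_fun_sum valT_linear); apply: eq_bigr => c _.
by rewrite valT_pure !ffunE.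
Qed.

Lemma tdif_valT X : tdif (g := g) (valT X) = valT (ltdif m X).
Proof.
rewrite /ltdif /tdif /tlift (linear_fun_sum valT_linear); apply: eq_bigr => a _.
by rewrite (linear_funD valT_linear) !valT_pure !ffunE.
Qed.

Lemma tprj_valT b X : tprj aprjs (@gprj k g) b (valT X) =
  valT (tprj aprjs (@der_prj k U) b X).
Proof.
rewrite /tprj /tlift (linear_fun_sum valT_linear); apply: eq_bigr => a _.
rewrite (linear_fun_sum valT_linear); apply: eq_bigr => c _.
by rewrite valT_pure !ffunE.
Qed.

Definition mkZ (p q : nat -> LD) : tensor Ai (zdz_ops g) :=
  [ffun j => ((fun n => der_fun (p n j), fun n => der_fun (q n j)) : zdz_ops g)].

Definition coefz n (Z : zdz_ops g) : g := Z.1 n.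
Definition coefdz n (Z : zdz_ops g) : g := Z.2 n.
Lemma coefz_linear n : linear (coefz n). Proof. by []. Qed.
Lemma coefdz_linear n : linear (coefdz n). Proof. by []. Qed.
HB.instance Definition _ n := GRing.isLinear.Build k (zdz_ops g) g *:%R (coefz n) (coefz_linear n).
HB.instance Definition _ n := GRing.isLinear.Build k (zdz_ops g) g *:%R (coefdz n) (coefdz_linear n).

Lemma zdz_tensor_eq (Z Z' : tensor Ai (zdz_ops g)) :
  (forall n, tmapr (coefz n) Z = tmapr (coefz n) Z') ->
  (forall n, tmapr (coefdz n) Z = tmapr (coefdz n) Z') -> Z = Z'.
Proof.
move=> H1 H2; apply/ffunP => j; rewrite [LHS]surjective_pairing [RHS]surjective_pairing.
congr pair; apply: funext => n.
  by have /ffunP/(_ j) := H1 n; rewrite !ffunE.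
by have /ffunP/(_ j) := H2 n; rewrite !ffunE.
Qed.

Lemma coefz_mkZ p q n : tmapr (coefz n) (mkZ p q) = valT (p n).
Proof. by apply/ffunP => j; rewrite !ffunE. Qed.
Lemma coefdz_mkZ p q n : tmapr (coefdz n) (mkZ p q) = valT (q n).
Proof. by apply/ffunP => j; rewrite !ffunE. Qed.

Let pure_sum (a : Ai) n (F : 'I_n -> g) :
  pure a (\sum_(l < n) F l) = \sum_(l < n) pure a (F l).
Proof. exact: (linear_fun_sum ((pure_bilin Ai g).2 a)). Qed.

Let exch (d n : nat) (F : 'I_d -> 'I_d -> bool -> 'I_n -> tensor Ai g) :
  \sum_(a < d) \sum_(b < d) \sum_(c : bool) \sum_(l < n) F a b c l =
  \sum_(l < n) \sum_(a < d) \sum_(b < d) \sum_(c : bool) F a b c l.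
Proof.
rewrite exchange_big /=; rewrite [RHS]exchange_big /=.
under [RHS]eq_bigr => a _ do rewrite exchange_big /=.
rewrite exchange_big; apply: eq_bigr => a _; apply: eq_bigr => b _.
by rewrite exchange_big.
Qed.

Lemma coefz_tbra p q n : tmapr (coefz n) (tbra (g := zdz_ops g) (mkZ p q) (mkZ p q)) =
  valT (\sum_(l < n.+1) ltbra (p l) (p (n - l)%N)).
Proof.
rewrite /tbra /tlift (linear_fun_sum (tmapr_is_linear (coefz n))).
transitivity (\sum_(a < \dim {:Ai}) \sum_(b < \dim {:Ai}) \sum_(c : bool) \sum_(l < n.+1)
   pure (amul (vbasis {:Ai})`_a (asg c (vbasis {:Ai})`_b))
     (der_fun (der_bra (der_prj c (p l a)) (p (n - l)%N b)) : g)).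
  apply: eq_bigr => a _; rewrite (linear_fun_sum (tmapr_is_linear (coefz n))).
  apply: eq_bigr => b _; rewrite (linear_fun_sum (tmapr_is_linear (coefz n))).
  apply: eq_bigr => c _; rewrite tmapr_pure /= /coefz /= /coef_bra pure_sum.
  by apply: eq_bigr => l _; rewrite !ffunE.
rewrite exch (linear_fun_sum valT_linear); apply: eq_bigr => l _.
rewrite /ltbra /tlift (linear_fun_sum valT_linear); apply: eq_bigr => a _.
rewrite (linear_fun_sum valT_linear); apply: eq_bigr => b _.
by rewrite (linear_fun_sum valT_linear); apply: eq_bigr => c _; rewrite valT_pure.
Qed.

Lemma coefdz_tbra p q n : tmapr (coefdz n) (tbra (g := zdz_ops g) (mkZ p q) (mkZ p q)) =
  valT (\sum_(l < n.+1) ltbra (p l) (q (n - l)%N) +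
        \sum_(l < n.+1) ltbra' (q l) (p (n - l)%N)).
Proof.
rewrite /tbra /tlift (linear_fun_sum (tmapr_is_linear (coefdz n))).
transitivity (\sum_(a < \dim {:Ai}) \sum_(b < \dim {:Ai}) \sum_(c : bool) \sum_(l < n.+1)
   (pure (amul (vbasis {:Ai})`_a (asg c (vbasis {:Ai})`_b))
     (der_fun (der_bra (der_prj c (p l a)) (q (n - l)%N b)) : g) +
    pure (amul (vbasis {:Ai})`_a (asg c (vbasis {:Ai})`_b))
     (der_fun (der_bra (der_prj (~~ c) (q l a)) (der_sgn (p (n - l)%N b))) : g))).
  apply: eq_bigr => a _; rewrite (linear_fun_sum (tmapr_is_linear (coefdz n))).
  apply: eq_bigr => b _; rewrite (linear_fun_sum (tmapr_is_linear (coefdz n))).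
  apply: eq_bigr => c _; rewrite tmapr_pure /= /coefdz /= [X in pure _ X]fctE /coef_bra.
  rewrite (bilinDr (pure_bilin Ai g)) !pure_sum -big_split.
  by apply: eq_bigr => l _; rewrite !ffunE.
rewrite exch -big_split (linear_fun_sum valT_linear); apply: eq_bigr => l _.
rewrite (linear_funD valT_linear) /ltbra /ltbra' /tlift.
rewrite !(linear_fun_sum valT_linear) -big_split; apply: eq_bigr => a _.
rewrite !(linear_fun_sum valT_linear) -big_split; apply: eq_bigr => b _.
rewrite !(linear_fun_sum valT_linear) -big_split; apply: eq_bigr => c _.
by rewrite !valT_pure.
Qed.

Lemma coefz_tdif p q n : tmapr (coefz n) (tdif (g := zdz_ops g) (mkZ p q)) =
  valT (ltdif m (p n)).
Proof.
rewrite /tdif /ltdif /tlift (linear_fun_sum (tmapr_is_linear (coefz n))).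
rewrite (linear_fun_sum valT_linear); apply: eq_bigr => a _.
rewrite (linear_funD (tmapr_is_linear (coefz n))) (linear_funD valT_linear).
by rewrite !tmapr_pure !valT_pure /= /coefz !ffunE.
Qed.

Lemma coefdz_tdif p q n : tmapr (coefdz n) (tdif (g := zdz_ops g) (mkZ p q)) =
  valT (ltdif m (q n) + lsgn (p n.+1) *+ n.+1).
Proof.
rewrite /tdif (linear_funD valT_linear) (linear_funMn valT_linear).
rewrite /ltdif /lsgn /tlift (linear_fun_sum (tmapr_is_linear (coefdz n))).
rewrite !(linear_fun_sum valT_linear) -sumrMnl -big_split; apply: eq_bigr => a _.
rewrite (linear_funD (tmapr_is_linear (coefdz n))) (linear_funD valT_linear).
rewrite !tmapr_pure !valT_pure /= /coefdz !ffunE /=.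
rewrite (bilinDr (pure_bilin Ai g)) addrA; congr (_ + _).
rewrite -(linear_funMn ((pure_bilin Ai g).2 _)); congr pure.
have vMn (D : der U) : (der_fun D : g) *+ n.+1 = der_fun (D *+ n.+1).
  have vl : linear (fun D : der U => der_fun D : g) by [].
  exact: (esym (linear_funMn vl n.+1 D)).
rewrite vMn.
change (der_fun (der_sgn (p n.+1 a *+ n.+1)) = (der_fun (der_sgn (p n.+1 a)) : g) *+ n.+1).
by rewrite vMn (linear_funMn (@der_sgn_linear k U)).
Qed.

Lemma tprj_mkZ p q b : tprj aprjs (@gprj k (zdz_ops g)) b (mkZ p q) =
  mkZ (fun n => tprj aprjs (@der_prj k U) b (p n)) (fun n => tprj aprjs (@der_prj k U) (~~ b) (q n)).
Proof.
apply: zdz_tensor_eq => n.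
  rewrite coefz_mkZ /tprj /tlift (linear_fun_sum (tmapr_is_linear (coefz n))).
  rewrite (linear_fun_sum valT_linear); apply: eq_bigr => a _.
  rewrite (linear_fun_sum (tmapr_is_linear (coefz n))) (linear_fun_sum valT_linear).
  by apply: eq_bigr => c _; rewrite tmapr_pure valT_pure /= /coefz !ffunE.
rewrite coefdz_mkZ /tprj /tlift (linear_fun_sum (tmapr_is_linear (coefdz n))).
rewrite (linear_fun_sum valT_linear); apply: eq_bigr => a _.
rewrite (linear_fun_sum (tmapr_is_linear (coefdz n))) (linear_fun_sum valT_linear).
rewrite (reindex_inj negb_inj); apply: eq_bigr => c _.
by rewrite tmapr_pure valT_pure /= /coefdz !ffunE /= negbK addbN addNb.
Qed.

End Level.

Lemma fsum_evals (k : fieldType) (M : lmodType k) (X : nat -> M) x :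
  evals X x -> \sum_(n \in [set: nat]) X n = x.
Proof.
move=> [d [Xd <-]]; rewrite fsbig_ord; apply/esym/fsbig_widen => // n [_ /= /negP].
by rewrite -leqNgt => /Xd.
Qed.

(** * Naturality in the coefficient algebra *)

Section Naturality.
Variables (k : fieldType) (char0 : [pchar k] =i pred0) (A A' : nil_cdga k).
Variables (phi : {linear A -> A'}) (phiM : cdga_morphism phi) (U : superspace k).
Notation B := (uvec A).
Notation B' := (uvec A').

Definition uphi (x : B) : B' := (x.1, phi x.2).
Lemma uphi_linear : linear uphi.
Proof. by move=> c x y; rewrite /uphi; congr pair; rewrite /= linearP. Qed.
HB.instance Definition _ := GRing.isLinear.Build k B B' *:%R uphi uphi_linear.

Lemma uphi_prj b x : uphi (uprj b x) = uprj b (uphi x).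
Proof. by rewrite /uphi /uprj /=; case: b; rewrite (morph_prj phiM). Qed.

Lemma uphi_mul x y : uphi (umul x y) = umul (uphi x) (uphi y).
Proof. by rewrite /uphi /umul /= !linearD !linearZ /= (morph_mul phiM). Qed.

Lemma uphi_dif x : uphi (udif x) = udif (uphi x).
Proof. by rewrite /uphi /udif /= (morph_dif phiM). Qed.

Lemma uphi_sgn b x : uphi (usgnA b x) = usgnA b (uphi x).
Proof. by case: b => //; rewrite /usgnA /ksgn linearB /= !uphi_prj. Qed.

Let tl (M : lmodType k) := @tmap_is_linear k B B' M uphi.

Lemma tmap_kop (M W : lmodType k) (op : der U -> M -> W) X Y :
  (forall v, linear (op^~ v)) -> (forall D, linear (op D)) ->
  tmap uphi (kop op X Y) = kop op (tmap uphi X) (tmap uphi Y).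
Proof.
move=> opl opr.
apply: (linear_tensor_eq (f := fun X => tmap uphi (kop op X Y))
  (g := fun X => kop op (tmap uphi X) (tmap uphi Y))) => [c x y|c x y|a D].
- by rewrite (kop_linearl opl) tl.
- by rewrite tl (kop_linearl opl).
apply: (linear_tensor_eq (f := fun Y => tmap uphi (kop op (pure a D) Y))
  (g := fun Y => kop op (tmap uphi (pure a D)) (tmap uphi Y))) => [c x y|c x y|b v].
- by rewrite (kop_linearr opr) tl.
- by rewrite tl (kop_linearr opr).
rewrite !tmap_pure !kop_pure // (linear_fun_sum (@tl W)); apply: eq_bigr => c _.
by rewrite tmap_pure /= uphi_mul uphi_sgn.
Qed.

Lemma tmap_bra (X Y : tensor B (der U)) :
  tmap uphi (bra X Y) = bra (tmap uphi X) (tmap uphi Y).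
Proof. exact: tmap_kop (@der_bra_linearl k U) (@der_bra_linearr k U). Qed.

Definition stmap (M : lmodType k) (X : nat -> tensor B M) : nat -> tensor B' M :=
  fun n => tmap uphi (X n).

Lemma stmap_cbra (X Y : nat -> tensor B (der U)) :
  stmap (cbra X Y) = cbra (stmap X) (stmap Y).
Proof.
apply: funext => n; rewrite /stmap /cbra (linear_fun_sum (@tl _)).
by apply: eq_bigr => i _; rewrite tmap_bra.
Qed.

Lemma stmap_csts (xi : nat -> tensor B U) : stmap (csts xi) = csts (stmap xi).
Proof. by apply: funext => n; rewrite /stmap /csts /cst tmapr_tmap. Qed.

Lemma stmap_gexp N xi (X : nat -> tensor B (der U)) :
  stmap (gexp N xi X) = gexp N (stmap xi) (stmap X).
Proof.
apply: funext => n; rewrite /stmap /gexp !fct_sum_nE (linear_fun_sum (@tl _)).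
apply: eq_bigr => l _; rewrite !fctE (linear_funZ (@tl _)); congr (_ *: _).
rewrite -/(stmap _ n); congr (_ n).
by elim: (nat_of_ord l) => [//|j IH]; rewrite !iterS /adx stmap_cbra stmap_csts IH.
Qed.

Lemma stmap_kap (X : tensor B (der U)) : tmap uphi (kap X) = kap (tmap uphi X).
Proof. by rewrite /kap tmapr_tmap. Qed.

Lemma stmap_pic N (Q : nat -> tensor B (der U)) r :
  stmap (pic N Q r) = pic N (stmap Q) r.
Proof.
elim: r => [|r IH].
  by apply: funext => n; rewrite /stmap /pic /= [X in tmap _ X](_ : _ = 0) // linear0.
rewrite /pic !iterS -!/(pic _ _ r) -IH; apply: funext => -[|n].
  by rewrite /stmap /= linear0.
by rewrite {1}/stmap /= (linear_funZ (@tl _)) stmap_kap -stmap_gexp.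
Qed.

Lemma tmap_udif (M : lmodType k) (X : tensor B M) :
  tmap uphi (tmap (@udif k A) X) = tmap (@udif k A') (tmap uphi X).
Proof. by apply: tmap_square => a; exact: uphi_dif. Qed.

Lemma stmapD (M : lmodType k) (X Y : nat -> tensor B M) : stmap (X + Y) = stmap X + stmap Y.
Proof. by apply: funext => n; exact: (linear_funD (@tl M)). Qed.

Lemma stmapB (M : lmodType k) (X Y : nat -> tensor B M) : stmap (X - Y) = stmap X - stmap Y.
Proof. by apply: funext => n; exact: (linear_funB (@tl M)). Qed.

Lemma stmap_gaugeM N xi (X : nat -> tensor B (der U)) :
  stmap (gaugeM xi N X) = gaugeM (stmap xi) N (stmap X).
Proof.
rewrite /gaugeM stmapB stmap_gexp stmap_csts; congr (_ - csts _).
by apply: funext => l; rewrite /stmap /dAs tmap_udif.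
Qed.

Lemma stmap_gaugeQ N xi (X : nat -> tensor B (der U)) :
  stmap (gaugeQ xi N X) = gaugeQ (stmap xi) N (stmap X).
Proof.
rewrite /gaugeQ stmapB stmap_gexp stmap_csts; congr (_ - csts _).
by apply: funext => l; rewrite /stmap /dzs (linear_funMn (@tl _)).
Qed.

Lemma tmap_uphi_uinc (M : lmodType k) (X : tensor A M) :
  tmap uphi (tmap (@uinc k A) X) = tmap (@uinc k A') (tmap phi X).
Proof. exact: tmap_square. Qed.

Lemma tmap_phi_usnd (M : lmodType k) (X : tensor B M) :
  tmap phi (tmap (@usnd k A) X) = tmap (@usnd k A') (tmap uphi X).
Proof. exact: tmap_square. Qed.

Lemma tmap_uphi_mB (m : der U) : tmap uphi (mB A m) = mB A' m.
Proof. by rewrite /mB tmap_pure /= /uphi /uone /= linear0. Qed.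

Lemma stmap_m0 (m : der U) : stmap (m0 A m) = m0 A' m.
Proof. by apply: funext => -[|n]; rewrite /stmap /= ?tmap_uphi_mB ?linear0. Qed.

Lemma stmap_inB (p : nat -> tensor A (der U)) :
  stmap (inB p) = inB (fun n => tmap phi (p n)).
Proof. by apply: funext => n; rewrite /stmap /inB tmap_uphi_uinc. Qed.

End Naturality.

Section Nilpotency_index.
Variables (k : fieldType) (A : nil_cdga k).

(** Increased so as to exceed 1, as conjugation of d_A and d/dz requires. It rests on a choice, and
    indices at different levels are unrelated. *)
Definition nidx := (projT1 (cid (fil_nilpotent A))).+2.

Lemma nidx_gt1 : (1 < nidx)%N. Proof. by []. Qed.

Lemma nidx_nil r (x : uvec A) : (nidx <= r)%N -> fil r x -> x = 0.
Proof.
rewrite /nidx; case: cid => N nilN /= Nr; apply: nilN.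
exact: leq_trans (leqW (leqnSn N)) Nr.
Qed.

End Nilpotency_index.

(** * Maurer-Cartan elements at one level *)

Section Level_MC.
Variables (k : fieldType) (char0 : [pchar k] =i pred0).
Variables (V : linf_algebra k) (A : formal_cdga k) (i : findex A).
Notation U := (Pi V).
Notation g := (CE_ops V).
Notation Ai := (A i).
Notation m := (ldif_der V).
Notation LD := (tensor Ai (der U)).
Notation aprjs := (fun b => aprj Ai b).

Lemma mkZ_inj (p q p' q' : nat -> LD) : mkZ p q = mkZ p' q' ->
  (forall n, p n = p' n) /\ (forall n, q n = q' n).
Proof.
move=> E; split=> n; apply: valT_inj.
  by have := congr1 (tmapr (coefz n)) E; rewrite !coefz_mkZ.
by have := congr1 (tmapr (coefdz n)) E; rewrite !coefdz_mkZ.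
Qed.

Lemma MC_mkZ (p q : nat -> LD) :
  (todd (g := zdz_ops g) (mkZ p q) /\
   tdif (g := zdz_ops g) (mkZ p q) + 2^-1 *: tbra (g := zdz_ops g) (mkZ p q) (mkZ p q) = 0) <->
  [/\ forall n, tprj aprjs (@der_prj k U) true (p n) = p n,
      forall n, tprj aprjs (@der_prj k U) false (q n) = q n,
      MC_eq (m0 Ai m + inB p) & flow_eq (m0 Ai m + inB p) (inB q)].
Proof.
have e1 n : tmapr (coefz n) (tdif (g := zdz_ops g) (mkZ p q) +
    2^-1 *: tbra (g := zdz_ops g) (mkZ p q) (mkZ p q)) =
    valT (ltdif m (p n) + 2^-1 *: \sum_(l < n.+1) ltbra (p l) (p (n - l)%N)).
  rewrite (linear_funD (tmapr_is_linear (coefz n))) (linear_funZ (tmapr_is_linear (coefz n))).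
  rewrite coefz_tdif coefz_tbra.
  by rewrite (linear_funD (@valT_linear _ _ _ _)) (linear_funZ (@valT_linear _ _ _ _)).
have e2 n : tmapr (coefdz n) (tdif (g := zdz_ops g) (mkZ p q) +
    2^-1 *: tbra (g := zdz_ops g) (mkZ p q) (mkZ p q)) =
    valT (ltdif m (q n) + lsgn (p n.+1) *+ n.+1 +
    2^-1 *: (\sum_(l < n.+1) ltbra (p l) (q (n - l)%N) +
             \sum_(l < n.+1) ltbra' (q l) (p (n - l)%N))).
  rewrite (linear_funD (tmapr_is_linear (coefdz n))) (linear_funZ (tmapr_is_linear (coefdz n))).
  rewrite coefdz_tdif coefdz_tbra.
  by rewrite [RHS](linear_funD (@valT_linear _ _ _ _)) (linear_funZ (@valT_linear _ _ _ _)).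
have v0 : valT (0 : LD) = 0 by exact: (linear_fun0 (@valT_linear _ _ _ _)).
have mo := ldif_der_odd V; have ms := @ldif_der_sq k V.
split=> [[]|[po qe MC fl]].
  rewrite /todd tprj_mkZ => /mkZ_inj[po qe] MC; split=> //.
    apply/(MC_components char0 mo ms po) => n; apply: valT_inj.
    by rewrite -e1 MC v0 linear0.
  apply/(flow_components char0 mo po qe) => n; apply: valT_inj.
  by rewrite -e2 MC v0 linear0.
split.
  rewrite /todd tprj_mkZ; congr mkZ; apply: funext => n; [exact: po|exact: qe].
apply: zdz_tensor_eq => n.
  by rewrite e1 ((MC_components char0 mo ms po).2 MC) v0 linear0.
by rewrite e2 ((flow_components char0 mo po qe).2 fl) v0 linear0.
Qed.

Definition cser (M : lmodType k) (X : M) : nat -> M := fun n => if n is 0 then X else 0.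

(** The single element y is regarded as a constant path, to which [MC_components] applies in degree
    0. *)
Lemma MC_valT (y : LD) : tprj aprjs (@der_prj k U) true y = y ->
  tmap (@udif k Ai) (mB Ai m + tmap (@uinc k Ai) y) +
    2^-1 *: bra (mB Ai m + tmap (@uinc k Ai) y) (mB Ai m + tmap (@uinc k Ai) y) = 0 ->
  todd (g := g) (valT y) /\ tdif (g := g) (valT y) + 2^-1 *: tbra (g := g) (valT y) (valT y) = 0.
Proof.
move=> yo MC; split; first by rewrite /todd tprj_valT yo.
rewrite tdif_valT tbra_valT -(linear_funZ (@valT_linear _ _ _ _)).
rewrite -(linear_funD (@valT_linear _ _ _ _)).
suff -> : ltdif m y + 2^-1 *: ltbra y y = 0 by exact: (linear_fun0 (@valT_linear _ _ _ _)).
have po n : tprj aprjs (@der_prj k U) true (cser y n) = cser y n.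
  by case: n => [|n] //=; exact: (linear_fun0 (tprj_linear _ _)).
have mo := ldif_der_odd V; have ms := @ldif_der_sq k V.
have := (MC_components char0 mo ms po).2 _ 0; rewrite big_ord1; apply.
have -> : m0 Ai m + inB (cser y) = cser (mB Ai m + tmap (@uinc k Ai) y).
  apply: funext => -[|n]; rewrite fctE //= /inB /= linear0 addr0 //.
set Y := mB _ _ + _ in MC *; apply: funext => n.
change (tmap (@udif k Ai) (cser Y n) + 2^-1 *: cbra (cser Y) (cser Y) n = 0).
case: n => [|n]; first by rewrite /cbra big_ord1 /= MC.
rewrite /cbra big1 ?scaler0 /= ?linear0 ?addr0 // => -[[|l] ln] _ /=.
  by rewrite linear0.
exact: (linear_fun0 (bra_linearl _)).
Qed.

End Level_MC.

(** * Twisting *)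

Section Unit_form.
Variables (k : fieldType) (char0 : [pchar k] =i pred0) (U : superspace k).
Notation S := (Shat U).

Lemma Shat_mulr1 (f : S) : Shat_mul f (Shat_one U) = f.
Proof.
apply: ShatP => s; transitivity (form_mul s f (Shat_one U)); first by [].
have: multilinear f by exact: Shat_multilinear.
move: (f : seq U -> k^o) => {}f; elim: s f => [|v s IH] f fl; first exact: mulr1.
rewrite /= form_mul0r add0r.
have one_sgn b : form_sgn b (Shat_one U) = Shat_one U.
  by apply: funext; case.
rewrite big_bool !one_sgn !IH; try exact: multilinear_contract.
by rewrite [RHS](multilinear_prj _ _ fl); exact: addrC.
Qed.

Lemma der_one (D : der U) : D (Shat_one U) = 0.
Proof.
rewrite -(der_prjD char0 D) derDE.
suff H b : der_prj b D (Shat_one U) = 0 by rewrite !H addr0.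
have [_ _ _ Dd] := CE_hderivation (char0_neq0 char0 1) b (der_CE D).
have := Dd (Shat_one U) (Shat_one U); rewrite Shat_sgn1 Shat_mul1 Shat_mulr1 Shat_mul1.
by move/eqP; rewrite -subr_eq0 opprD addrA subrr sub0r oppr_eq0 => /eqP.
Qed.

Lemma rcontr_linear_form x u : linear_form x ->
  rcontr u x = (x [:: u] : k) *: Shat_one U.
Proof.
move=> xl; apply: ShatP => -[|v s]; rewrite ShatZE /= /rcontr_fun /= ?mulr1 // mulr0.
by rewrite xl //= size_rcons.
Qed.

Lemma lcontr_symform u (f : S) : (fun s => f (u :: s)) \in @symform k U.
Proof.
by apply/symformP; split; [apply: multilinear_contract (Shat_multilinear f)|
  apply: gsymmetric_contract (Shat_gsymmetric f)].
Qed.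
(** The multilinear extension [mext] takes its vectors from the left, while the derivation is
    contraction on the right; this one mediates between them. *)
Definition lcontr u f : S := MkShat (lcontr_symform u f).

Lemma lcontr_linearl f : linear (lcontr^~ f).
Proof.
move=> c u v; apply: ShatP => s; rewrite ShatDE ShatZE /=.
by rewrite (Shat_multilinear f [::]).
Qed.

Lemma lcontr_linearr u : linear (lcontr u).
Proof. by move=> c f g; apply: ShatP => s; rewrite ShatDE ShatZE. Qed.

Lemma rcontr_lcontr b u f : sprj U b u = u -> rcontr u f = Shat_sgn b (lcontr u f).
Proof.
move=> ub; apply: ShatP => s; rewrite Shat_sgnE /= /rcontr_fun.
exact: (form_rcons _ (Shat_multilinear f) (Shat_gsymmetric f) ub).
Qed.

Lemma lcontr_sgn b q u f : sprj U b u = u ->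
  lcontr u (Shat_sgn q f) = (-1) ^+ (q && b) *: Shat_sgn q (lcontr u f).
Proof.
move=> ub; apply: ShatP => s; rewrite ShatZE Shat_sgnE /= /form_sgn /= (usgn_hom _ ub).
exact: (multilinearZ [::] _ _ _ (Shat_multilinear f)).
Qed.

Lemma Shat_sgn_addb b c (f : S) : Shat_sgn (b (+) c) f = Shat_sgn b (Shat_sgn c f).
Proof. by case: b; case: c; rewrite /= ?Shat_sgn0 ?Shat_sgnK. Qed.

End Unit_form.

(** * Insertion of vectors as iterated contraction *)

Section Twisting.
Variables (k : fieldType) (char0 : [pchar k] =i pred0) (A : nil_cdga k).
Variables (U : superspace k) (m : der U).
Notation S := (Shat U).
Notation B := (uvec A).
Notation uprj := (@uprj k A).
Notation usgn := (ksgn (sprj U)).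
Notation udif := (@udif k A).
Notation TS := (tensor B S).
Notation TU := (tensor B U).
Notation homU := (hom_tensor (fun b => sprj U b)).

Definition pairing (x : S) (X : TU) : B := tlift (fun b u => (x [:: u] : k) *: b) X.

Lemma pairing_bilin (x : S) : bilin (fun (b : B) (u : U) => (x [:: u] : k) *: b).
Proof.
split=> [u|b] c y z; first by rewrite scalerDr !scalerA mulrC.
by rewrite (linear_form_linear x) scalerDl scalerA.
Qed.

Lemma pairing_linear x : linear (pairing x).
Proof. exact: (tlift_linear (pairing_bilin x).2). Qed.

Lemma pairing_pure x b u : pairing x (pure b u) = (x [:: u] : k) *: b.
Proof. exact: (tlift_pure _ _ (pairing_bilin x)). Qed.

Lemma pairing_inj X Y :
  (forall x, linear_form x -> pairing x X = pairing x Y) -> X = Y.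
Proof.
move=> XY; apply/ffunP => j; apply: linear_form_inj => x xl.
have coordE Z : coord (vbasis {:B}) j (pairing x Z) = x [:: Z j].
  rewrite /pairing /tlift linear_sum (bigD1 j) //= linearZ /=.
  rewrite coord_free ?(basis_free (vbasisP _)) // eqxx [X in X + _]mulr1 big1 ?addr0 //.
  move=> l lj; rewrite linearZ /= coord_free ?(basis_free (vbasisP _)) //.
  by rewrite (negPf lj); exact: mulr0.
by rewrite -!coordE XY.
Qed.

(* h paired with [mext]. *)
Fixpoint fx (p : bool) (a : B) (h : S) (Xs : seq TU) : B :=
  if Xs is X :: Xs' then
    tlift (fun b u => \sum_(c : bool)
      fx (p (+) c) (umul a (usgnA p b)) (lcontr (sprj U c u) h) Xs') X
  else (h [::] : k) *: a.

Lemma fx_linear Xs : (forall p h, linear (fun a => fx p a h Xs)) /\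
  (forall p a, linear (fun h => fx p a h Xs)).
Proof.
elim: Xs => [|X Xs [IHa IHh]]; split=> p.
- by move=> h c a b /=; rewrite scalerDr !scalerA mulrC.
- by move=> a c h g /=; rewrite ?ShatDE ?ShatZE scalerDl scalerA.
- move=> h c a b /=; rewrite /tlift scaler_sumr -big_split; apply: eq_bigr => j _ /=.
  rewrite scaler_sumr -big_split; apply: eq_bigr => d _ /=.
  by rewrite (umul_linearl _ c) IHa.
- move=> a c h g /=; rewrite /tlift scaler_sumr -big_split; apply: eq_bigr => j _ /=.
  rewrite scaler_sumr -big_split; apply: eq_bigr => d _ /=.
  by rewrite lcontr_linearr IHh.
Qed.

Let fx_step p a h Xs : bilin (fun (b : B) (u : U) => \sum_(c : bool)
      fx (p (+) c) (umul a (usgnA p b)) (lcontr (sprj U c u) h) Xs).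
Proof.
apply: bilin_sum => c; have [fa fh] := fx_linear Xs; split=> [u|b] e y z.
  by rewrite linearP linearP fa.
by rewrite linearP lcontr_linearl fh.
Qed.

Lemma fx_cons_linear p a h Xs : linear (fun X => fx p a h (X :: Xs)).
Proof. exact: (tlift_linear (fx_step p a h Xs).2). Qed.

Lemma fx_cons_pure p a h Xs b u : fx p a h (pure b u :: Xs) =
  \sum_(c : bool) fx (p (+) c) (umul a (usgnA p b)) (lcontr (sprj U c u) h) Xs.
Proof. exact: (tlift_pure _ _ (fx_step p a h Xs)). Qed.

Lemma fx_units p a h s :
  fx p a h (map (@unit_tensor k A U) s) = (h s : k) *: a.
Proof.
elim: s p a h => [//|u s IH] p a h.
rewrite [map _ _]/= fx_cons_pure usgnA_uone umulr1.
under eq_bigr => c _ do rewrite IH /=.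
by rewrite big_bool /= -scalerDl addrC -(multilinear_prj _ _ (Shat_multilinear h)).
Qed.

Lemma pairing_mext (x h : S) p a t Xs : (forall s, x [:: str m s] = - h s) ->
  pairing x (mext (fun b => sprj U b) (str m) p a t Xs) =
  - fx p a (foldl (fun h u => lcontr u h) h t) Xs.
Proof.
move=> xh; elim: Xs p a t => [|X Xs IH] p a t /=.
  rewrite pairing_pure xh scaleNr; congr (- (_ *: _)).
  have lE s g : foldl (fun h u => lcontr u h) g t s = g (t ++ s).
    by elim: t g => [//|v t IHt] g /=; rewrite IHt.
  by rewrite lE cats0.
rewrite /tlift (linear_fun_sum (pairing_linear x)) -sumrN; apply: eq_bigr => j _.
rewrite (linear_fun_sum (pairing_linear x)) -sumrN; apply: eq_bigr => c _.
by rewrite IH -[rcons t _]cats1 foldl_cat.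
Qed.

(* F(s), the coefficients of F being moved past s. *)
Definition evs (s : seq U) (F : TS) : B :=
  tlift (fun b (f : S) => \sum_(c : bool) (f (map (usgn c) s) : k) *: uprj c b) F.

Lemma evs_bilin s : bilin (fun (b : B) (f : S) =>
  \sum_(c : bool) (f (map (usgn c) s) : k) *: uprj c b).
Proof.
apply: bilin_sum => c; split=> [f|b] e y z.
  by rewrite linearP scalerDr !scalerA mulrC.
by rewrite ShatDE ShatZE scalerDl scalerA.
Qed.

Lemma evs_linear s : linear (evs s).
Proof. exact: (tlift_linear (evs_bilin s).2). Qed.

Lemma evs_pure s b f : evs s (pure b f) =
  \sum_(c : bool) (f (map (usgn c) s) : k) *: uprj c b.
Proof. exact: (tlift_pure _ _ (evs_bilin s)). Qed.

Lemma evs_hom s d b f : uprj d b = b ->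
  evs s (pure b f) = (f (map (usgn d) s) : k) *: b.
Proof.
move=> bd; rewrite evs_pure (bigD1 d) //= bd big1 ?addr0 // => c cd.
by rewrite (uprj_hom bd) (negPf cd) scaler0.
Qed.

(* The pairing of a form with a vector and its contraction by that vector differ
   by this sign; it turns the gauge parameter into the twisting element. *)
Definition tsgn : TU -> TU := tmapr (usgn true).

Lemma tsgnK : involutive tsgn.
Proof. by move=> X; apply/ffunP => j; rewrite !ffunE usgnK. Qed.

Lemma tsgn_linear : linear tsgn. Proof. exact: tmapr_is_linear. Qed.

Lemma tsgn_hom p X : homU p X -> homU p (tsgn X).
Proof.
apply: tmapr_gen => a u [c [ac uc]]; exists c; split=> //.
by rewrite sprj_usgn uc.
Qed.

Notation T := (fun F xi => act (cst (tsgn xi)) F).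

(** Inserting an even X into the next slot is contraction by [tsgn X]. The hypothesis that a has
    parity [~~ p] is an invariant: since X is even, each vector and its coefficient have equal
    parity, so p and the parity of a change together. *)
Lemma fx_act p a h Xs s : (forall X, X \in Xs -> homU false X) -> uprj (~~ p) a = a ->
  fx p a h (Xs ++ map (@unit_tensor k A U) s) =
  evs s (foldl T (pure a (Shat_sgn (~~ p) h)) Xs).
Proof.
elim: Xs p a h => [|X Xs IH] p a h Xh ap.
  by rewrite cat0s fx_units /= (evs_hom _ _ ap) Shat_sgnE mapK //; exact: usgnK.
have Xsh Y : Y \in Xs -> homU false Y.
  by move=> YXs; apply: Xh; rewrite inE YXs orbT.
have {}IH p' a' h' := IH p' a' h' Xsh.
have fold_linear : linear (fun F => foldl T F Xs).
  elim: (Xs) => [//|Y Ys IHY] c F G /=.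
  by rewrite act_linearr IHY.
apply: (linear_gen_eq (f := fun X => fx p a h (X :: Xs ++ map (@unit_tensor k A U) s))
  (g := fun X => evs s (foldl T (pure a (Shat_sgn (~~ p) h)) (X :: Xs))) _ _
  (Xh X (mem_head _ _))).
- exact: fx_cons_linear.
- move=> c Y Z /=; rewrite tsgn_linear cst_linear act_linearl fold_linear.
  exact: evs_linear.
move=> e u [c [ec uc]]; rewrite addFb in ec.
rewrite fx_cons_pure (bigD1 c) //= uc big1 ?addr0; last first.
  move=> d dc; rewrite -uc sprjK (negPf dc) (linear_fun0 (lcontr_linearl h)).
  exact: (linear_fun0 ((fx_linear _).2 _ _)).
have a'p : uprj (~~ (p (+) c)) (umul a (usgnA p e)) = umul a (usgnA p e).
  have ep : uprj c (usgnA p e) = usgnA p e by rewrite (usgnA_hom _ ec) linearZ /= ec.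
  by have := umul_hom ap ep; rewrite addNb.
rewrite (IH _ _ _ a'p); congr (evs s (foldl _ _ Xs)).
have uc' : der_prj c (der_rcontr (usgn true u)) = der_rcontr (usgn true u).
  by rewrite (der_prj_rcontr char0) sprj_usgn uc.
rewrite /tsgn /cst !tmapr_pure (act_hom char0 _ _ _ uc').
rewrite -[der_fun _ _]/(rcontr (usgn true u) (Shat_sgn (~~ p) h)).
have rcontrZ e' f : rcontr (e' *: u) f = e' *: rcontr u f.
  have := rcontrP e' u 0 f; rewrite addr0 => ->.
  have -> : rcontr 0 f = 0.
    apply: ShatP => r; rewrite /= /rcontr_fun -cats1.
    exact: (multilinear0 r [::] (Shat_multilinear f)).
  by rewrite addr0.
rewrite (usgn_hom _ uc) rcontrZ (rcontr_lcontr _ uc) (lcontr_sgn _ _ uc).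
have pZ := bilinZl (pure_bilin B S); have pZr := bilinZr (pure_bilin B S).
have uZ := bilinZl (@umul_bilin k A); have uZr := bilinZr (@umul_bilin k A).
(* With c the parity of u and of e, the right side carries (-1)^c from [tsgn] and three times
   (-1)^(c (~~ p)): from the grading sign on h, from moving the contraction past a, and from
   exchanging e with a. Their product is the sign (-1)^(p c) of the left side. *)
rewrite (usgnA_hom _ ap) (usgnA_hom _ ec) !uZr (umulC_hom ec ap) -addNb addbC Shat_sgn_addb.
rewrite (linear_funZ (@Shat_sgn_linear k U c)) !pZr !pZ !scalerA -!signr_addb.
by congr (_ *: _); case: (p); case: (c).
Qed.

End Twisting.

(** * The exponential of a contraction as twisting *)

Section Twisted_structure.
Variables (k : fieldType) (char0 : [pchar k] =i pred0) (A : nil_cdga k).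
Variables (U : superspace k) (m : der U).
Hypothesis m_odd : der_prj true m = m.
Hypothesis m_free : dfree m.
Notation S := (Shat U).
Notation B := (uvec A).
Notation uprj := (@uprj k A).
Notation usgn := (ksgn (sprj U)).
Notation udif := (@udif k A).
Notation TD := (tensor B (der U)).
Notation TU := (tensor B U).
Notation homD := (hom_tensor (@der_prj k U)).
Notation homU := (hom_tensor (fun b => sprj U b)).
Notation one := (uone A).
Notation sg := (@Shat_sgn k U true).

Lemma act_unit_form (X : TD) b : act X (pure b (Shat_one U)) = 0.
Proof.
apply: (linear_tensor_eq (f := fun X => act X (pure b (Shat_one U))) (g := fun=> 0))
  => [c x y|c x y|a D].
- by rewrite act_linearl.
- by rewrite scaler0 addr0.
rewrite /act kop_pure //; last exact: der_linear.
by rewrite big1 // => c _; rewrite der_one // (bilin0r (pure_bilin B S)).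
Qed.

(** The contraction of a linear form is a multiple of the unit form, which every derivation
    annihilates. *)
Lemma act_act_cst (X : TD) (Z : TU) x : linear_form x ->
  act X (act (cst Z) (pure one x)) = 0.
Proof.
move=> xl; rewrite act_one //; set G := [ffun j => _].
have -> : G = \sum_(j < \dim {:B}) (x [:: Z j] : k) *: pure (vbasis {:B})`_j (Shat_one U).
  rewrite [LHS]tensor_sum; apply: eq_bigr => j _.
  rewrite /G !ffunE /= (rcontr_linear_form _ xl).
  exact: (bilinZr (pure_bilin B S)).
rewrite (linear_fun_sum (act_linearr X)) big1 // => j _.
by rewrite (linear_funZ (act_linearr X)) act_unit_form scaler0.
Qed.

(** Of all terms of the nested commutator only the one with every contraction to the left of X
    survives on a linear form. On linear forms exp(ad) is therefore plain Taylor expansion. *)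
Lemma act_iter_bra n (Xi : TU) (X : TD) x : homU false Xi -> homD true X -> linear_form x ->
  act (iter n (bra (cst Xi)) X) (pure one x) = iter n (act (cst Xi)) (act X (pure one x)).
Proof.
move=> hXi hX xl.
have hc : homD false (cst Xi) by exact: cst_hom.
have hn l : homD true (iter l (bra (cst Xi)) X).
  by elim: l => [//|l IH]; rewrite iterS; exact: (bra_hom_parity char0 hc IH).
elim: n => [//|n IH]; rewrite !iterS (act_bra char0 _ hc (hn n)) IH act_act_cst //.
by rewrite scaler0 subr0.
Qed.

Lemma act_gexp1 N (Xi : TU) (X : TD) x : homU false Xi -> homD true X -> linear_form x ->
  act (gexp1 N Xi X) (pure one x) =
  \sum_(l < N) (l`!%:R^-1 : k) *: iter l (act (cst Xi)) (act X (pure one x)).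
Proof.
move=> hXi hX xl; rewrite /gexp1 (linear_fun_sum (act_linearl _)); apply: eq_bigr => l _.
by rewrite (linear_funZ (act_linearl _)) act_iter_bra.
Qed.

Lemma act_mB f : act (mB A m) (pure one f) = pure one (m f).
Proof. by rewrite (act_hom char0 _ _ _ m_odd) usgnA_uone umul1. Qed.

Lemma iter_act_fil l (Xi : TU) F : fil_tensor 1 Xi -> fil_tensor l (iter l (act (cst Xi)) F).
Proof.
move=> X1; elim: l => [|l IH]; first exact: fil_tensor0.
by rewrite iterS; apply: kop_fil1 IH => //; [exact: der_linear|exact: cst_fil].
Qed.

Lemma pairing_str x s (Y : tensor A (der U)) : linear_form x ->
  homD true (tmap (@uinc k A) Y) ->
  pairing x (tmap (@uinc k A) (tlift (fun a (D : der U) => pure a (str D s)) Y)) =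
  - evs s (act (tmap (@uinc k A) Y) (pure one (sg x))).
Proof.
move=> xl hY.
(* The right side of [str_pairing] without its sign. Since Y is odd in total, coefficients have the
   parity [~~ c] when derivations have the parity c, which is the sign that [evs] puts on s. *)
pose h (b : B) (D : der U) : B :=
  \sum_(c : bool) (der_prj c D (sg x) (map (usgn (~~ c)) s) : k) *: b.
have hb : bilin h.
  apply: bilin_sum => c; split=> [D|b] e y z.
    by rewrite scalerDr !scalerA mulrC.
  by rewrite linearP derDE derZE ShatDE ShatZE scalerDl scalerA.
transitivity (- tlift h (tmap (@uinc k A) Y)).
  rewrite /tlift (linear_fun_sum (@tmap_is_linear _ _ _ _ _)) (linear_fun_sum (pairing_linear x)).
  rewrite [tmap _ Y in RHS]/tmap [in RHS]/tlift -/(tlift h _) (linear_fun_sum (tlift_linear hb.2)) -sumrN.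
  apply: eq_bigr => j _; rewrite tmap_pure pairing_pure (str_pairing char0 _ (der_CE _) xl).
  rewrite (tlift_pure _ _ hb) /h scaleNr scaler_suml; congr (- _).
congr (- _).
apply: (linear_gen_eq (f := tlift h) (g := fun X => evs s (act X (pure one (sg x)))) _ _ hY).
- exact: (tlift_linear hb.2).
- by move=> c X Z; rewrite act_linearl evs_linear.
move=> b D [c [bc Dc]].
rewrite (tlift_pure _ _ hb) (act_hom char0 _ _ _ Dc) usgnA_uone umulr1 (evs_hom _ _ bc).
rewrite /h (bigD1 c) // Dc big1 => [|d dc]; first exact: addr0.
have -> : der_prj d D = 0 by rewrite -Dc der_prjK // (negPf dc).
exact: scale0r.
Qed.

Lemma str_m x s : linear_form x -> x [:: str m s] = - m (sg x) s.
Proof.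
move=> xl; rewrite (str_pairing char0 _ (der_CE m) xl) big_bool /= map_id.
have -> : End_prj true m = m by have := congr1 (@der_fun k U) m_odd.
have -> : End_prj false m = (0 : der U).
  by have := congr1 (@der_fun k U) (der_prjK char0 false true m); rewrite m_odd.
by rewrite addr0.
Qed.

Lemma pairing_mext_odd x Xs s : linear_form x -> (forall X, X \in Xs -> homU false X) ->
  pairing x (mext_odd (fun b => sprj U b) (str m) (Xs ++ map (@unit_tensor k A U) s)) =
  - evs s (foldl (fun F xi => act (cst (tsgn xi)) F) (pure one (m (sg x))) Xs).
Proof.
move=> xl Xh; rewrite /mext_odd (pairing_mext _ _ _ _ (fun s => str_m s xl)) /=.
have one_even : uprj (~~ true) one = one by exact: uprj_uone.
by rewrite (fx_act char0 _ _ Xh one_even) /= Shat_sgn0.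
Qed.

Variable N : nat.
Hypothesis N_nil : forall r (x : B), (N <= r)%N -> fil r x -> x = 0.
Variable xi : TU.
Hypothesis xi_fil : fil_tensor 1 xi.
Hypothesis xi_hom : homU false xi.

Let Xi := tsgn xi.
Let term s n : TU := (n`!%:R^-1 : k) *:
  mext_odd (fun b => sprj U b) (str m) (nseq n xi ++ map (@unit_tensor k A U) s).
Let W s := \sum_(n < N) term s n.

Let Xi_fil : fil_tensor 1 Xi. Proof. by apply: tmapr_gen xi_fil. Qed.
Let Xi_hom : homU false Xi. Proof. exact: tsgn_hom. Qed.

Lemma pairing_term x s n : linear_form x ->
  pairing x (term s n) =
  - evs s ((n`!%:R^-1 : k) *: iter n (act (cst Xi)) (act (mB A m) (pure one (sg x)))).
Proof.
move=> xl; rewrite /term (linear_funZ (pairing_linear x)) pairing_mext_odd //; last first.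
  by move=> X; rewrite mem_nseq => /andP[_ /eqP->].
rewrite act_mB (linear_funZ (evs_linear s)) -scalerN; congr (_ *: - evs s _).
by elim: n (pure _ _) => [//|n IH] F /=; rewrite IH -iterSr.
Qed.

(** Each insertion of xi raises the order of the coefficients by one, so the twisting series is
    finite. *)
Lemma term_evals s : evals (term s) (W s).
Proof.
exists N; split=> // n Nn; apply: pairing_inj => x xl; rewrite pairing_term //.
rewrite (fil_tensor_nil (fun y => N_nil Nn (x := y)) (iter_act_fil n _ Xi_fil)).
by rewrite scaler0 (linear_fun0 (evs_linear s)) oppr0 (linear_fun0 (pairing_linear x)).
Qed.

Lemma pairing_W x s : linear_form x ->
  pairing x (W s) = - evs s (act (gexp1 N Xi (mB A m)) (pure one (sg x))).
Proof.
move=> xl; rewrite /W (linear_fun_sum (pairing_linear x)).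
rewrite (act_gexp1 _ Xi_hom (mB_hom A m_odd) (linear_form_sgn true xl)).
rewrite (linear_fun_sum (evs_linear s)) -sumrN.
by apply: eq_bigr => n _; rewrite pairing_term.
Qed.

Variable YA : tensor A (der U).
Hypothesis YA_eq : tmap (@uinc k A) YA =
  gexp1 N Xi (mB A m) - mB A m - cst (tmap udif Xi).

(** Paired with linear forms, the exponential becomes the twisting series. The remaining contraction
    by d_A Xi turns a linear form into a constant, which a nonempty s does not detect. *)
Lemma twisted_eq s : (0 < size s)%N -> homD true (tmap (@uinc k A) YA) ->
  tmap (@uinc k A) (tlift (fun a (D : der U) => pure a (str D s)) YA) =
  W s - mext_odd (fun b => sprj U b) (str m) (map (@unit_tensor k A U) s).
Proof.
move=> s0 hY; apply: pairing_inj => x xl; rewrite (pairing_str _ xl hY) YA_eq.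
rewrite (linear_funB (pairing_linear x)) pairing_W //.
have := @pairing_mext_odd x [::] s xl; rewrite cat0s => -> //.
rewrite !(linear_funB (act_linearl _)) !(linear_funB (evs_linear s)) act_mB /=.
suff -> : evs s (act (cst (tmap udif Xi)) (pure one (sg x))) = 0.
  by rewrite subr0 opprB opprK addrC.
rewrite act_one // /evs /tlift big1 // => j _; rewrite big1 // => c _.
have xl' := linear_form_sgn true xl.
rewrite !ffunE [X in X *: _](_ : _ = 0) ?scale0r //; apply: xl'.
by rewrite size_rcons size_map; case: (s) s0.
Qed.

(** At the empty sequence m itself contributes nothing, so the constant term balances the twisting
    series against d_A Xi. As [tsgn] commutes with d_A and is an involution, this is the equation
    for xi. *)
Lemma twisting_MC : dfreeT (tmap (@uinc k A) YA) -> tmap udif xi + W [::] = 0.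
Proof.
move=> Yf; apply: pairing_inj => x xl.
rewrite (linear_fun0 (pairing_linear x)) (linear_funD (pairing_linear x)) pairing_W //.
have ev0 X : dfreeT X -> evs [::] (act X (pure one (sg x))) = 0.
  move=> Xf; rewrite act_one // /evs /tlift big1 // => j _; rewrite big1 // => c _.
  by rewrite ffunE Xf scale0r.
have mf : dfreeT (mB A m) by exact: dfreeT_pure.
have := ev0 _ Yf; rewrite YA_eq !(linear_funB (act_linearl _)) !(linear_funB (evs_linear _)).
rewrite (ev0 _ mf) subr0 => /eqP; rewrite subr_eq0 => /eqP->.
have -> : evs [::] (act (cst (tmap udif Xi)) (pure one (sg x))) = pairing x (tsgn (tmap udif Xi)).
  rewrite act_one //.
  rewrite /evs /pairing /tlift; apply: eq_bigr => j _.
  set b := (vbasis _)`_j; rewrite !ffunE big_bool -[b in RHS]uprjD scalerDr.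
  exact: addrC.
have -> : tsgn (tmap udif Xi) = tmap udif xi.
  by rewrite /Xi /tsgn tmapr_tmap -/(tsgn _) -/(tsgn _) tsgnK.
by rewrite subrr.
Qed.

(** The operation with no inputs vanishes, so the sum over n > 0 in [linf_MC] may start at 0. *)
Lemma term0_nil : term [::] 0 = 0.
Proof.
apply: pairing_inj => x xl; rewrite pairing_term // (linear_fun0 (pairing_linear x)).
rewrite act_mB fact0 invr1 scale1r /= (evs_hom _ _ (uprj_uone A)) /= m_free.
by rewrite scale0r oppr0.
Qed.

End Twisted_structure.

(** * Making the path free of constant terms *)

Section Gauged_path.
Variables (k : fieldType) (char0 : [pchar k] =i pred0) (A : nil_cdga k).
Variables (U : superspace k) (m : der U).
Hypothesis m_odd : der_prj true m = m.
Hypothesis m_free : dfree m.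
Notation B := (uvec A).
Notation udif := (@udif k A).
Notation uinc := (@uinc k A).
Notation usnd := (@usnd k A).
Notation aprjs := (fun b => aprj A b).
Notation TD := (tensor B (der U)).
Notation TU := (tensor B U).
Notation LD := (tensor A (der U)).
Notation homD := (hom_tensor (@der_prj k U)).
Notation homU := (hom_tensor (fun b => sprj U b)).
Notation N := (nidx A).
Notation m0 := (m0 A m).
Notation mB := (mB A m).

Lemma dfree_tmap (C C' : vectType k) (phi : C -> C') (X : tensor C (der U)) j :
  (forall j, dfree (X j)) -> dfree (tmap phi X j).
Proof.
move=> Xf; rewrite /tmap /tlift sum_ffunE.
apply: big_ind => [|D E hD hE|l _]; first exact: dfree0.
  by rewrite -[D]scale1r; exact: dfreeP.
by rewrite ffunE; exact: dfreeZ.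
Qed.

Variables p q : nat -> LD.

Definition xi_path : nat -> TU := psol (inB q) N.
Definition M_path : nat -> TD := gaugeM xi_path N (m0 + inB p).
Definition Q_path : nat -> TD := gaugeQ xi_path N (inB q).
(** Conjugation changes m only by terms with coefficients in A_+, so after m is removed [usnd]
    discards nothing. *)
Definition p_path : nat -> LD := fun n => tmap usnd (M_path n - m0 n).
Definition q_path : nat -> LD := fun n => tmap usnd (Q_path n).

Hypothesis p_odd : forall n, tprj aprjs (@der_prj k U) true (p n) = p n.
Hypothesis q_even : forall n, tprj aprjs (@der_prj k U) false (q n) = q n.
Hypothesis p_MC : MC_eq (m0 + inB p).
Hypothesis pq_flow : flow_eq (m0 + inB p) (inB q).
Hypothesis q_fsupp : fsupp q.
Hypothesis p_free0 : forall j, dfree (p 0 j).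
Hypothesis p_eval1 : evals p 0.

Let uincl := @tmap_is_linear k A B (der U) uinc.
Let usndl := @tmap_is_linear k B A (der U) usnd.

Let Q_fil n : fil_tensor 1 (inB q n). Proof. exact: fil_tensor_uinc. Qed.
Let Q_hom n : homD false (inB q n). Proof. exact: inB_q_hom. Qed.
Let M_hom n : homD true ((m0 + inB p) n).
Proof. by apply: hom_tensorD; [exact: m0_hom|exact: inB_p_hom]. Qed.
Let xi_adm : adm xi_path. Proof. exact: (psol_adm char0 Q_fil Q_hom). Qed.
Let nilN := @nidx_nil k A.

Lemma M_path_hom n : homD true (M_path n).
Proof. exact: (gaugeM_hom char0 xi_adm.2 _ M_hom). Qed.

Lemma Q_path_hom n : homD false (Q_path n).
Proof. exact: (gaugeQ_hom char0 xi_adm.2 _ Q_hom). Qed.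

Lemma filB (M : lmodType k) r (X Y : tensor B M) :
  fil_tensor r X -> fil_tensor r Y -> fil_tensor r (X - Y).
Proof. by move=> hX hY; rewrite -scaleN1r; apply: fil_tensorD => //; exact: fil_tensorZ. Qed.

Lemma fil_tensor1 (M : lmodType k) r (X : tensor B M) : (0 < r)%N ->
  fil_tensor r X -> fil_tensor 1 X.
Proof. by elim: r => // -[//|r] IH _ /fil_tensorS; exact: IH. Qed.

Lemma gexp_fil_diff (xi : nat -> TU) K (X : nat -> TD) n : (0 < K)%N ->
  (forall n, fil_tensor 1 (xi n)) -> fil_tensor 1 (gexp K xi X n - X n).
Proof.
case: K => // K _ xif; rewrite /gexp fct_sum_nE big_ord_recl /= fact0 invr1.
rewrite [(1 *: X) n](_ : _ = 1 *: X n) // scale1r addrC addKr.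
apply: tgen_sum => l _; apply: fil_tensorZ.
exact: (fil_tensor1 _ (iter_adx_fil xif l.+1 X n)).
Qed.

Lemma M_path_fil n : fil_tensor 1 (M_path n - m0 n).
Proof.
have -> : M_path n - m0 n = gexp N xi_path (m0 + inB p) n - (m0 + inB p) n +
    inB p n - csts (dAs xi_path) n.
  rewrite [M_path n](_ : _ = gexp N xi_path (m0 + inB p) n - csts (dAs xi_path) n) //.
  rewrite [(m0 + inB p) n](_ : _ = m0 n + inB p n) // opprD addrA subrK.
  by rewrite addrAC.
apply: filB; last by apply: cst_fil; exact: tmap_udif_fil.
apply: fil_tensorD; last exact: fil_tensor_uinc.
by apply: gexp_fil_diff => // l; exact: xi_adm.1.
Qed.

Lemma Q_path_fil n : fil_tensor 1 (Q_path n).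
Proof.
apply: filB; first exact: (gexp_fil1 Q_fil).
by apply: cst_fil; rewrite /dzs -scaler_nat; apply: fil_tensorZ; exact: xi_adm.1.
Qed.

Lemma inB_p_path : m0 + inB p_path = M_path.
Proof.
apply: funext => n; change (m0 n + inB p_path n = M_path n).
by rewrite /inB /p_path (uinc_usnd _ (M_path_fil n)) // addrC subrK.
Qed.

Lemma inB_q_path : inB q_path = Q_path.
Proof. by apply: funext => n; rewrite /inB /q_path (uinc_usnd _ (Q_path_fil n)). Qed.

Lemma p_path_odd n : tprj aprjs (@der_prj k U) true (p_path n) = p_path n.
Proof.
rewrite /p_path.
apply: (hom_tprj (pM := fun c => der_prj c : {linear der U -> der U}) (@der_prjK k char0 U)).
by apply: homB; [exact: M_path_hom|exact: m0_hom].
Qed.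

Lemma q_path_even n : tprj aprjs (@der_prj k U) false (q_path n) = q_path n.
Proof.
rewrite /q_path.
apply: (hom_tprj (pM := fun c => der_prj c : {linear der U -> der U}) (@der_prjK k char0 U)).
exact: Q_path_hom.
Qed.

Lemma M_path_MC : MC_eq M_path.
Proof. exact: (gauge_MC char0 xi_adm.1 xi_adm.2 (nidx_gt1 A) nilN M_hom p_MC). Qed.

Lemma M_path_flow : flow_eq M_path Q_path.
Proof. exact: (gauge_flow char0 xi_adm.1 xi_adm.2 (nidx_gt1 A) nilN M_hom Q_hom pq_flow). Qed.

Lemma Q_path_free n : dfreeT (Q_path n).
Proof. exact/(dfreeT_kap char0)/(kap_gaugeQ char0 Q_fil Q_hom nilN). Qed.

Lemma M_path0 : M_path 0 = mB + inB p 0.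
Proof.
rewrite [M_path 0](_ : _ = gexp N xi_path (m0 + inB p) 0 - csts (dAs xi_path) 0) //.
rewrite (gexp0 _ _ (psol0 _ _)) // /csts /dAs /xi_path psol0.
by rewrite (linear_fun0 (@tmap_is_linear _ _ _ _ _)) linear0 subr0.
Qed.

Lemma M_path_free n : dfreeT (M_path n).
Proof.
apply: (flow_dfree char0 M_path_flow Q_path_free); rewrite M_path0.
apply: dfreeTD; first exact: dfreeT_pure.
by move=> j; exact: dfree_tmap.
Qed.

Lemma m0_free n : dfreeT (m0 n).
Proof. by case: n => [|n]; [exact: dfreeT_pure|exact: dfreeT0]. Qed.

Lemma p_path_free n j : dfree (p_path n j).
Proof.
apply: dfree_tmap => l; rewrite -scaleN1r addrC.
by apply: dfreeTP; [exact: m0_free|exact: M_path_free].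
Qed.

Lemma q_path_free n j : dfree (q_path n j).
Proof. by apply: dfree_tmap; exact: Q_path_free. Qed.

Lemma p_path0 : p_path 0 = p 0.
Proof. by rewrite /p_path M_path0 /= addrC addKr usnd_uinc. Qed.

Let Q_fsupp : fsupp (inB q).
Proof. by have [x hx] := q_fsupp; exists (tmap uinc x); exact: (evals_lin uincl). Qed.

Lemma xi_path_fsupp : fsupp xi_path.
Proof. exact: psol_fsupp. Qed.

Lemma q_path_fsupp : fsupp q_path.
Proof.
have [Xi hXi] := xi_path_fsupp; have [x hx] := Q_fsupp.
have [y hy] := fsupp_dzs xi_path_fsupp.
exists (tmap usnd (gexp1 N Xi x - cst y)); apply: (evals_lin usndl).
by apply: evalsB; [exact: evals_gexp|exact: evals_csts].
Qed.

Section At_one.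
Variable Xi : TU.
Hypothesis xi_eval : evals xi_path Xi.

Lemma Xi_fil : fil_tensor 1 Xi.
Proof. by have [d [_ <-]] := xi_eval; apply: tgen_sum => n _; exact: xi_adm.1. Qed.

Lemma Xi_hom : homU false Xi.
Proof. by have [d [_ <-]] := xi_eval; apply: tgen_sum => n _; exact: xi_adm.2. Qed.

(** The endpoint in closed form, as needed for the comparison with the twisting; [p_path_evals]
    identifies it with the sum of the coefficients. *)
Definition Y_end : LD := tmap usnd (gexp1 N Xi mB - mB - cst (tmap udif Xi)).

Lemma m0_evals : evals m0 mB.
Proof. by exists 1%N; split=> [[]//|]; rewrite big_ord1. Qed.

Lemma M_path_evals : evals M_path (gexp1 N Xi mB - cst (tmap udif Xi)).
Proof.
(* Here the triviality of the curved deformation enters: the old path ends at 0, so at z = 1 only m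
   remains under the exponential. *)
apply: evalsB; last by apply: evals_csts; exact: evals_dAs.
apply: evals_gexp => //; rewrite -[mB]addr0; apply: evalsD m0_evals _.
by have := evals_lin uincl p_eval1; rewrite (linear_fun0 uincl).
Qed.

Lemma p_path_evals : evals p_path Y_end.
Proof.
rewrite /Y_end addrAC; apply: (evals_lin usndl).
exact: evalsB M_path_evals m0_evals.
Qed.

Lemma Y_end_fil : fil_tensor 1 (gexp1 N Xi mB - mB - cst (tmap udif Xi)).
Proof.
apply: filB; last by apply: cst_fil; exact: tmap_udif_fil.
rewrite /gexp1 /nidx big_ord_recl /= fact0 invr1 scale1r addrC addKr.
apply: tgen_sum => l _; apply: fil_tensorZ.
have step j : fil_tensor j (iter j (bra (cst Xi)) mB).
  elim: j => [|j IH]; first exact: fil_tensor0.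
  by rewrite iterS; apply: bra_fil1 IH; apply: cst_fil; exact: Xi_fil.
exact: (fil_tensor1 _ (step l.+1)).
Qed.

Lemma Y_end_uinc : tmap uinc Y_end = gexp1 N Xi mB - mB - cst (tmap udif Xi).
Proof. by rewrite /Y_end (uinc_usnd _ Y_end_fil). Qed.

Lemma Y_end_hom : homD true (tmap uinc Y_end).
Proof.
have [d [_ <-]] := p_path_evals; rewrite (linear_fun_sum uincl); apply: tgen_sum => n _.
exact: (inB_p_hom char0 p_path_odd).
Qed.

Lemma Y_end_odd : tprj aprjs (@der_prj k U) true Y_end = Y_end.
Proof.
have [d [_ <-]] := p_path_evals.
rewrite (linear_fun_sum (tprj_linear (fun c => der_prj c : {linear der U -> der U}) true)); apply: eq_bigr => n _.
exact: p_path_odd.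
Qed.

Lemma Y_end_free j : dfree (Y_end j).
Proof.
have [d [_ <-]] := p_path_evals; rewrite sum_ffunE.
apply: big_ind => [|D E hD hE|l _]; first exact: dfree0.
  by rewrite -[D]scale1r; exact: dfreeP.
exact: p_path_free.
Qed.

Lemma Y_end_MC : tmap udif (mB + tmap uinc Y_end) +
  2^-1 *: bra (mB + tmap uinc Y_end) (mB + tmap uinc Y_end) = 0.
Proof.
have -> : mB + tmap uinc Y_end = gexp1 N Xi mB - cst (tmap udif Xi).
  by rewrite Y_end_uinc addrA [mB + _]addrC subrK.
(* Evaluation at 1 is compatible with d_A and the bracket, so the equation for the path specializes
   to one for its endpoint. *)
have e := evalsD (evals_dAs M_path_evals) (evalsZ 2^-1 (evals_cbra M_path_evals M_path_evals)).
by apply: (evals_inj e); rewrite M_path_MC; exact: evals0.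
Qed.

End At_one.
End Gauged_path.

(** * Compatibility of the corrected paths with the transition maps *)

Section Path_naturality.
Variables (k : fieldType) (char0 : [pchar k] =i pred0) (A A' : nil_cdga k).
Variables (phi : {linear A -> A'}) (phiM : cdga_morphism phi).
Variables (U : superspace k) (m : der U).
Variables (p q : nat -> tensor A (der U)) (p' q' : nat -> tensor A' (der U)).
Hypothesis q_even : forall n, tprj (fun b => aprj A b) (@der_prj k U) false (q n) = q n.
Hypothesis q'_even : forall n, tprj (fun b => aprj A' b) (@der_prj k U) false (q' n) = q' n.
Hypothesis pp' : forall n, tmap phi (p n) = p' n.
Hypothesis qq' : forall n, tmap phi (q n) = q' n.
Notation K := (maxn (nidx A) (nidx A')).

Let Q_fil n : fil_tensor 1 (inB q n). Proof. exact: fil_tensor_uinc. Qed.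
Let Q_hom n : hom_tensor (@der_prj k U) false (inB q n). Proof. exact: inB_q_hom. Qed.
Let Q'_fil n : fil_tensor 1 (inB q' n). Proof. exact: fil_tensor_uinc. Qed.
Let Q'_hom n : hom_tensor (@der_prj k U) false (inB q' n). Proof. exact: inB_q_hom. Qed.
Let stmap_inB_q : stmap phi (inB q) = inB q'.
Proof. by rewrite stmap_inB; apply: funext => n; rewrite /inB qq'. Qed.
Let stmap_inB_p : stmap phi (inB p) = inB p'.
Proof. by rewrite stmap_inB; apply: funext => n; rewrite /inB pp'. Qed.
Let adm_xi : adm (xi_path q). Proof. exact: (psol_adm char0 Q_fil Q_hom). Qed.
Let adm_xi' : adm (xi_path q'). Proof. exact: (psol_adm char0 Q'_fil Q'_hom). Qed.

(** The two solutions are built with unrelated cut-offs. Both are recomputed with the larger one,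
    after which the same formula stands on either side and the iteration is natural. *)
Lemma stmap_xi_path : stmap phi (xi_path q) = xi_path q'.
Proof.
rewrite /xi_path -(psol_widen char0 Q_fil Q_hom (@nidx_nil k A) (leq_maxl _ (nidx A'))).
rewrite -(psol_widen char0 Q'_fil Q'_hom (@nidx_nil k A') (leq_maxr (nidx A) _)).
by rewrite (stmap_pic phiM) stmap_inB_q.
Qed.

Let gexp_xi X : gexp (nidx A) (xi_path q) X = gexp K (xi_path q) X.
Proof. by rewrite (gexp_widen (@nidx_nil k A) _ adm_xi (leq_maxl _ _)). Qed.
Let gexp_xi' X : gexp (nidx A') (xi_path q') X = gexp K (xi_path q') X.
Proof. by rewrite (gexp_widen (@nidx_nil k A') _ adm_xi' (leq_maxr _ _)). Qed.

Lemma stmap_M_path : stmap phi (M_path m p q) = M_path m p' q'.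
Proof.
rewrite /M_path /gaugeM gexp_xi gexp_xi' -!/(gaugeM _ K _) (stmap_gaugeM phiM).
by rewrite stmap_xi_path stmapD stmap_m0 stmap_inB_p.
Qed.

Lemma stmap_Q_path : stmap phi (Q_path q) = Q_path q'.
Proof.
rewrite /Q_path /gaugeQ gexp_xi gexp_xi' -!/(gaugeQ _ K _) (stmap_gaugeQ phiM).
by rewrite stmap_xi_path stmap_inB_q.
Qed.

Lemma tmap_p_path n : tmap phi (p_path m p q n) = p_path m p' q' n.
Proof.
rewrite /p_path tmap_phi_usnd; congr tmap.
have := congr1 (fun f => f n) stmap_M_path; have := congr1 (fun f => f n) (stmap_m0 phi m).
rewrite /stmap => <- <-.
exact: (linear_funB (@tmap_is_linear _ _ _ _ (uphi phi))).
Qed.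

Lemma tmap_q_path n : tmap phi (q_path q n) = q_path q' n.
Proof.
rewrite /q_path tmap_phi_usnd; congr tmap.
by have := congr1 (fun f => f n) stmap_Q_path.
Qed.

Lemma tmap_xi_end Xi Xi' : evals (xi_path q) Xi -> evals (xi_path q') Xi' ->
  tmap (uphi phi) Xi = Xi'.
Proof.
move=> h; apply: evals_inj; rewrite -stmap_xi_path.
exact: (evals_lin (@tmap_is_linear _ _ _ _ (uphi phi)) h).
Qed.

End Path_naturality.

Lemma valT_tmap (k : fieldType) (V : linf_algebra k) (A : formal_cdga k) (i j : findex A)
  (phi : {linear A j -> A i}) (X : tensor (A j) (der (Pi V))) :
  valT (tmap phi X) = tmap phi (valT X).
Proof.
apply: (linear_tensor_eq (f := fun X => valT (tmap phi X)) (g := fun X => tmap phi (valT X)))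
  => [c Y Z|c Y Z|a v].
- by rewrite tmap_is_linear valT_linear.
- by rewrite valT_linear tmap_is_linear.
by rewrite tmap_pure !valT_pure tmap_pure.
Qed.

(** * Assembling the levels *)

Section Gauge_to_twisting.
Variables (k : fieldType) (char0 : [pchar k] =i pred0) (V : linf_algebra k).
Variables (A : formal_cdga k) (x : ctensor A (CE_ops V)).
Variable Z : ctensor A (zdz_ops (CE_ops V)).
Hypothesis x_def : deformation x.
Hypothesis Z_MC : is_MC (zdz_sub (@CE k (Pi V) : set (CE_ops V))) Z.
Hypothesis Z0 : forall i j, zdz_eval 0 (Z i j) = x i j.
Hypothesis Z1 : forall i j, zdz_eval 1 (Z i j) = 0.
Notation U := (Pi V).
Notation g := (CE_ops V).
Notation m := (ldif_der V).

(** The default value 0 of [insubd] never occurs, because the coefficients of Z lie in [CE]. *)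
Definition zpart i n : tensor (A i) (der U) := [ffun j => insubd 0 ((Z i j).1 n)].
Definition dzpart i n : tensor (A i) (der U) := [ffun j => insubd 0 ((Z i j).2 n)].

Lemma zpart_val i n j : der_fun (zpart i n j) = (Z i j).1 n.
Proof.
have [h _ _] := Z_MC i; have [hh _] := h j; have [h1 _] := hh n.
by rewrite ffunE; apply: (insubdK (0 : der U)); apply/CE_predP.
Qed.

Lemma dzpart_val i n j : der_fun (dzpart i n j) = (Z i j).2 n.
Proof.
have [h _ _] := Z_MC i; have [hh _] := h j; have [_ h2] := hh n.
by rewrite ffunE; apply: (insubdK (0 : der U)); apply/CE_predP.
Qed.

Lemma mkZ_parts i : mkZ (zpart i) (dzpart i) = Z i.
Proof.
apply/ffunP => j; rewrite ffunE [RHS]surjective_pairing.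
by congr pair; apply: funext => n; rewrite ?zpart_val ?dzpart_val.
Qed.

Lemma parts_bound i : exists d, forall n, (d <= n)%N -> zpart i n = 0 /\ dzpart i n = 0.
Proof.
have [h _ _] := Z_MC i.
have bj j : {d | forall n, (d <= n)%N -> (Z i j).1 n = 0 /\ (Z i j).2 n = 0}.
  by apply: cid; have [_ hd] := h j.
exists (\max_j projT1 (bj j)) => n dn; split; apply/ffunP => j; apply: val_inj;
  have [e1 e2] := projT2 (bj j) n (leq_trans (leq_bigmax j) dn).
- by rewrite /= zpart_val e1 ffunE.
- by rewrite /= dzpart_val e2 ffunE.
Qed.

Lemma zpart_evals i : evals (zpart i) 0.
Proof.
have [d dZ] := parts_bound i; exists d; split=> [n dn|]; first by have [] := dZ n dn.
apply: valT_inj; rewrite [RHS](linear_fun0 (@valT_linear _ _ _ _)).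
rewrite (linear_fun_sum (@valT_linear _ _ _ _)).
apply/ffunP => j; rewrite sum_ffunE [RHS]ffunE; apply: etrans (Z1 j).
apply/esym/fsum_evals; exists d; split=> [n dn|].
  by rewrite -zpart_val (dZ n dn).1 ffunE scaler0.
by apply: eq_bigr => n _; rewrite expr1n scale1r ffunE zpart_val.
Qed.

Lemma dzpart_fsupp i : fsupp (dzpart i).
Proof. by have [d dZ] := parts_bound i; apply: (@fsuppP _ _ _ d) => n /dZ[]. Qed.

Lemma zdz_eval0 (z : zdz_ops g) : zdz_eval 0 z = z.1 0.
Proof.
apply: fsum_evals; exists 1%N; split=> [[|n]//|]; last by rewrite big_ord1 expr0 scale1r.
by rewrite expr0n scale0r.
Qed.

Lemma zpart_free i j : dfree (zpart i 0 j).
Proof.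
have [h _ _] := x_def i; apply/(dfree_CEbar char0).
by rewrite [der_fun _]zpart_val -zdz_eval0 Z0.
Qed.

Lemma zpart_compat i j n : fle i j -> tmap (ftrans A i j) (zpart j n) = zpart i n.
Proof.
move=> ij; apply: valT_inj; rewrite -(coefz_mkZ (zpart i) (dzpart i)) mkZ_parts -(ct_compat Z ij).
rewrite tmapr_tmap -mkZ_parts coefz_mkZ.
exact: valT_tmap.
Qed.

Lemma dzpart_compat i j n : fle i j -> tmap (ftrans A i j) (dzpart j n) = dzpart i n.
Proof.
move=> ij; apply: valT_inj; rewrite -(coefdz_mkZ (zpart i) (dzpart i)) mkZ_parts -(ct_compat Z ij).
rewrite tmapr_tmap -mkZ_parts coefdz_mkZ.
exact: valT_tmap.
Qed.

Lemma parts_MC i :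
  [/\ forall n, tprj (fun b => aprj (A i) b) (@der_prj k U) true (zpart i n) = zpart i n,
      forall n, tprj (fun b => aprj (A i) b) (@der_prj k U) false (dzpart i n) = dzpart i n,
      MC_eq (m0 (A i) m + inB (zpart i)) &
      flow_eq (m0 (A i) m + inB (zpart i)) (inB (dzpart i))].
Proof. by have [_ Zo Zmc] := Z_MC i; apply/(MC_mkZ char0); rewrite mkZ_parts. Qed.

Let p_odd i := let: And4 h _ _ _ := parts_MC i in h.
Let q_even i := let: And4 _ h _ _ := parts_MC i in h.
Let p_MC i := let: And4 _ _ h _ := parts_MC i in h.
Let pq_flow i := let: And4 _ _ _ h := parts_MC i in h.
Let m_odd : der_prj true m = m. Proof. exact: ldif_der_odd. Qed.
Let m_free : dfree m. Proof. exact: ldif_der_free. Qed.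
Let p_free i j := @zpart_free i j.

(** Obtained by choice, yet determined: the value at 1 of a finitely supported path is unique, and
    this makes the chosen values compatible across levels. *)
Definition xi_end i : tensor (uvec (A i)) U :=
  projT1 (cid (xi_path_fsupp (dzpart_fsupp i))).

Lemma xi_endP i : evals (xi_path (dzpart i)) (xi_end i).
Proof. by rewrite /xi_end; case: cid. Qed.

Lemma xi_end_compat i j : fle i j -> tmap (uphi (ftrans A i j)) (xi_end j) = xi_end i.
Proof.
move=> ij; apply: (tmap_xi_end char0 (ftrans_morph ij) (q_even j) (q_even i) _ (xi_endP j) (xi_endP i)).
by move=> n; exact: dzpart_compat.
Qed.

Definition xi_lev i : tensor (A i) U := tmap (@usnd k (A i)) (tsgn (xi_end i)).

Lemma xi_end_fil i : fil_tensor 1 (xi_end i).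
Proof. exact: (Xi_fil char0 (q_even i) (xi_endP i)). Qed.

Lemma xi_end_hom i : hom_tensor (fun b => sprj U b) false (xi_end i).
Proof. exact: (Xi_hom char0 (q_even i) (xi_endP i)). Qed.

Lemma xi_lev_inc i : inc_tensor (xi_lev i) = tsgn (xi_end i).
Proof. by apply: (@uinc_usnd _ _ _ 1) => //; apply: tmapr_gen (xi_end_fil i). Qed.

Lemma xi_lev_compat i j : fle i j -> tmap (ftrans A i j) (xi_lev j) = xi_lev i.
Proof.
by move=> ij; rewrite /xi_lev tmap_phi_usnd /tsgn -tmapr_tmap xi_end_compat.
Qed.

Definition xi_ct : ctensor A U := CTensor xi_lev_compat.

Definition Y_lev i : tensor (A i) (der U) := Y_end m (xi_end i).

Lemma Y_levP i : evals (p_path m (zpart i) (dzpart i)) (Y_lev i).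
Proof. exact: (p_path_evals m (zpart_evals i) (xi_endP i)). Qed.

Lemma Y_lev_free i j : dfree (Y_lev i j).
Proof.
exact: (Y_end_free char0 m_odd m_free (p_odd i) (q_even i) (pq_flow i)
  (p_free (i := i)) (zpart_evals i) (xi_endP i)).
Qed.

Lemma Y_lev_compat i j : fle i j -> tmap (ftrans A i j) (Y_lev j) = Y_lev i.
Proof.
move=> ij; apply: (evals_inj _ (Y_levP i)).
have := evals_lin (@tmap_is_linear _ _ _ _ (ftrans A i j)) (Y_levP j).
congr evals; apply: funext => n.
apply: (tmap_p_path char0 (ftrans_morph ij) _ (q_even j) (q_even i)) => l.
  exact: zpart_compat.
exact: dzpart_compat.
Qed.

Fact valT_Y_compat i j : fle i j ->
  tmap (ftrans A i j) (valT (Y_lev j)) = valT (Y_lev i).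
Proof. by move=> ij; rewrite -valT_tmap Y_lev_compat. Qed.

Definition Y_ct : ctensor A g := CTensor valT_Y_compat.

Definition Z_lev i : tensor (A i) (zdz_ops g) :=
  mkZ (p_path m (zpart i) (dzpart i)) (q_path (dzpart i)).

Fact Z_lev_compat i j : fle i j -> tmap (ftrans A i j) (Z_lev j) = Z_lev i.
Proof.
move=> ij; apply: zdz_tensor_eq => n; rewrite tmapr_tmap.
  rewrite !coefz_mkZ -valT_tmap; congr valT.
  apply: (tmap_p_path char0 (ftrans_morph ij) _ (q_even j) (q_even i)) => l.
    exact: zpart_compat.
  exact: dzpart_compat.
rewrite !coefdz_mkZ -valT_tmap; congr valT.
apply: (tmap_q_path char0 (ftrans_morph ij) (q_even j) (q_even i)) => l.
exact: dzpart_compat.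
Qed.

Definition Z_ct : ctensor A (zdz_ops g) := CTensor Z_lev_compat.

Lemma Y_ct_deformation : deformation Y_ct.
Proof.
move=> i; have [yo ymc] : todd (g := g) (valT (Y_lev i)) /\
    tdif (g := g) (valT (Y_lev i)) + 2^-1 *: tbra (g := g) (valT (Y_lev i)) (valT (Y_lev i)) = 0.
  apply: (MC_valT char0).
    exact: (Y_end_odd char0 m_odd (p_odd i) (q_even i) (zpart_evals i) (xi_endP i)).
  exact: (Y_end_MC char0 m_odd (p_odd i) (q_even i) (p_MC i) (zpart_evals i) (xi_endP i)).
split=> // j; rewrite ffunE; apply/(dfree_CEbar char0); exact: Y_lev_free.
Qed.

Lemma Z_ct_MC : is_MC (zdz_sub (@CEbar k U : set g)) Z_ct.
Proof.
move=> i; have [] := (MC_mkZ char0 (i := i) (p_path m (zpart i) (dzpart i)) (q_path (dzpart i))).2.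
  split.
  - exact: (p_path_odd char0 m_odd (p_odd i) (q_even i)).
  - exact: (q_path_even char0 (q_even i)).
  - rewrite (inB_p_path char0 m _ (q_even i)); exact: (M_path_MC char0 m_odd (p_odd i) (q_even i) (p_MC i)).
  - rewrite (inB_p_path char0 m _ (q_even i)) (inB_q_path char0 (q_even i)).
    exact: (M_path_flow char0 m_odd (p_odd i) (q_even i) (pq_flow i)).
move=> Zo Zmc; split=> // j; split=> [n|].
  rewrite ffunE /=; split; apply/(dfree_CEbar char0).
    exact: (p_path_free char0 m_odd m_free (p_odd i) (q_even i) (pq_flow i) (p_free (i := i))).
  exact: (q_path_free char0 (q_even i)).
have [y [d [hd _]]] := q_path_fsupp (dzpart_fsupp i).
have [d' [hd' _]] := Y_levP i.
exists (maxn d d') => n; rewrite geq_max => /andP[dn d'n].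
by rewrite ffunE /= hd' // hd // !ffunE.
Qed.

Lemma equivalent_x_Y : equivalent x Y_ct.
Proof.
exists Z_ct; split=> [|i j]; first exact: Z_ct_MC.
split.
  rewrite zdz_eval0 ffunE /= p_path0 zpart_val -zdz_eval0; exact: Z0.
apply: fsum_evals; have [d [hd hs]] := Y_levP i.
exists d; split=> [n dn|]; first by rewrite ffunE /= hd // ffunE scaler0.
rewrite [RHS]/= -hs (linear_fun_sum (@valT_linear _ _ _ _)) sum_ffunE.
by apply: eq_bigr => n _; rewrite expr1n scale1r !ffunE.
Qed.

Let xi_fil i : fil_tensor 1 (inc_tensor (xi_lev i)). Proof. exact: fil_tensor_uinc. Qed.
Let xi_hom i : hom_tensor (fun b => sprj U b) false (inc_tensor (xi_lev i)).
Proof. by rewrite xi_lev_inc; apply: tsgn_hom; exact: xi_end_hom. Qed.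
Let YA_eq i : tmap (@uinc k (A i)) (Y_lev i) =
  gexp1 (nidx (A i)) (tsgn (inc_tensor (xi_lev i))) (mB (A i) m) - mB (A i) m -
  cst (tmap (@udif k (A i)) (tsgn (inc_tensor (xi_lev i)))).
Proof.
by rewrite xi_lev_inc tsgnK; exact: (Y_end_uinc char0 m (q_even i) (xi_endP i)).
Qed.
Let Y_hom i : hom_tensor (@der_prj k U) true (tmap (@uinc k (A i)) (Y_lev i)).
Proof. exact: (Y_end_hom char0 m_odd (p_odd i) (q_even i) (zpart_evals i) (xi_endP i)). Qed.

Lemma xi_ct_twisting : is_twisting xi_ct Y_ct.
Proof.
move=> i s s0; have := twisted_eq char0 m_odd (xi_hom i) (YA_eq i) s0 (Y_hom i).
have <- := fsum_evals (term_evals char0 m_odd (@nidx_nil k (A i)) (xi_fil i) (xi_hom i) s).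
move=> <-; congr tmap; rewrite /tlift; apply: eq_bigr => l _.
by rewrite ffunE.
Qed.

Lemma xi_ct_MC : linf_MC xi_ct.
Proof.
move=> i; split.
  apply: (hom_tprj (pM := fun b => sprj U b) (@sprjK k U)).
  by apply: tsgn_hom; exact: xi_end_hom.
have Yf : dfreeT (tmap (@uinc k (A i)) (Y_lev i)).
  by move=> j; apply: dfree_tmap; exact: Y_lev_free.
rewrite -[RHS](twisting_MC char0 m_odd m_free (xi_hom i) (YA_eq i) Yf); congr (_ + _).
rewrite -(fsum_evals (term_evals char0 m_odd (@nidx_nil k (A i)) (xi_fil i) (xi_hom i) [::])).
(* The index n = 0 is added to the sum, at the cost of checking that its term is zero. *)
rewrite (fsbig_widen _ [set: nat]) //; last first.
  move=> [|n] [_ hn]; last by case: hn.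
  have := term0_nil char0 m_odd m_free (xi_hom i).
  by apply.
by congr (\big[_/_]_(n \in _) _); apply: funext => n; rewrite cats0.
Qed.

End Gauge_to_twisting.

Lemma tensor0E (k : fieldType) (B : vectType k) (M : lmodType k) j : (0 : tensor B M) j = 0.
Proof. by rewrite ffunE. Qed.

Theorem corollary4p11 (k : fieldType) (char0 : [pchar k] =i pred0)
    (V : linf_algebra k) (A : formal_cdga k) (x : ctensor A (CE_ops V)) :
  deformation x ->
  curved_equivalent x (ct0 A (CE_ops V)) ->
  exists xi : ctensor A (Pi V), linf_MC xi /\
    exists y : ctensor A (CE_ops V),
      [/\ deformation y, is_twisting xi y & equivalent x y].
Proof.
move=> x_def [Z [Z_MC Z01]].
have Z0 i j : zdz_eval 0 (Z i j) = x i j by have [] := Z01 i j.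
have Z1 i j : zdz_eval 1 (Z i j) = 0.
  have [_ e] := Z01 i j; apply: (etrans e).
  exact: tensor0E.
exists (xi_ct char0 Z_MC); split; first exact (xi_ct_MC char0 x_def Z_MC Z0 Z1).
(* The given path runs from x at z = 0 to 0 at z = 1. The corrected one still starts at x and ends
   at this deformation. *)
exists (Y_ct char0 Z_MC Z1); split.
- exact (Y_ct_deformation char0 x_def Z_MC Z0 Z1).
- exact (xi_ct_twisting char0 Z_MC Z1).
- exact (equivalent_x_Y char0 x_def Z_MC Z0 Z1).
Qed.
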